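(* Let $p_1,p_2\in[1,\infty)$ satisfy $\frac{p_1p_2}{p_1+p_2-1}\ge 3$. Assume that the ground process $\mathcal P$ has a $p_1$-moment and that the score $\xi$ has a $p_2$-moment. Assume that $\operatorname{Var}H_\lambda=\Omega(\lambda^\nu)$ for some $\nu>2/3$. Let $Z$ be a standard normal random variable. (a) If the score sums satisfy exponential mixing, then $$d_W\Big(\frac{H_\lambda-\mathbb E H_\lambda}{\sqrt{\operatorname{Var}H_\lambda}},Z\Big)=O\big((\log\lambda)^{3d}\lambda^{-1.5\nu+1}\big).$$ (b) If the score sums satisfy polynomial mixing with parameters $\gamma_0,\gamma_1,\gamma_2,\gamma_3$ and $$\gamma_2>\max\Big\{\frac{3(-\nu d+2d+2\gamma_0)}{3\nu-2},\ \frac{6(-\nu d+d+\gamma_0)}{3\nu-2}+\gamma_0\Big\},$$ or equivalently $$\tau(\gamma_0,\gamma_2):=\frac32\Big(\frac{2\nu d+2\gamma_0}{3d+\gamma_2}\vee\frac{\nu d+2\gamma_0}{3d+\gamma_2-\gamma_0}\Big)<\frac32\nu-1,$$ then $$d_W\Big(\frac{H_\lambda-\mathbb E H_\lambda}{\sqrt{\operatorname{Var}H_\lambda}},Z\Big)=O\big(\lambda^{-1.5\nu+1+\tau(\gamma_0,\gamma_2)}\big)=o(1).$$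
   Context: Notation: $a\vee b=\max$, $a\wedge b=\min$, $\|X\|_p=(\mathbb E|X|^p)^{1/p}$. Asymptotics are as $\lambda\to\infty$; $f(\lambda)=\Omega(g(\lambda))$ means $f\ge c\,g$ for some $c>0$ and all large $\lambda$. $d$ is Euclidean distance, also $d(A,B)=\inf\{d(x,y):x\in A,y\in B\}$; $\operatorname{diam}(A)=\sup\{d(x,y):x,y\in A\}$. $d_W(X_1,X_2)=\sup_h|\mathbb E h(X_1)-\mathbb E h(X_2)|$ over all $h:\mathbb R\to\mathbb R$ with $|h(x)-h(y)|\le|x-y|$. Setting. $\mathcal P$ is a simple stationary point process on $\mathbb R^d$, $d\ge1$, with intensity $\mu\in(0,\infty)$. $\mathbb M$ is a measurable (mark) space and $\hat{\mathcal P}=\sum_{x\in\mathcal P}\delta_{(x,M_x)}$ is a simple marked point process on $\mathbb R^d\times\mathbb M$ with ground process $\mathcal P$ (each $x\in\mathcal P$ carries exactly one mark $M_x$; marks may depend on each other and on $\mathcal P$). $\mathcal N_{\mathbb R^d\times\mathbb M}$ is the space of locally finite subsets of $\mathbb R^d\times\mathbb M$ with the evaluation $\sigma$-algebra; $\mathcal B(\cdot)$ denotes Borel sets; $\Gamma_\lambda=[-\tfrac12\lambda^{1/d},\tfrac12\lambda^{1/d}]^d$, $\lambda\in(0,\infty)$. A score is a measurable function $\xi:(\mathbb R^d\times\mathbb M)\times\mathcal N_{\mathbb R^d\times\mathbb M}\times\mathcal B(\mathbb R^d)\to\mathbb R$, with $\xi((x,m_x),\hat{\mathcal X},A)=0$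 when $(x,m_x)\notin\hat{\mathcal X}\cap(A\times\mathbb M)$. For $A\in\mathcal B(\mathbb R^d)$ put $H_{\lambda,A}=\sum_{x\in\mathcal P\cap A}\xi((x,M_x),\hat{\mathcal P},\Gamma_\lambda)$, $H_\lambda=H_{\lambda,\Gamma_\lambda}$, $S_A=S_{\lambda,A}=H_{\lambda,A}-\mathbb E H_{\lambda,A}$. $\mathbb P_x,\mathbb E_x$ denote Palm probability and expectation given a point of $\mathcal P$ at $x$. $\mathcal P$ has a $p_1$-moment if $b_1:=\|\operatorname{card}(\mathcal P\cap\Gamma_1)\|_{p_1}<\infty$. $\xi$ has a $p_2$-moment if $b_2:=\sup_{\lambda\in(0,\infty)}\sup_{x\in\Gamma_\lambda}(\mathbb E_x|\xi((x,M_x),\hat{\mathcal P},\Gamma_\lambda)|^{p_2})^{1/p_2}<\infty$. Mixing of score sums. Let $\mathcal H_1$ be the class of open hyperrectangles in $\mathbb R^d$ with sides of length at least one and faces parallel to the coordinate planes, and $\mathcal H_2$ the class of unions of two incident hyperrectangles in $\mathcal H_1$. Let $\mathcal F_b=\{g:\mathbb R\to\mathbb R:\|g\|_\infty\vee\|g'\|_\infty\le1\}$, $\mathcal F_1=\mathcal F_b\cup\{x\mapsto x\}$, $\mathcal F_2=\mathcal F_b$. The score sums satisfy exponential mixing if there exist $\lambda_0\in(0,\infty)$ and positive constants $\gamma_0,\gamma_1,\gamma_2,\gamma_3$ such that for all $\lambda\ge\lambda_0$, $j\in\{1,2\}$, $g\in\mathcal F_j$, $A\in\mathcal H_j$, and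 all $B\in\mathcal B(\Gamma_\lambda)$ that are finite unions of disjoint hyperrectangles in $\mathcal H_1$ with $d(A,B)\ge\gamma_3[\log(\operatorname{diam}(A)\vee\operatorname{diam}(B))\vee1]$, $$|\operatorname{Cov}(S_A^j,g(S_B))|\le\gamma_1(\operatorname{diam}(A)^{\gamma_0}\vee1)(\operatorname{diam}(B)^{\gamma_0}\vee1)e^{-\gamma_2d(A,B)}.$$ They satisfy polynomial mixing (with parameters $\gamma_0,\dots,\gamma_3$) if the same holds with right-hand side replaced by $\gamma_1(\operatorname{diam}(A)^{\gamma_0}\vee1)(\operatorname{diam}(B)^{\gamma_0}\vee1)d(A,B)^{-\gamma_2}$. *)

(* Defs.v *)
From HB Require Import structures.
From mathcomp Require Import all_boot all_order all_algebra finmap.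
From mathcomp Require Import all_classical all_reals all_analysis.
From mathcomp Require Import measurable_realfun.

Set Implicit Arguments.
Unset Strict Implicit.
Unset Printing Implicit Defensive.

Import Order.TTheory GRing.Theory Num.Theory.
Import numFieldNormedType.Exports.

Local Open Scope classical_set_scope.
Local Open Scope ring_scope.

(* R^d is [d.-tuple R]; its library sigma-algebra, generated by the coordinate
   maps, is the Borel sigma-algebra. *)

Section geometry.
Context {R : realType} {d : nat}.
Local Notation pt := (d.-tuple R).
Implicit Types (x y v a b : pt) (A B : set pt).

Definition edist x y : R :=
  Num.sqrt (\sum_(i < d) (tnth x i - tnth y i) ^+ 2).

Definition set_dist A B : R := inf [set edist x y | x in A & y in B].

Definition diam A : R := sup [set edist x y | x in A & y in A].

Definition bounded_region A : Prop :=
  exists r : R, forall x y, A x -> A y -> edist x y <= r.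

Definition translate v x : pt := [tuple tnth x i + tnth v i | i < d].

Definition window (lam : R) : set pt :=
  [set x | forall i : 'I_d,
     - (lam `^ d%:R^-1 / 2) <= tnth x i <= lam `^ d%:R^-1 / 2].

Definition open_box a b : set pt :=
  [set x | forall i : 'I_d, tnth a i < tnth x i < tnth b i].

Definition closed_box a b : set pt :=
  [set x | forall i : 'I_d, tnth a i <= tnth x i <= tnth b i].

Definition long_sides a b : Prop :=
  forall i : 'I_d, 1 <= tnth b i - tnth a i.

Definition hyperrect1 A : Prop :=
  exists a b, long_sides a b /\ A = open_box a b.

(* Two open boxes are incident when their closures meet; a box is incident to
   itself. *)
Definition hyperrect2 A : Prop :=
  exists a b a' b',
    [/\ long_sides a b, long_sides a' b',
        closed_box a b `&` closed_box a' b' !=set0 &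
        A = open_box a b `|` open_box a' b'].

Definition disjoint_hyperrects B : Prop :=
  exists (n : nat) (F : 'I_n -> set pt),
    [/\ forall i, hyperrect1 (F i), trivIset setT F & B = \bigcup_i F i].

End geometry.

(* Locally finite subsets of a space E whose points have a position in R^d.
   Position [fst] on R^d * M gives N_{R^d * M}: locally finite means finitely
   many points over each bounded region, since M carries no topology.
   Position [id] on R^d gives the unmarked configurations. *)
Definition locally_finite {R : realType} {d : nat} {E : Type}
    (pos : E -> d.-tuple R) (phi : set E) : Prop :=
  forall A : set (d.-tuple R), bounded_region A ->
    finite_set (phi `&` pos @^-1` A).

Record config {R : realType} {d : nat} {E : Type} (pos : E -> d.-tuple R) :=
  Config { points :> set E ; points_locally_finite : locally_finite pos points }.

Section config_space.
Context {R : realType} {d : nat} {dE : measure_display} {E : measurableType dE}.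
Variable pos : E -> d.-tuple R.

Lemma locally_finite0 : locally_finite pos set0.
Proof. by move=> A _; rewrite set0I; exact: finite_set0. Qed.

HB.instance Definition _ := gen_eqMixin (config pos).
HB.instance Definition _ := gen_choiceMixin (config pos).
HB.instance Definition _ :=
  isPointed.Build (config pos) (Config locally_finite0).

Definition evaluation_generators : set (set (config pos)) :=
  \bigcup_(D in @measurable _ E)
    preimage_set_system setT
      (fun phi : config pos => counting (phi `&` D) : \bar R)
      (measurable : set (set (\bar R))).

HB.instance Definition _ :=
  Measurable.copy (config pos) (g_sigma_algebraType evaluation_generators).

Lemma measurable_evaluation (D : set E) : measurable D ->
  measurable_fun setT
    (fun phi : config pos => counting (phi `&` D) : \bar R).
Proof.
move=> mD _ B mB; apply: sub_sigma_algebra.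
by exists D => //; exists B.
Qed.

End config_space.

Section ground_process.
Context {R : realType} {d : nat}.
Local Notation pt := (d.-tuple R).

Definition point_config := config (@id pt).
Definition marked_config (M : Type) := config (@fst pt M).

Lemma locally_finite_ground (M : Type) (phi : marked_config M) :
  locally_finite (@id pt) (fst @` phi).
Proof.
move=> A bA; apply: (@sub_finite_set _ _ (fst @` (phi `&` fst @^-1` A))); last first.
  exact/finite_image/points_locally_finite.
by move=> _ [[z z2 <-] Az]; exists z.
Qed.

Definition ground (M : Type) (phi : marked_config M) : point_config :=
  Config (locally_finite_ground phi).

Lemma edist_translate (v x y : pt) :
  edist (translate v x) (translate v y) = edist x y.
Proof.
rewrite /edist; congr Num.sqrt; apply: eq_bigr => i _.
by rewrite !tnth_mktuple opprD addrACA subrr addr0.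
Qed.

Lemma locally_finite_shift (v : pt) (phi : point_config) :
  locally_finite (@id pt) (translate v @` phi).
Proof.
move=> A [r Ar]; set B := translate v @^-1` A.
have bB : bounded_region B.
  by exists r => x y Bx By; rewrite -(edist_translate v); exact: Ar.
apply: (@sub_finite_set _ _ (translate v @` (phi `&` B))); last first.
  by apply: finite_image; move: bB; exact: (points_locally_finite phi).
by move=> _ [[x px <-] Ax]; exists x.
Qed.

Definition shift (v : pt) (phi : point_config) : point_config :=
  Config (locally_finite_shift v phi).

End ground_process.
Arguments point_config : clear implicits.
Arguments marked_config : clear implicits.

Lemma counting_image_inj {R : realType} (T T' : choiceType) (f : T -> T')
  (A : set T) : {in A &, injective f} -> counting (f @` A) = counting A :> \bar R.
Proof.
move=> fI; have [fA|nfA] := pselect (finite_set A).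
  have ffA : finite_set (f @` A) by exact: finite_image.
  rewrite /counting !asboolT// fset_set_image//.
  rewrite card_in_imfset//= => x y; rewrite !in_fset_set//; exact: fI.
rewrite /counting !asboolF// => ffA; apply: nfA.
by rewrite -(eq_finite_set (inj_card_eq fI)).
Qed.

Lemma counting_ge0 {R : realType} (T : choiceType) (A : set T) :
  (0 <= counting A :> \bar R)%E.
Proof. by rewrite /counting; case: ifPn; rewrite ?lee_fin ?lee_pinfty. Qed.

Lemma counting_bigcup {R : realType} (T : pointedType) (F : (set T)^nat) :
  trivIset setT F ->
  counting (\bigcup_n F n) = (\sum_(0 <= n <oo) counting (F n))%E :> \bar R.
Proof.
move=> tF; pose T' := g_sigma_algebraType (@setT (set T)).
have mT' (A : set T') : measurable A by exact: sub_sigma_algebra.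
rewrite (@measure_bigcup _ R T' (@counting T R) setT F)//.
by apply: eq_eseriesl => n; rewrite in_setT.
Qed.

Section marked_point_processes.
Context {R : realType} {d : nat} {dM dO : measure_display}.
Context {M : measurableType dM} {Om : measurableType dO}.
Variable P : probability Om R.
Local Notation pt := (d.-tuple R).
Local Notation conf := (marked_config R d M).

(* Being set-valued, such a process is simple. *)
Record marked_point_process := MarkedPointProcess {
  process :> {mfun Om >-> conf} ;
  unique_mark : forall (w : Om) (x : pt) (m m' : M),
    points (process w) (x, m) -> points (process w) (x, m') -> m = m'
}.

Variable X : marked_point_process.

Definition num_points (B : set pt) (w : Om) : \bar R :=
  counting (ground (X w) `&` B).

Definition stationary : Prop :=
  forall (v : pt) (E : set (point_config R d)), measurable E ->
    P [set w | E (shift v (ground (X w)))] = P [set w | E (ground (X w))].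

Definition has_intensity (mu : R) : Prop :=
  (\int[P]_w num_points (window 1) w = mu%:E)%E.

Definition intensity_measure (B : set pt) : \bar R :=
  (\int[P]_w num_points B w)%E.

Lemma num_pointsE (B : set pt) (w : Om) :
  num_points B w = counting (points (X w) `&` (B `*` setT)).
Proof.
rewrite -(counting_image_inj (f := fst)); last first.
  move=> [x m] [y m'] /set_mem[/= Xx _] /set_mem[/= Xy _] xy.
  by subst y; rewrite (unique_mark Xx Xy).
congr counting; apply/seteqP; split=> [_ [[z Xz <-] Bz]|_ [z [Xz [Bz _]] <-]].
  by exists z.
by split=> //; exists z.
Qed.

Lemma measurable_num_points (B : set pt) : measurable B ->
  measurable_fun setT (num_points B).
Proof.
move=> mB.
have mBT : measurable (B `*` [set: M]) by exact: measurableX.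
have -> : num_points B =
    (fun phi : conf => counting (phi `&` (B `*` setT))) \o X.
  by apply/funext => w; rewrite num_pointsE.
apply: measurableT_comp; last exact: measurable_funPT.
exact: (@measurable_evaluation _ _ _ _ fst).
Qed.

Let intensity_measure0 : intensity_measure set0 = 0%E.
Proof.
rewrite /intensity_measure integral0_eq// => w _.
by rewrite /num_points setI0 /counting asboolT// fset_set0.
Qed.

Let intensity_measure_ge0 B : (0 <= intensity_measure B)%E.
Proof. by apply: integral_ge0 => w _; exact: counting_ge0. Qed.

Let intensity_measure_sigma_additive : semi_sigma_additive intensity_measure.
Proof.
move=> F mF tF mUF.
have -> : intensity_measure (\bigcup_n F n) =
    (\sum_(0 <= n <oo) intensity_measure (F n))%E.
  rewrite /intensity_measure -integral_nneseries//; last 1 first.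
    by move=> n; exact: measurable_num_points.
  apply: eq_integral => w _; rewrite /num_points setI_bigcupr.
  by rewrite counting_bigcup//; exact: trivIset_setIl.
by apply: is_cvg_ereal_nneg_natsum_cond => n _ _; exact: intensity_measure_ge0.
Qed.

HB.instance Definition _ := isMeasure.Build _ _ _ intensity_measure
  intensity_measure0 intensity_measure_ge0 intensity_measure_sigma_additive.

(* Palm distributions of the marked configuration given a point of the ground
   process: a disintegration of the Campbell measure with respect to the
   intensity measure, which is mu times Lebesgue measure in the stationary
   case. Such a kernel is determined up to null sets of locations. *)
Definition is_palm (palm : R.-pker pt ~> conf) : Prop :=
  forall (B : set pt) (E : set conf), measurable B -> measurable E ->
    (\int[P]_(w in X @^-1` E) num_points B w =
     \int[intensity_measure]_(x in B) palm x E)%E.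

Definition has_point_moment (p : R) : Prop :=
  ('N[P]_(p%:E)[num_points (window 1)] < +oo)%E.

Section scores.
Variable xi : pt * M -> conf -> set pt -> R.

Definition is_score : Prop :=
  (forall A, measurable A ->
     measurable_fun setT (fun z : (pt * M) * conf => xi z.1 z.2 A)) /\
  (forall x m (phi : conf) A, measurable A ->
     ~ (points phi (x, m) /\ A x) -> xi (x, m) phi A = 0).

(* The score of the point at x. When exactly one m satisfies (x, m) \in phi,
   as holds for the configurations of a marked point process, this is
   xi (x, m) phi A. *)
Definition score_at (x : pt) (phi : conf) (A : set pt) : R :=
  \sum_(m \in [set m | points phi (x, m)]) xi (x, m) phi A.

Definition has_score_moment (palm : R.-pker pt ~> conf) (p : R) : Prop :=
  (ereal_sup [set 'N[palm z.2]_(p%:E)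
                    [(fun phi => (score_at z.2 phi (window z.1))%:E)]
             | z in [set z : R * pt | (0 < z.1)%R /\ window z.1 z.2]]
   < +oo)%E.

(* The sum has finite support: the score vanishes outside the window, which
   contains finitely many points. *)
Definition score_sum (lam : R) (A : set pt) (w : Om) : R :=
  \sum_(x \in points (ground (X w)) `&` A) score_at x (X w) (window lam).

Definition total_score (lam : R) : Om -> R := score_sum lam (window lam).

Definition centered_score_sum (lam : R) (A : set pt) (w : Om) : R :=
  score_sum lam A w - fine 'E_P[score_sum lam A].

Definition normalized_score (lam : R) (w : Om) : R :=
  (total_score lam w - fine 'E_P[total_score lam]) /
    Num.sqrt (fine 'V_P[total_score lam]).

Definition bounded_test (g : R -> R) : Prop :=
  forall x, [/\ derivable g x 1, `|g x| <= 1 & `|(g^`())%classic x| <= 1].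

Definition mixing_test (j : nat) (g : R -> R) (A : set pt) : Prop :=
  (j = 1%N /\ (bounded_test g \/ g = id) /\ hyperrect1 A) \/
  (j = 2%N /\ bounded_test g /\ hyperrect2 A).

Definition mixing (g0 g1 g3 : R) (rate : R -> R) : Prop :=
  exists2 lam0 : R, 0 < lam0 &
    forall lam, lam0 <= lam ->
    forall (j : nat) (g : R -> R) (A B : set pt), mixing_test j g A ->
      disjoint_hyperrects B -> B `<=` window lam ->
      g3 * Num.max (ln (Num.max (diam A) (diam B))) 1 <= set_dist A B ->
    (`| covariance P (fun w => (centered_score_sum lam A w ^+ j)%R)
                     (fun w => g (centered_score_sum lam B w)) |
     <= (g1 * Num.max (diam A `^ g0) 1 * Num.max (diam B `^ g0) 1
            * rate (set_dist A B))%:E)%E.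

Definition exponential_mixing : Prop :=
  exists g0 g1 g2 g3 : R, [/\ 0 < g0, 0 < g1, 0 < g2 & 0 < g3] /\
    mixing g0 g1 g3 (fun r => expR (- g2 * r)).

Definition polynomial_mixing (g0 g1 g2 g3 : R) : Prop :=
  [/\ 0 < g0, 0 < g1, 0 < g2 & 0 < g3] /\
    mixing g0 g1 g3 (fun r => r `^ (- g2)).

End scores.
End marked_point_processes.

Definition wasserstein {R : realType} {d1 d2 : measure_display}
    {T1 : measurableType d1} {T2 : measurableType d2}
    (P1 : probability T1 R) (X1 : T1 -> R)
    (P2 : probability T2 R) (X2 : T2 -> R) : \bar R :=
  ereal_sup [set `| 'E_P1[h \o X1] - 'E_P2[h \o X2] |%E
            | h in [set h : R -> R | forall x y, `|h x - h y| <= `|x - y|]].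

Definition tau {R : realType} (d : nat) (nu g0 g2 : R) : R :=
  3 / 2 * Num.max ((2 * nu * d%:R + 2 * g0) / (3 * d%:R + g2))
                  ((nu * d%:R + 2 * g0) / (3 * d%:R + g2 - g0)).

(* Main.v *)
(* Cut the window into n^d equal open cubes of side s. Almost surely no point
   lies on a face, so the centered total score is the sum of the centered score
   sums Y_k over the cubes. By mixing, Y_k is almost uncorrelated with functions
   of the sum over the cubes that are not neighbours of k, and Y_k Y_l, for
   neighbours k and l, with functions of the sum over the cubes that neighbour
   neither (polarization reduces the product to squares of score sums over unions
   of two incident cubes). Stein's method for such local dependence bounds the
   Wasserstein distance by n^d t^3 / sigma^3 up to mixing errors, where t is a
   uniform bound for the L^3 norms of the Y_k.

   For t, the cubed sum of scores in a unit cube is, by Young's inequality,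
   bounded by N^p1 plus the sum of the p2-th powers of the scores, N being the
   number of points; stationarity and Campbell's formula bound the expectations
   uniformly, so t is of order s^d.

   This gives the order lam s^(2d) / sigma^3. In (a) s is a large multiple of
   ln lam. In (b) s = lam^(tau/(2d)), the scale at which s^(2d) = lam^tau; that the
   mixing error does not dominate there uses nu <= 2, which follows from the
   third moment bound applied to the whole window. *)
Require Import Defs.
From HB Require Import structures.
From mathcomp Require Import all_boot all_order all_algebra finmap.
From mathcomp Require Import all_classical all_reals all_analysis.
From mathcomp Require Import measurable_realfun.
From mathcomp Require Import ring lra.

Set Implicit Arguments.
Unset Strict Implicit.
Unset Printing Implicit Defensive.

Import Order.TTheory GRing.Theory Num.Theory.
Import numFieldNormedType.Exports.

Local Open Scope classical_set_scope.
Local Open Scope ring_scope.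

(** The test [id] in the mixing condition serves the variance: it compares [sigma ^+ 2] with the sum
    of the covariances of neighbouring cubes, which is what Stein's identity produces. All other
    tests are bounded, being rescalings of Stein's solution or of its derivative. The solution must
    therefore have two bounded derivatives, so a Lipschitz test function is first replaced by a
    differentiable one. The assumption on [p1] and [p2] is exactly the exponent condition behind the
    inequality n^2 y^3 <= n^(p1-1) + y^p2 for n >= 1 and y >= 0; summed over the n points of a cube
    it separates the number of points from the scores. A score depends on the whole configuration,
    so Campbell's formula is required for functions of a location and a configuration. Both of its
    sides are integrals against mixtures of measures that agree on rectangles. Only the dependence
    on [lam] matters, so constants are crude: a b c <= a^3 + b^3 + c^3 takes the place of Hoelder's
    inequality throughout. *)

(** * Mixtures of measures *)

Section mixture.
Context d d' (Y : measurableType d) (T : measurableType d') (R : realType).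
Variables (mu : {measure set Y -> \bar R}) (k : Y -> {measure set T -> \bar R}).
Hypothesis mk : forall U, measurable U -> measurable_fun setT (k ^~ U).

(** The measurability proof is an argument because the measure structure declared on [mixture mk]
    rests on it. *)
Definition mixture of (forall U, measurable U -> measurable_fun setT (k ^~ U)) :=
  fun U : set T => (\int[mu]_y k y U)%E.

Local Notation mix := (mixture mk).

Let mixture0 : mix set0 = 0%E.
Proof. by rewrite /mixture integral0_eq// => y _; rewrite measure0. Qed.

Let mixture_ge0 U : (0 <= mix U)%E. Proof. exact: integral_ge0. Qed.

Let mixture_sigma_additive : semi_sigma_additive mix.
Proof.
move=> U mU tU mUU; rewrite [X in _ --> X](_ : _ =
  (\int[mu]_y (\sum_(n <oo) k y (U n)))%E); last first.
  apply: eq_integral => y _.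
  by apply/esym/cvg_lim => //; exact/measure_semi_sigma_additive.
apply/cvg_closeP; split.
  by apply: is_cvg_nneseries => n _ _; exact: integral_ge0.
by rewrite closeE// integral_nneseries// => n; exact: mk.
Qed.

HB.instance Definition _ := isMeasure.Build _ _ R mix
  mixture0 mixture_ge0 mixture_sigma_additive.

Import HBNNSimple.

Let integral_mixture_nnsfun (f : {nnsfun T >-> R}) :
  (\int[mix]_z (f z)%:E = \int[mu]_y (\int[k y]_z (f z)%:E))%E.
Proof.
under [in LHS]eq_integral do rewrite fimfunE -fsumEFin//.
rewrite ge0_integral_fsum//; last 2 first.
  - by move=> r; exact/measurable_EFinP/measurableT_comp.
  - by move=> r z _; rewrite EFinM nnfun_muleindic_ge0.
under [in RHS]eq_integral.
  move=> y _.
  under eq_integral.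
    by move=> z _; rewrite fimfunE -fsumEFin//; over.
  rewrite /= ge0_integral_fsum//; last 2 first.
    - by move=> r; exact/measurable_EFinP/measurableT_comp.
    - by move=> r z _; rewrite EFinM nnfun_muleindic_ge0.
  under eq_fsbigr.
    move=> r _.
    rewrite (integralZl_indic _ (fun r => f @^-1` [set r]))//; last first.
      by move=> r0; rewrite preimage_nnfun0.
    rewrite integral_indic// setIT.
    over.
  over.
rewrite /= ge0_integral_fsum//; last 2 first.
  - by move=> r; apply: measurable_funeM; exact: mk.
  - move=> n y _.
    have := mulemu_ge0 (fun n => f @^-1` [set n]).
    by apply; exact: preimage_nnfun0.
apply: eq_fsbigr => r _.
rewrite (integralZl_indic _ (fun r => f @^-1` [set r]))//; last first.
  exact: preimage_nnfun0.
rewrite integral_indic// setIT.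
have [r0|r0] := leP 0%R r.
  by rewrite ge0_integralZl//; exact: mk.
rewrite preimage_nnfun0// measure0 mule0.
by rewrite integral0_eq// => y _; rewrite measure0 mule0.
Qed.

(** Simple functions first, then monotone convergence for the mixture, for [mu] and for each [k y].
    The masses of the measures [k y] may be unbounded in [y], as are those of the counting measures
    in Campbell's formula. *)
Lemma ge0_integral_mixture (f : T -> \bar R) :
  (forall z, 0 <= f z)%E -> measurable_fun setT f ->
  (\int[mix]_z f z = \int[mu]_y (\int[k y]_z f z))%E.
Proof.
move=> f0 mf.
pose f_ := nnsfun_approx measurableT mf.
transitivity (\int[mix]_z (lim ((f_ n z)%:E @[n --> \oo])))%E.
  by apply/eq_integral => z _; apply/esym/cvg_lim => //=; exact: cvg_nnsfun_approx.
rewrite monotone_convergence//; last 3 first.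
  by move=> n; exact/measurable_EFinP.
  by move=> n z _; rewrite lee_fin.
  by move=> z _ a b ab; rewrite lee_fin; exact/lefP/nd_nnsfun_approx.
rewrite (_ : (fun _ => _) =
    (fun n => \int[mu]_y (\int[k y]_z (f_ n z)%:E)))%E//; last first.
  by apply/funext => n; rewrite integral_mixture_nnsfun.
transitivity (\int[mu]_y lim ((\int[k y]_z (f_ n z)%:E) @[n --> \oo]))%E.
  rewrite -monotone_convergence//; last 3 first.
  - move=> n; apply: measurable_fun_integral_kernel => //.
    + by move=> z; rewrite lee_fin.
    + exact/measurable_EFinP.
  - by move=> n y _; apply: integral_ge0 => // z _; rewrite lee_fin.
  - move=> y _ a b ab; apply: ge0_le_integral => //.
    + by move=> z _; rewrite lee_fin.
    + exact/measurable_EFinP.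
    + exact/measurable_EFinP.
    + by move=> z _; rewrite lee_fin; exact/lefP/nd_nnsfun_approx.
apply: eq_integral => y _; rewrite -monotone_convergence//; last 3 first.
  - by move=> n; exact/measurable_EFinP.
  - by move=> n z _; rewrite lee_fin.
  - by move=> z _ a b ab; rewrite lee_fin; exact/lefP/nd_nnsfun_approx.
by apply: eq_integral => z _; apply/cvg_lim => //; exact: cvg_nnsfun_approx.
Qed.

End mixture.

(** * The standard normal density *)

Section gaussian.
Context {R : realType}.
Local Notation mu := (@lebesgue_measure R).
Local Notation phi := (@normal_pdf R 0 1).

Let phiE x : phi x = normal_peak 1 * expR (- x ^+ 2 / 2).
Proof. by rewrite normal_pdfE ?oner_eq0// /normal_fun subr0 expr1n. Qed.

Lemma normal_pdf_gt0 x : 0 < phi x.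
Proof. by rewrite phiE mulr_gt0 ?expR_gt0// normal_peak_gt0 ?oner_eq0. Qed.

Lemma normal_pdfN x : phi (- x) = phi x.
Proof. by rewrite !phiE sqrrN. Qed.

Lemma is_derive_normal_pdf (x : R) : is_derive x 1 phi (- x * phi x).
Proof.
have -> : phi = (fun x => normal_peak 1 * expR (- x ^+ 2 / 2)).
  by apply/funext => y; exact: phiE.
apply: is_derive_eq.
by rewrite /GRing.scale/=; field.
Qed.

Let density (x : measurableTypeR R) : {measure set (measurableTypeR R) -> \bar R} :=
  mscale (NngNum (normal_pdf_ge0 0 1 x)) (\d_x).

Let measurable_density U : measurable U -> measurable_fun setT (density ^~ U).
Proof.
move=> mU; rewrite /density/= /mscale/=.
apply: emeasurable_funM.
  by apply/measurable_EFinP; exact: measurable_normal_pdf.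
rewrite [X in measurable_fun _ X](_ : _ = EFin \o \1_U)//.
by apply/measurable_EFinP; exact: measurable_indic.
Qed.

(** The normal law is the mixture, over Lebesgue measure, of point masses of weight [phi x] at [x],
    so integration against a mixture applies. *)
Lemma ge0_integral_normal (f : R -> \bar R) :
  (forall z, 0 <= f z)%E -> measurable_fun (setT : set (measurableTypeR R)) f ->
  (\int[normal_prob 0 1]_z f z = \int[mu]_z ((phi z)%:E * f z))%E.
Proof.
move=> f0 mf.
transitivity (\int[mixture mu measurable_density]_z f z)%E.
  apply: eq_measure_integral => A mA _.
  rewrite /= /mixture /normal_prob [LHS]integral_mkcond; apply: eq_integral => x _.
  rewrite /= /mscale/= diracE patchE.
  by case: ifPn => _; rewrite ?mule1 ?mule0.
rewrite ge0_integral_mixture//; apply: eq_integral => x _.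
rewrite ge0_integral_mscale//= integral_dirac//.
by rewrite diracT mul1e.
Qed.

Let continuous_phi : continuous phi.
Proof. by apply: continuous_normal_pdf; exact: oner_neq0. Qed.

Let phi_cvgy : phi x @[x --> +oo] --> (0 : R).
Proof.
apply: (@squeeze_cvgr _ _ _ _ (cst 0) (fun x => normal_peak 1 * expR (- x))).
- near=> x; rewrite /= ltW ?normal_pdf_gt0//= phiE.
  rewrite ler_wpM2l ?normal_peak_ge0// ler_expR mulNr lerN2.
  have : 2 <= x by near: x; exact: nbhs_pinfty_ge.
  by move=> x2; nra.
- exact: cvg_cst.
- rewrite -[X in _ --> X](mulr0 (normal_peak 1)).
  by apply: cvgM; [exact: cvg_cst|exact: cvgr_expR].
Unshelve. all: by end_near. Qed.

(** [- phi] is an antiderivative of [t * phi t] and vanishes at infinity. This exact value yields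
    the decay of [F] in Stein's equation. *)
Lemma integral_tail_normal_pdf (a : R) : 0 <= a ->
  (\int[mu]_(t in `[a, +oo[) (t * phi t)%:E = (phi a)%:E)%E.
Proof.
move=> a0.
have := @ge0_continuous_FTC2y R (fun t => t * phi t) (fun t => - phi t) a 0.
rewrite EFinN oppeK add0e; apply.
- by move=> x ax; rewrite mulr_ge0 ?normal_pdf_ge0// (le_trans a0).
- apply: continuous_subspaceT => x.
  by apply: cvgM; [exact: cvg_id|exact: continuous_phi].
- by rewrite -[X in _ --> X]oppr0; apply: (@cvgN _ R^o); exact: phi_cvgy.
- move=> x _; apply: derivableN; by case: (is_derive_normal_pdf x).
- by apply: cvg_at_right_filter; apply: (@cvgN _ R^o); exact: continuous_phi.
- move=> x _; rewrite derive1E deriveN; last first.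
    by case: (is_derive_normal_pdf x).
  by rewrite (@derive_val _ _ _ _ _ _ _ (is_derive_normal_pdf x)); lra.
Qed.

Lemma integral_tailN_normal_pdf (a : R) : 0 <= a ->
  (\int[mu]_(t in `]-oo, (- a)%R]) (`|t| * phi t)%:E = (phi a)%:E)%E.
Proof.
move=> a0; rewrite -integral_tail_normal_pdf//.
rewrite ge0_integration_by_substitutionNy//.
- apply: eq_integral => t /[!inE]/=; rewrite in_itv/= andbT => at_.
  by rewrite normrN normal_pdfN ger0_norm// (le_trans a0).
- apply: continuous_subspaceT => x.
  by apply: cvgM; [exact: norm_continuous|exact: continuous_phi].
- by move=> x _; rewrite mulr_ge0 ?normal_pdf_ge0.
Qed.

Lemma integrable_normr_normal_pdf :
  mu.-integrable setT (fun t => (`|t| * phi t)%:E).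
Proof.
(* Domination by a multiple of the normal density of variance 2: [|t| <= expR (t ^+ 2 / 4)], because
   [expR u >= 1 + u] and the square of [|t| - 2] is nonnegative. *)
have c2 : mu.-integrable setT
    (fun t => ((normal_peak 1 / normal_peak (Num.sqrt 2))%:E *
               (normal_pdf 0 (Num.sqrt 2) t)%:E)%E).
  by apply: integrableZl => //; exact: integrable_normal_pdf.
have sqrt20 : Num.sqrt 2 != 0 :> R by rewrite sqrtr_eq0 -ltNge.
apply: le_integrable c2 => //.
  apply/measurable_EFinP/measurable_funM => //.
  exact: measurable_normal_pdf.
move=> t _; rewrite -EFinM !abse_EFin lee_fin.
rewrite ger0_norm ?mulr_ge0 ?normal_pdf_ge0//.
rewrite ger0_norm ?mulr_ge0 ?invr_ge0 ?normal_peak_ge0 ?normal_pdf_ge0//.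
rewrite (normal_pdfE 0 sqrt20) [leRHS]mulrA divfK ?gt_eqF ?normal_peak_gt0//.
rewrite phiE mulrCA ler_wpM2l ?normal_peak_ge0//.
rewrite /normal_fun subr0 sqr_sqrtr//.
have -> : - t ^+ 2 / 2 = - t ^+ 2 / (2 *+ 2) + - t ^+ 2 / (2 *+ 2) by field.
rewrite expRD mulrA ler_piMl ?expR_ge0//.
rewrite -ler_pdivlMr ?expR_gt0// div1r -expRN.
apply: le_trans (expR_ge1Dx _).
have -> : - (- t ^+ 2 / (2 *+ 2)) = `|t| ^+ 2 / 4 by rewrite real_normK ?num_real//; field.
by have := sqr_ge0 (`|t| - 2); rewrite sqrrB; lra.
Qed.

Definition normal_abs_mean : R := \int[mu]_t (`|t| * phi t).

Lemma normal_abs_mean_ge0 : 0 <= normal_abs_mean.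
Proof. by apply: Rintegral_ge0 => t _; rewrite mulr_ge0 ?normal_pdf_ge0. Qed.

End gaussian.

(** * Mean value theorem and a Mills-type bound *)

Lemma is_derive_MVT (R : realType) (f df : R -> R) (a b : R) :
  (forall x : R, is_derive x 1 f (df x)) ->
  exists c, f b - f a = df c * (b - a).
Proof.
move=> fdf; wlog ab : a b / a <= b => [hw|].
  have [/hw//|/ltW/hw[c fab]] := leP a b; exists c.
  by rewrite -opprB fab -mulrN opprB.
have [|c _ ->] := @MVT_segment R f df a b ab.
  by apply: derivable_within_continuous => x _; case: (fdf x).
by exists c.
Qed.

Lemma is_derive_lipschitz (R : realType) (f df : R -> R) (C : R) :
  (forall x : R, is_derive x 1 f (df x)) -> (forall x, `|df x| <= C) ->
  forall x y, `|f x - f y| <= C * `|x - y|.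
Proof.
move=> fdf dfC x y; have [c ->] := is_derive_MVT y x fdf.
by rewrite normrM ler_wpM2r.
Qed.

Section mills_bound.
Context {R : realType}.
Local Notation phi := (@normal_pdf R 0 1).

Lemma normal_pdf_le_inv (y : R) : phi y <= normal_peak 1 / (1 + y ^+ 2 / 2).
Proof.
rewrite normal_pdfE ?oner_eq0// ler_wpM2l ?normal_peak_ge0//.
rewrite /normal_fun subr0 expr1n mulNr expRN lef_pV2 ?posrE ?expR_gt0//.
  exact: expR_ge1Dx.
by rewrite ltr_wpDr// divr_ge0// sqr_ge0.
Qed.

(** Suppose [x * g x > B]. Then [G y = (g y - B / x) * phi y] is positive at [x] and its derivative
    [(k y + B / x * y) * phi y] is nonnegative for [y >= x], so [G] stays above [G x]. But [g] grows
    at most linearly and [phi] decays at least quadratically, which forces [G] below [G x]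
    eventually. *)
Lemma mills_upper (g k : R -> R) (B C : R) :
  (forall x : R, is_derive x 1 g (x * g x + k x)) ->
  (forall x, `|k x| <= B) -> (forall x, `|g x| <= C * (1 + `|x|)) ->
  forall x, 0 <= x -> x * g x <= B.
Proof.
move=> dg kB gC x; rewrite le_eqVlt => /predU1P[<-|x0].
  by rewrite mul0r (le_trans _ (kB 0)).
rewrite leNgt; apply/negP => xgB.
have B0 : 0 <= B by rewrite (le_trans _ (kB 0)).
pose G y := (g y - B / x) * phi y.
have dG (y : R) : is_derive y 1 G ((k y + B / x * y) * phi y).
  have dp := is_derive_normal_pdf y.
  have dgy := dg y.
  apply: is_derive_eq.
  rewrite /GRing.scale/=; field.
  by rewrite gt_eqF.
have G0 : 0 < G x.
  by rewrite mulr_gt0 ?normal_pdf_gt0// subr_gt0 ltr_pdivrMr// mulrC.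
have GG y : x <= y -> G x <= G y.
  rewrite le_eqVlt => /predU1P[->//|xy].
  have Gcont : {within `[x, y], continuous G}.
    by apply: derivable_within_continuous => z _; case: (dG z).
  have [z] := MVT xy (fun z _ => dG z) Gcont.
  rewrite in_itv/= => /andP[xz zy] GE.
  rewrite -subr_ge0 GE mulr_ge0 ?subr_ge0 ?(ltW xy)//.
  rewrite mulr_ge0 ?normal_pdf_ge0//.
  have := kB z; rewrite ler_norml => /andP[kz _].
  suff : B <= B / x * z by lra.
  by rewrite mulrAC ler_pdivlMr// ler_wpM2l// ltW.
have C0 : 0 <= C by have := gC 0; rewrite normr0 addr0 mulr1; exact: le_trans.
have peak0 : 0 <= normal_peak 1 :> R by exact: normal_peak_ge0.
pose m := C * normal_peak 1.
have m0 : 0 <= m by exact: mulr_ge0.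
(* Far enough for a contradiction: [y >= 1] and [4 * m <= G x * y] give [m * (1 + y) <= 2 * m * y <=
   G x * (y ^+ 2 / 2)], whereas [G y <= m * (1 + y) / (1 + y ^+ 2 / 2)]. *)
pose y := x + 1 + 4 * m / G x.
have e0 : 0 <= 4 * m / G x by rewrite divr_ge0 ?(ltW G0)// mulr_ge0.
have xy : x <= y by rewrite /y; lra.
have y1 : 1 <= y by rewrite /y; lra.
have y0 : 0 < y by lra.
have Gy : G y <= C * (1 + y) * (normal_peak 1 / (1 + y ^+ 2 / 2)).
  apply: (@le_trans _ _ (C * (1 + y) * phi y)).
    rewrite ler_wpM2r ?normal_pdf_ge0//.
    have := gC y; rewrite (ger0_norm (ltW y0)).
    have : 0 <= B / x by rewrite divr_ge0// ltW.
    by have := ler_norm (g y); lra.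
  by rewrite ler_wpM2l ?normal_pdf_le_inv// mulr_ge0//; lra.
have : G y < G x.
  apply: le_lt_trans Gy _.
  have -> : C * (1 + y) * (normal_peak 1 / (1 + y ^+ 2 / 2)) =
            m * (1 + y) / (1 + y ^+ 2 / 2).
    by rewrite /m; ring.
  have den : 0 < 1 + y ^+ 2 / 2 by rewrite ltr_wpDr// divr_ge0// sqr_ge0.
  rewrite ltr_pdivrMr//.
  have yG : 4 * m <= G x * y.
    rewrite /y mulrDr [G x * (4 * m / G x)]mulrCA divff ?gt_eqF// mulr1.
    by rewrite lerDr mulr_ge0 ?(ltW G0)//; lra.
  have : 0 <= m * (y - 1) by rewrite mulr_ge0 ?subr_ge0.
  have : 4 * m * y / 2 <= G x * (y ^+ 2 / 2).
    have -> : G x * (y ^+ 2 / 2) = G x * y * y / 2 by ring.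
    by rewrite ler_wpM2r// ler_wpM2r// ltW.
  by have := G0; lra.
by rewrite ltNge GG.
Qed.

(** The form of the equation survives both [g] replaced by [- g] and [g x] replaced by [- g (- x)],
    which reduces everything to [mills_upper]. Applied to the derivative of Stein's solution, this
    bounds the second derivative. *)
Lemma mills_bound (g k : R -> R) (B C : R) :
  (forall x : R, is_derive x 1 g (x * g x + k x)) ->
  (forall x, `|k x| <= B) -> (forall x, `|g x| <= C * (1 + `|x|)) ->
  forall x, `|x * g x| <= B.
Proof.
move=> dg kB gC x.
wlog x0 : x g k dg kB gC / 0 <= x => [hw|].
  have [/hw|/ltW x0] := leP 0 x; first exact.
  rewrite -[x * g x]mulrNN -[x in - g x]opprK.
  apply: (hw (- x) (fun y => - g (- y)) (fun y => k (- y))).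
  - move=> y; have dgy := dg (- y).
    have dN : is_derive y 1 (fun y : R => - y) (-1) by exact: is_deriveNid.
    have := @is_derive1_comp R g _ y _ _ dgy dN => dcomp.
    by apply: is_derive_eq; rewrite /=; ring.
  - by move=> y; exact: kB.
  - by move=> y; rewrite normrN -(normrN y); exact: gC.
  - by rewrite oppr_ge0.
rewrite ler_norml; apply/andP; split; last exact: mills_upper dg kB gC x x0.
rewrite lerNl -mulrN.
apply: (@mills_upper (fun y => - g y) (fun y => - k y) B C) => //.
- move=> y; have dgy := dg y; apply: is_derive_eq; ring.
- by move=> y; rewrite normrN.
- by move=> y; rewrite normrN.
Qed.

End mills_bound.

(** * Stein's equation *)

Section stein_equation.
Context {R : realType}.
Local Notation mu := (@lebesgue_measure R).
Local Notation phi := (@normal_pdf R 0 1).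
Local Notation K := (@normal_abs_mean R).
Variables (h dh : R -> R).
Hypothesis hdh : forall x : R, is_derive x 1 h (dh x).
Hypothesis dh1 : forall x, `|dh x| <= 1.

Let hlip x y : `|h x - h y| <= `|x - y|.
Proof. by rewrite -[leRHS]mul1r; exact: (is_derive_lipschitz hdh dh1). Qed.

Let hc : continuous h.
Proof.
move=> x; apply: differentiable_continuous; apply/derivable1_diffP.
by case: (hdh x).
Qed.

Let phic : continuous phi.
Proof. by apply: continuous_normal_pdf; exact: oner_neq0. Qed.

Let mphi (g : R -> R) : continuous g ->
  measurable_fun [set: measurableTypeR R] (fun t => (g t * phi t)%:E).
Proof.
move=> cg; apply/measurable_EFinP/measurable_funM.
  exact: continuous_measurable_fun.
exact: measurable_normal_pdf.
Qed.

Let int_phi r : mu.-integrable setT (fun t => (r * phi t)%:E).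
Proof.
under eq_fun do rewrite EFinM.
by apply: integrableZl => //; exact: integrable_normal_pdf.
Qed.

Let Rint_phi r : \int[mu]_t (r * phi t) = r.
Proof.
rewrite RintegralZl//; last exact: integrable_normal_pdf.
by rewrite /Rintegral integral_normal_pdf/= mulr1.
Qed.

Let int_affine r : mu.-integrable setT (fun t => ((`|t| + r) * phi t)%:E).
Proof.
under eq_fun do rewrite mulrDl EFinD.
by apply: integrableD => //; exact: integrable_normr_normal_pdf.
Qed.

Let Rint_affine r : \int[mu]_t ((`|t| + r) * phi t) = K + r.
Proof.
under eq_Rintegral do rewrite mulrDl.
rewrite RintegralD//= ?Rint_phi//; first exact: integrable_normr_normal_pdf.
exact: int_phi.
Qed.

Let int_lip (g : R -> R) r : continuous g -> (forall t, `|g t| <= `|t| + r) ->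
  mu.-integrable setT (fun t => (g t * phi t)%:E).
Proof.
move=> cg gr; apply: le_integrable (int_affine r) => //; first exact: mphi.
move=> t _; rewrite !abse_EFin lee_fin !normrM ler_wpM2r//.
by apply: le_trans (gr t) _; exact: ler_norm.
Qed.

Definition normal_mean := \int[mu]_t (h t * phi t).
Local Notation c := normal_mean.

Let int_h : mu.-integrable setT (fun t => (h t * phi t)%:E).
Proof.
apply: (@int_lip _ `|h 0|) => // t.
have -> : h t = (h t - h 0) + h 0 by ring.
by apply: le_trans (ler_normD _ _) _; rewrite lerD2r -[in leRHS](subr0 t).
Qed.

Lemma normal_mean_dist0 : `|h 0 - c| <= K.
Proof.
have int0 : mu.-integrable setT (fun t => ((h 0 - h t) * phi t)%:E).
  under eq_fun do rewrite mulrBl EFinB.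
  exact: integrableB.
have -> : h 0 - c = \int[mu]_t ((h 0 - h t) * phi t).
  under [in RHS]eq_Rintegral do rewrite mulrBl.
  by rewrite RintegralB ?Rint_phi//; exact: int_phi.
apply: le_trans (le_normr_Rintegral _ int0) _ => //.
apply: le_Rintegral => //.
- exact: integrable_norm int0.
- exact: integrable_normr_normal_pdf.
move=> t _; rewrite normrM (ger0_norm (normal_pdf_ge0 _ _ _)).
by rewrite ler_wpM2r ?normal_pdf_ge0// (le_trans (hlip _ _))// sub0r normrN.
Qed.

Let ht t := h t - c.
Let q t := ht t * phi t.

Let ht_le t : `|ht t| <= `|t| + K.
Proof.
rewrite /ht; have -> : h t - c = (h t - h 0) + (h 0 - c) by ring.
apply: le_trans (ler_normD _ _) _; rewrite lerD ?normal_mean_dist0//.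
by apply: le_trans (hlip _ _) _; rewrite subr0.
Qed.

Let htc : continuous ht.
Proof. by move=> x; apply: (@cvgB _ R^o) => //; [exact: hc|exact: cvg_cst]. Qed.

Let int_q : mu.-integrable setT (EFin \o q).
Proof. exact: int_lip ht_le. Qed.

Let Rint_q : \int[mu]_t (q t) = 0.
Proof.
rewrite /q /ht; under eq_Rintegral do rewrite mulrBl.
by rewrite RintegralB ?Rint_phi /normal_mean ?subrr//; exact: int_phi.
Qed.

Let int_qS (A : set R) : measurable A -> mu.-integrable A (EFin \o q).
Proof. by move=> mA; exact: integrableS int_q. Qed.

(** Stein's solution is [F / phi]. Since [q] has total integral 0, [F x] is also minus the integral
    over the upper tail, so that it is small on both sides. *)
Let F x := \int[mu]_(t in `]-oo, x]) q t.

Let qc : continuous q.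
Proof. by move=> x; apply: cvgM; [exact: htc|exact: phic]. Qed.

Let dF (x : R) : is_derive x 1 F (q x).
Proof.
have [||||+ dFE] := @continuous_FTC1 R q -oo%O x (x + 1).
- by rewrite ltrDl.
- exact: int_qS.
- exact: ltNyr.
- exact: qc.
move=> dFx; apply: DeriveDef; first exact: dFx.
by rewrite -derive1E; exact: dFE.
Qed.

Let F_le x : `|F x| <= K + K.
Proof.
apply: le_trans (le_normr_Rintegral _ (int_qS _)) _ => //.
rewrite -[leRHS]Rint_affine.
apply: (@le_trans _ _ (\int[mu]_(t in `]-oo, x]) ((`|t| + K) * phi t))).
  apply: le_Rintegral => //.
  - by apply: integrable_norm; exact: int_qS.
  - by apply: integrableS (int_affine K).
  - move=> t _; rewrite normrM (ger0_norm (normal_pdf_ge0 _ _ _)).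
    by rewrite ler_wpM2r ?normal_pdf_ge0.
rewrite /Rintegral fine_le//.
- by apply: integrable_fin_num => //; exact: integrableS (int_affine K).
- by apply: integrable_fin_num => //; exact: int_affine.
apply: ge0_subset_integral => //.
- by case/integrableP : (int_affine K).
- by move=> t _; rewrite lee_fin mulr_ge0 ?normal_pdf_ge0// addr_ge0// normal_abs_mean_ge0.
Qed.

(** Where [|t| >= 1], the integrand is at most [(|t| + K) * phi t <= (1 + K) * (|t| * phi t)], and
    the integral of [|t| * phi t] over a tail is known exactly. *)
Let tail_le (A : set R) x : measurable A -> (forall t, A t -> 1 <= `|t|) ->
  (\int[mu]_(t in A) (`|t| * phi t)%:E = (phi x)%:E)%E ->
  `|\int[mu]_(t in A) q t| <= (1 + K) * phi x.
Proof.
move=> mA A1 AE.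
apply: le_trans (le_normr_Rintegral _ (int_qS _)) _ => //.
have -> : phi x = \int[mu]_(t in A) (`|t| * phi t) by rewrite /Rintegral AE.
have iA : mu.-integrable A (EFin \o (fun t => `|t| * phi t)).
  by apply: integrableS integrable_normr_normal_pdf.
rewrite -RintegralZl//; apply: le_Rintegral => //.
- by apply: integrable_norm; exact: int_qS.
- under [X in _.-integrable _ X]eq_fun do rewrite EFinM.
  exact: integrableZl.
move=> t At; rewrite normrM (ger0_norm (normal_pdf_ge0 _ _ _)) mulrA.
rewrite ler_wpM2r ?normal_pdf_ge0// (le_trans (ht_le t))// mulrDl mul1r lerD2l.
by rewrite ler_peMr ?A1 ?normal_abs_mean_ge0.
Qed.

Let F_tail x : 1 <= `|x| -> `|F x| <= (1 + K) * phi x.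
Proof.
have [x0|x0] := leP 0 x => x1.
  have -> : F x = - \int[mu]_(t in `]x, +oo[) q t.
    have : \int[mu]_(t in `]-oo, +oo[) q t - F x = \int[mu]_(t in `]x, +oo[) q t.
      apply: Rintegral_itvB => //; first exact: int_qS.
    by rewrite set_itvE Rint_q sub0r => <-; rewrite opprK.
  rewrite normrN Rintegral_itv_obnd_cbnd; last exact: int_qS.
  apply: tail_le => //.
    move=> t /=; rewrite in_itv/= andbT => xt.
    by rewrite ger0_norm ?(le_trans x0)// (le_trans _ xt)// -(ger0_norm x0).
  rewrite -integral_tail_normal_pdf//; apply: eq_integral => t /[!inE]/=.
  by rewrite in_itv/= andbT => xt; rewrite ger0_norm// (le_trans x0).
have Nx : `|x| = - x by rewrite ltr0_norm.
rewrite -normal_pdfN; apply: tail_le => //.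
  move=> t /=; rewrite in_itv/= => tx.
  by rewrite ler0_norm ?(le_trans tx (ltW x0))//; lra.
by rewrite -integral_tailN_normal_pdf ?opprK// oppr_ge0 ltW.
Qed.

(** If [A] is the bound [(K + K) / phi 1 + 1 + K] for the solution, then [A + 1 + K] bounds the
    first derivative and [2 * A + 2] the second; one constant dominates all three. In [A], the first
    summand covers [|x| <= 1] and [1 + K] covers the tails. *)
Definition stein_const : R := 2 * ((K + K) / phi 1 + 1 + K) + 2 + K.
Local Notation A := ((K + K) / phi 1 + 1 + K).

Let K0 : 0 <= K. Proof. exact: normal_abs_mean_ge0. Qed.
Let phi_gt0 x : 0 < phi x. Proof. exact: normal_pdf_gt0. Qed.

Let phi1_le x : `|x| <= 1 -> phi 1 <= phi x.
Proof.
move=> x1; rewrite !normal_pdfE ?oner_eq0// ler_wpM2l ?normal_peak_ge0//.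
rewrite /normal_fun !subr0 ler_expR ler_wpM2r ?invr_ge0//.
by rewrite lerN2 -[leLHS]real_normK ?num_real// lerXn2r ?nnegrE.
Qed.

Let f x := F x / phi x.

Let f_le x : `|f x| <= A.
Proof.
rewrite normrM normfV (gtr0_norm (phi_gt0 x)) ler_pdivrMr//.
have [x1|/ltW x1] := leP (`|x|) 1.
  apply: le_trans (F_le x) _; apply: (@le_trans _ _ (A * phi 1)).
    by rewrite -addrA mulrDl divfK ?gt_eqF// lerDl mulr_ge0 ?addr_ge0// ltW.
  rewrite ler_wpM2l ?phi1_le//.
  by rewrite !addr_ge0// divr_ge0 ?addr_ge0// ltW.
apply: le_trans (F_tail x1) _; rewrite ler_wpM2r ?normal_pdf_ge0//.
by rewrite -addrA lerDr divr_ge0 ?addr_ge0// ltW.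
Qed.

Let f1 x := x * f x + ht x.

Let df (x : R) : is_derive x 1 f (f1 x).
Proof.
have dFx := dF x; have dp := is_derive_normal_pdf x.
have p0 : phi x != 0 by rewrite gt_eqF.
have dV := is_deriveV p0.
apply: is_derive_eq.
by rewrite /f1 /f /q /GRing.scale/=; field.
Qed.

Let df1 (x : R) : is_derive x 1 f1 (x * f1 x + (f x + dh x)).
Proof.
have dfx := df x; have dhx := hdh x.
suff : is_derive x 1 (fun y => y * f y + (h y - c)) (x * f1 x + (f x + dh x)) by [].
by apply: is_derive_eq; rewrite /GRing.scale/=; ring.
Qed.

Lemma stein_solution : exists f0 f' f'' : R -> R,
  [/\ forall x : R, is_derive x 1 f0 (f' x),
      forall x : R, is_derive x 1 f' (f'' x),
      forall x, f' x - x * f0 x = h x - normal_mean &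
      forall x, [/\ `|f0 x| <= stein_const, `|f' x| <= stein_const &
                    `|f'' x| <= stein_const]].
Proof.
exists f, f1, (fun x => x * f1 x + (f x + dh x)); split=> //.
  by move=> x; rewrite /f1 addrAC subrr add0r.
have A0 : 0 <= A by exact: le_trans (f_le 0).
have k_le x : `|f x + dh x| <= A + 1.
  by rewrite (le_trans (ler_normD _ _))// lerD.
(* Differentiating Stein's equation gives [f1' = x * f1 + (f + dh)] with a bounded inhomogeneous
   term, which is the situation of [mills_bound]; estimating [x * f1] from the formula for [f1]
   would give a bound that grows with [x]. *)
have xf1 x : `|x * f1 x| <= A + 1.
  apply: (@mills_bound R f1 (fun x => f x + dh x) (A + 1) (A + 1 + K)) => //.
  move=> y; rewrite (le_trans (ler_normD _ _))// normrM.
  move: A A0 (f_le y) => a a0 fa.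
  have : `|y| * `|f y| <= `|y| * a by rewrite ler_wpM2l.
  have : 0 <= `|y| * K by rewrite mulr_ge0.
  by have := ht_le y; lra.
have f1_le x : `|f1 x| <= A + 1 + K.
  have [x1|/ltW x1] := leP (`|x|) 1.
    rewrite (le_trans (ler_normD _ _))// -addrA lerD//.
      by rewrite normrM -[leRHS]mul1r ler_pM.
    by rewrite (le_trans (ht_le x))// lerD2r.
  rewrite (@le_trans _ _ `|x * f1 x|)//; last by have := xf1 x; have := K0; lra.
  by rewrite normrM ler_peMl.
move=> x; split; rewrite /stein_const.
- by have := f_le x; have := K0; lra.
- by have := f1_le x; have := K0; lra.
- rewrite (le_trans (ler_normD _ _))//.
  by have := xf1 x; have := k_le x; have := K0; lra.
Qed.

End stein_equation.

Lemma stein_const_gt0 (R : realType) : 0 < @stein_const R.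
Proof.
have K0 := @normal_abs_mean_ge0 R.
have : 0 <= (@normal_abs_mean R + @normal_abs_mean R) / normal_pdf 0 1 1.
  by rewrite divr_ge0 ?addr_ge0// normal_pdf_ge0.
by rewrite /stein_const; lra.
Qed.

(** * Smoothing of Lipschitz functions *)

Section antiderivative.
Context {R : realType}.
Local Notation mu := (@lebesgue_measure R).

Let antiderivative0 (g : R -> R) : continuous g -> (forall x, x <= 0 -> g x = 0) ->
  exists G : R -> R, forall x : R, is_derive x 1 G (g x).
Proof.
move=> gc g0.
have intg u : mu.-integrable `]-oo, u] (EFin \o g).
  apply/integrable_mkcond => //.
  have : mu.-integrable `[0, u] (EFin \o g).
    apply: continuous_compact_integrable; first exact: segment_compact.
    exact: continuous_subspaceT.
  move=> i0u; have /= := proj1 (integrable_mkcond (mu := mu) (EFin \o g) (measurable_itv `[0, u])) i0u.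
  apply: eq_integrable => // x _; rewrite !patchE !mem_setE !in_itv/=.
  have [x0|x0] := leP 0 x; first by [].
  by case: ifPn => // _; rewrite /= g0// ltW.
exists (fun x => \int[mu]_(t in `]-oo, x]) g t) => x.
have [||||+ dFE] := @continuous_FTC1 R g -oo%O x (x + 1).
- by rewrite ltrDl.
- exact: intg.
- exact: ltNyr.
- exact: gc.
move=> dFx; apply: DeriveDef; first exact: dFx.
by rewrite -derive1E; exact: dFE.
Qed.

(** Integration starts at [-oo], so the integrand has to vanish on the negative half-line. This
    holds for [h (max x 0) - h 0] and for [h (- max x 0) - h 0]; their antiderivatives, the second
    one reflected, are glued with the linear term [h 0 * x]. *)
Lemma continuous_antiderivative (h : R -> R) : continuous h ->
  exists H : R -> R, forall x : R, is_derive x 1 H (h x).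
Proof.
move=> hc.
have cmax : continuous (fun x : R => Num.max x 0).
  move=> x; apply: continuous_max; [exact: cvg_id|exact: cvg_cst].
have hmaxc (g : R -> R) : continuous g ->
    continuous (fun x : R => g (Num.max x 0) - g 0).
  move=> gc x; apply: (@cvgB _ R^o); last exact: cvg_cst.
  by apply: continuous_comp; [exact: cmax|exact: gc].
have hN : continuous (fun x : R => h (- x)).
  by move=> x; apply: continuous_comp; [exact: opp_continuous|exact: hc].
have [x x0|G1 dG1] := antiderivative0 (hmaxc h hc).
  by rewrite (max_idPr x0) subrr.
have [x x0|G2 dG2] := antiderivative0 (hmaxc _ hN).
  by rewrite (max_idPr x0) subrr.
exists (fun x => G1 x - G2 (- x) + h 0 * x) => x.
have d1 := dG1 x; have d2 := dG2 (- x).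
have dN : is_derive x 1 (fun y : R => - y) (-1) by exact: is_deriveNid.
have dcomp := @is_derive1_comp R G2 _ x _ _ d2 dN.
apply: is_derive_eq; rewrite /GRing.scale/= oppr0.
have [x0|/ltW x0] := leP 0 x.
  by rewrite (max_idPr _) ?oppr_le0// oppr0; ring.
by rewrite (max_idPl _) ?oppr_ge0// opprK; ring.
Qed.

End antiderivative.

(** Take the average of [h] over [[x, x + e]]: its derivative is a difference quotient of [h], and
    averaging moves a value by at most [e]. *)
Lemma lipschitz_smoothing (R : realType) (h : R -> R) (e : R) : 0 < e ->
  (forall x y, `|h x - h y| <= `|x - y|) ->
  exists g dg : R -> R, [/\ forall x : R, is_derive x 1 g (dg x),
    forall x, `|dg x| <= 1 & forall x, `|g x - h x| <= e].
Proof.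
move=> e0 hlip.
have hc : continuous h.
  move=> x; apply/cvgrPdist_le => /= r r0; near=> y.
  by apply: le_trans (hlip _ _) _; near: y; exact: cvgr_dist_le.
have [H dH] := continuous_antiderivative hc.
exists (fun x => e^-1 * (H (x + e) - H x)), (fun x => e^-1 * (h (x + e) - h x)).
have eN0 : e != 0 by rewrite gt_eqF.
split=> x.
- have d1 := dH x; have d2 := dH (x + e).
  have dD : is_derive x 1 (fun y : R => y + e) 1.
    by apply: is_derive_eq; rewrite addr0.
  have dcomp := @is_derive1_comp R H _ x _ _ d2 dD.
  by apply: is_derive_eq; rewrite /GRing.scale/= mulr1.
- rewrite normrM gtr0_norm ?invr_gt0// ler_pdivrMl// mulr1.
  by rewrite (le_trans (hlip _ _))// addrAC subrr add0r gtr0_norm.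
- have xe : x < x + e by rewrite ltrDl.
  have Hcont : {within `[x, x + e], continuous H}.
    by apply: derivable_within_continuous => z _; case: (dH z).
  have [z] := MVT xe (fun z _ => dH z) Hcont.
  rewrite in_itv/= => /andP[xz ze] ->.
  rewrite addrAC subrr add0r mulrC mulfK// (le_trans (hlip _ _))//.
  by rewrite gtr0_norm ?subr_gt0// lerBlDl ltW.
Unshelve. all: by end_near. Qed.

(** * Calculus of third moments *)

Section third_moments.
Context {R : realType} {dO : measure_display} {Om : measurableType dO}.
Variable P : probability Om R.
Local Notation int1 f := (P.-integrable setT (EFin \o f)).
Local Notation Ex f := (Rintegral P setT f).
Implicit Types f g k : Om -> R.

Definition L3 f := measurable_fun setT f /\ int1 (fun w => `|f w| ^+ 3).

Lemma integrable_le f g : measurable_fun setT f -> int1 g ->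
  (forall w, `|f w| <= g w) -> int1 f.
Proof.
move=> mf ig fg; apply: le_integrable ig => //; first exact/measurable_EFinP.
by move=> w _; rewrite !abse_EFin lee_fin (le_trans (fg w))// ler_norm.
Qed.

Lemma eq_integrabler f g : (forall w, f w = g w) -> int1 f -> int1 g.
Proof. by move=> /funext ->. Qed.

Lemma integrable_cstr (r : R) : int1 (fun=> r).
Proof. exact: finite_measure_integrable_cst. Qed.

Lemma integrable_addr f g : int1 f -> int1 g -> int1 (fun w => f w + g w).
Proof. by move=> i1 i2; have := integrableD measurableT i1 i2. Qed.

Lemma integrable_subr f g : int1 f -> int1 g -> int1 (fun w => f w - g w).
Proof. by move=> i1 i2; have := integrableB measurableT i1 i2. Qed.

Lemma integrable_mulrl r f : int1 f -> int1 (fun w => r * f w).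
Proof. by move=> i1; have := integrableZl measurableT r i1. Qed.

Lemma integrable_sumr (I : Type) (s : seq I) (Q : pred I) (f : I -> Om -> R) :
  (forall i, int1 (f i)) -> int1 (fun w => \sum_(i <- s | Q i) f i w).
Proof.
move=> fi; elim: s => [|a s IH].
  by apply: eq_integrabler (integrable_cstr 0) => w; rewrite big_nil.
have [Qa|Qa] := boolP (Q a).
  by apply: eq_integrabler (integrable_addr (fi a) IH) => w; rewrite big_cons Qa.
by apply: eq_integrabler IH => w; rewrite big_cons (negbTE Qa).
Qed.

Lemma Rintegral_sumr (I : Type) (s : seq I) (Q : pred I) (f : I -> Om -> R) :
  (forall i, int1 (f i)) ->
  Ex (fun w => \sum_(i <- s | Q i) f i w) = \sum_(i <- s | Q i) Ex (f i).
Proof.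
move=> fi; elim: s => [|a s IH].
  under eq_Rintegral do rewrite big_nil.
  by rewrite big_nil Rintegral_cst//= mul0r.
under eq_Rintegral do rewrite big_cons.
rewrite big_cons; case: ifP => _ //.
by rewrite RintegralD//= ?IH//; exact: integrable_sumr.
Qed.

Lemma probability_Rintegral_cst r : Ex (fun=> r) = r.
Proof.
rewrite Rintegral_cst// -[RHS]mulr1; congr (_ * _).
by transitivity (fine (1%E : \bar R)) => //; congr fine; exact: probability_setT.
Qed.

Lemma L3_le f g k : measurable_fun setT f -> L3 g -> L3 k ->
  (forall w, `|f w| <= `|g w| + `|k w|) -> L3 f.
Proof.
move=> mf [mg ig] [mk ik] fgk; split=> //.
(* The constant 4 is that of [(a + b) ^+ 3 <= 4 * (a ^+ 3 + b ^+ 3)], equivalent to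
   [(a + b) * (a - b) ^+ 2 >= 0]. *)
apply: (@integrable_le _ (fun w => 4 * (`|g w| ^+ 3 + `|k w| ^+ 3))).
- by apply: measurable_funX; exact: measurableT_comp.
- by apply: integrable_mulrl; exact: integrable_addr.
move=> w; rewrite ger0_norm ?exprn_ge0//.
apply: (@le_trans _ _ ((`|g w| + `|k w|) ^+ 3)).
  by rewrite lerXn2r ?nnegrE ?addr_ge0.
move: (`|g w|) (`|k w|) (normr_ge0 (g w)) (normr_ge0 (k w)) => a b a0 b0.
have : 0 <= (a + b) * (a - b) ^+ 2 by rewrite mulr_ge0 ?sqr_ge0 ?addr_ge0.
by lra.
Qed.

Lemma eq_L3 f g : (forall w, f w = g w) -> L3 f -> L3 g.
Proof. by move=> /funext ->. Qed.

Lemma L3_cst r : L3 (fun=> r).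
Proof. by split; [exact: measurable_cst|exact: integrable_cstr]. Qed.

Lemma L3_bounded f r : measurable_fun setT f -> (forall w, `|f w| <= r) -> L3 f.
Proof.
move=> mf fr; apply: (L3_le mf (L3_cst r) (L3_cst 0)) => w.
by rewrite normr0 addr0 (le_trans (fr w))// ler_norm.
Qed.

Lemma L3D f g : L3 f -> L3 g -> L3 (fun w => f w + g w).
Proof.
move=> f3 g3; apply: (L3_le _ f3 g3) => [|w]; last exact: ler_normD.
by apply: measurable_funD; [case: f3|case: g3].
Qed.

Lemma L3Z r f : L3 f -> L3 (fun w => r * f w).
Proof.
move=> [mf if3]; split; first exact: measurable_funM.
by apply: eq_integrabler (integrable_mulrl (`|r| ^+ 3) if3) => w; rewrite normrM exprMn.
Qed.

Lemma L3_norm f : L3 f -> L3 (fun w => `|f w|).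
Proof.
move=> f3; apply: (L3_le _ f3 (L3_cst 0)) => [|w].
  by apply: measurableT_comp => //; case: f3.
by rewrite normr_id normr0 addr0.
Qed.

Lemma L3B f g : L3 f -> L3 g -> L3 (fun w => f w - g w).
Proof.
move=> f3 g3; apply: (L3_le _ f3 g3) => [|w]; last exact: ler_normB.
by apply: measurable_funB; [case: f3|case: g3].
Qed.

Lemma L3_sum (I : Type) (s : seq I) (Q : pred I) (f : I -> Om -> R) :
  (forall i, L3 (f i)) -> L3 (fun w => \sum_(i <- s | Q i) f i w).
Proof.
move=> fi; elim: s => [|a s IH].
  by apply: eq_L3 (L3_cst 0) => w; rewrite big_nil.
have [Qa|Qa] := boolP (Q a).
  by apply: eq_L3 (L3D (fi a) IH) => w; rewrite big_cons Qa.
by apply: eq_L3 IH => w; rewrite big_cons (negbTE Qa).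
Qed.

(** The product is at most the cube of the largest factor, which is one of the summands. This is the
    source of the factors 3 in the moment bounds below. *)
Lemma mulr3_le_sum (a b c : R) : 0 <= a -> 0 <= b -> 0 <= c ->
  a * b * c <= a ^+ 3 + b ^+ 3 + c ^+ 3.
Proof.
move=> a0 b0 c0.
have [a3 b3 c3] : [/\ 0 <= a ^+ 3, 0 <= b ^+ 3 & 0 <= c ^+ 3].
  by split; rewrite exprn_ge0.
pose m := Num.max a (Num.max b c).
have [am bm cm] : [/\ a <= m, b <= m & c <= m].
  by rewrite /m !le_max !lexx !orbT.
apply: (@le_trans _ _ (m ^+ 3)).
  rewrite !exprS expr0 mulr1 mulrA.
  by apply: ler_pM => //; [exact: mulr_ge0|exact: ler_pM].
rewrite /m; case: (leP b c) => _; first by case: (leP a c) => _; lra.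
by case: (leP a b) => _; lra.
Qed.

Lemma integrable_mul3 f g k : L3 f -> L3 g -> L3 k ->
  int1 (fun w => f w * g w * k w).
Proof.
move=> [mf i1] [mg i2] [mk i3].
apply: (@integrable_le _ (fun w => `|f w| ^+ 3 + `|g w| ^+ 3 + `|k w| ^+ 3)).
- by apply: measurable_funM => //; exact: measurable_funM.
- by apply: integrable_addr => //; exact: integrable_addr.
- by move=> w; rewrite !normrM mulr3_le_sum.
Qed.

Lemma integrable_mul2 f g : L3 f -> L3 g -> int1 (fun w => f w * g w).
Proof.
move=> f3 g3; apply: eq_integrabler (integrable_mul3 f3 g3 (L3_cst 1)) => w.
by rewrite mulr1.
Qed.

Lemma L3_integrable f : L3 f -> int1 f.
Proof.
move=> f3; apply: eq_integrabler (integrable_mul2 f3 (L3_cst 1)) => w.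
by rewrite mulr1.
Qed.

Lemma Rintegral_mul3_le f g k T : L3 f -> L3 g -> L3 k ->
  Ex (fun w => `|f w| ^+ 3) <= T -> Ex (fun w => `|g w| ^+ 3) <= T ->
  Ex (fun w => `|k w| ^+ 3) <= T ->
  Ex (fun w => `|f w * g w * k w|) <= 3 * T.
Proof.
move=> f3 g3 k3 fT gT kT.
have [[mf i1] [mg i2] [mk i3]] := And3 f3 g3 k3.
apply: (@le_trans _ _ (Ex (fun w => `|f w| ^+ 3 + `|g w| ^+ 3 + `|k w| ^+ 3))).
  apply: le_Rintegral => //.
  - by apply: integrable_norm; exact: integrable_mul3.
  - by apply: integrable_addr => //; exact: integrable_addr.
  - by move=> w _; rewrite !normrM mulr3_le_sum.
rewrite RintegralD//; last exact: integrable_addr.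
by rewrite RintegralD//; lra.
Qed.

Lemma Rintegral_cube_cst t : 0 <= t -> Ex (fun=> `|t| ^+ 3) = t ^+ 3.
Proof. by move=> t0; rewrite probability_Rintegral_cst ger0_norm. Qed.

(** The third factor of [Rintegral_mul3_le] is taken to be the constant [t], and [t] is then divided
    out, which restores homogeneity. *)
Lemma Rintegral_mul2_le f g t : 0 < t -> L3 f -> L3 g ->
  Ex (fun w => `|f w| ^+ 3) <= t ^+ 3 -> Ex (fun w => `|g w| ^+ 3) <= t ^+ 3 ->
  Ex (fun w => `|f w * g w|) <= 3 * t ^+ 2.
Proof.
move=> t0 f3 g3 ft gt.
have := Rintegral_mul3_le f3 g3 (L3_cst t) ft gt.
rewrite (Rintegral_cube_cst (ltW t0)) => /(_ (lexx _)).
under eq_Rintegral do rewrite normrM (ger0_norm (ltW t0)).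
rewrite RintegralZr//; last by apply: integrable_norm; exact: integrable_mul2.
by move=> le3; rewrite -(ler_pM2r t0) (le_trans le3)//; lra.
Qed.

Lemma Rintegral_mul1_le f t : 0 < t -> L3 f ->
  Ex (fun w => `|f w| ^+ 3) <= t ^+ 3 ->
  Ex (fun w => `|f w|) <= 3 * t.
Proof.
move=> t0 f3 ft.
have := Rintegral_mul2_le t0 f3 (L3_cst t) ft.
rewrite (Rintegral_cube_cst (ltW t0)) => /(_ (lexx _)).
under eq_Rintegral do rewrite normrM (ger0_norm (ltW t0)).
rewrite RintegralZr//; last by apply: integrable_norm; exact: L3_integrable.
by move=> le3; rewrite -(ler_pM2r t0) (le_trans le3)//; lra.
Qed.

End third_moments.

(** * Stein's method under local dependence *)

Section local_stein.
Context {R : realType} {dO : measure_display} {Om : measurableType dO}.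
Variable P : probability Om R.
Local Notation int1 f := (P.-integrable setT (EFin \o f)).
Local Notation Ex f := (Rintegral P setT f).

Lemma Rintegral_dist_le (f g k : Om -> R) (b : R) : int1 f -> int1 g -> int1 k ->
  (forall w, `|f w - g w| <= b * `|k w|) ->
  `|Ex f - Ex g| <= b * Ex (fun w => `|k w|).
Proof.
move=> fi gi ki fgk.
rewrite -RintegralB//.
have fgi : int1 (fun w => f w - g w) by exact: integrable_subr.
apply: le_trans (le_normr_Rintegral _ fgi) _ => //.
rewrite -RintegralZl//; last exact: integrable_norm.
apply: le_Rintegral => //; first exact: integrable_norm.
by apply: integrable_mulrl; exact: integrable_norm.
Qed.

(** Mean value theorem for [f z - (z - y) * f' x]. The derivative is taken at [x], later the full
    sum, so that the linear term contains [f' (s * W)], the quantity that [stein_inner]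
    decouples. *)
Lemma taylor1_le (f f' f'' : R -> R) (c x y : R) :
  (forall x : R, is_derive x 1 f (f' x)) ->
  (forall x : R, is_derive x 1 f' (f'' x)) ->
  (forall x, `|f'' x| <= c) ->
  `|f x - f y - (x - y) * f' x| <= c * (x - y) ^+ 2.
Proof.
move=> df df' f''c.
pose g z := f z - (z - y) * f' x.
have dg (z : R) : is_derive z 1 g (f' z - f' x).
  by have dz := df z; apply: is_derive_eq; rewrite /GRing.scale/=; ring.
have c0 : 0 <= c by exact: le_trans (f''c 0).
have main a b z : a <= z <= b -> (a = y /\ b = x) \/ (a = x /\ b = y) ->
    `|f' z - f' x| <= c * `|x - y|.
  move=> /andP[az zb] ab; rewrite (le_trans (is_derive_lipschitz df' f''c _ _))//.
  rewrite ler_wpM2l//; case: ab => -[? ?]; subst a b.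
    by rewrite distrC !ger0_norm ?subr_ge0 ?(le_trans az)//; lra.
  by rewrite ger0_norm ?subr_ge0// distrC ger0_norm ?subr_ge0 ?(le_trans az)//; lra.
have -> : f x - f y - (x - y) * f' x = g x - g y by rewrite /g; ring.
have gcont A : {within A, continuous g}.
  apply: continuous_subspaceT => z; apply: differentiable_continuous.
  by apply/derivable1_diffP; case: (dg z).
have -> : c * (x - y) ^+ 2 = c * `|x - y| * `|x - y|.
  by rewrite -mulrA -expr2 real_normK ?num_real.
have [xy|yx|->] := ltgtP x y.
- have [z] := MVT xy (fun z _ => dg z) (gcont _).
  rewrite in_itv/= => /andP[xz zy] gE.
  rewrite distrC gE normrM (distrC x y) ler_wpM2r// (distrC y x).
  by apply: (main x y); [rewrite !ltW|right].
- have [z] := MVT yx (fun z _ => dg z) (gcont _).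
  rewrite in_itv/= => /andP[xz zy] gE.
  rewrite gE normrM ler_wpM2r//.
  by apply: (main y x); [rewrite !ltW|left].
- by rewrite !subrr normr0 mulr0.
Qed.

Variables (I : finType) (Y : I -> Om -> R) (N : I -> {set I}).
Variables (K : nat) (t dl dl2 sigma : R).

Definition partial_sum (S : {set I}) (w : Om) : R := \sum_(k in S) Y k w.
Local Notation YS := partial_sum.
Local Notation W := (partial_sum [set: I]).

Hypothesis Y3 : forall i, L3 P (Y i).
Hypothesis Yt : forall i, Ex (fun w => `|Y i w| ^+ 3) <= t ^+ 3.
Hypothesis t0 : 0 < t.
Hypothesis NK : forall i, (#|N i| <= K)%N.
Hypothesis dl0 : 0 <= dl.
Hypothesis dl20 : 0 <= dl2.
Hypothesis cov1 : forall i g, bounded_test g \/ g = id ->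
  `|Ex (fun w => Y i w * g (YS (~: N i) w))| <= dl.
Hypothesis cov2 : forall i j g, j \in N i -> bounded_test g ->
  `|Ex (fun w => Y i w * Y j w * g (YS (~: (N i :|: N j)) w))
    - Ex (fun w => Y i w * Y j w) * Ex (fun w => g (YS (~: (N i :|: N j)) w))|
  <= dl2.
Hypothesis sigma1 : 1 <= sigma.
Hypothesis sigmaE : Ex (fun w => W w ^+ 2) = sigma ^+ 2.

Variables (f f' f'' : R -> R) (c : R).
Hypothesis df : forall x : R, is_derive x 1 f (f' x).
Hypothesis df' : forall x : R, is_derive x 1 f' (f'' x).
Hypothesis fc : forall x, [/\ `|f x| <= c, `|f' x| <= c & `|f'' x| <= c].
Hypothesis c_gt0 : 0 < c.

Let s := sigma^-1.
Let s0 : 0 < s. Proof. by rewrite invr_gt0 (lt_le_trans _ sigma1). Qed.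
Let s1 : s <= 1. Proof. by rewrite invf_le1 ?(lt_le_trans _ sigma1). Qed.
Let c0 : 0 <= c. Proof. exact: ltW. Qed.

Let continuous_f : continuous f.
Proof.
by move=> x; apply: differentiable_continuous; apply/derivable1_diffP; case: (df x).
Qed.
Let continuous_f' : continuous f'.
Proof.
by move=> x; apply: differentiable_continuous; apply/derivable1_diffP; case: (df' x).
Qed.

Let mul_partial_sum x S w : x * YS S w = \sum_(j in S) x * Y j w.
Proof. exact: mulr_sumr. Qed.

Let YS3 S : L3 P (YS S). Proof. exact: L3_sum. Qed.

Let f3 (g : R -> R) S : continuous g -> (forall x, `|g x| <= c) ->
  L3 P (fun w => g (s * YS S w)).
Proof.
move=> gc gb; apply: (@L3_bounded _ _ _ _ _ c) => [|w]; last exact: gb.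
apply: measurableT_comp; first exact: continuous_measurable_fun.
by apply: measurable_funM => //; case: (YS3 S).
Qed.

Let fS3 S : L3 P (fun w => f (s * YS S w)).
Proof. by apply: f3 => // x; case: (fc x). Qed.
Let f'S3 S : L3 P (fun w => f' (s * YS S w)).
Proof. by apply: f3 => // x; case: (fc x). Qed.

(** Division by [c] normalizes the sup norms, and [s <= 1] keeps the derivative within bounds after
    the scaling of the argument. *)
Let scaled_test (g dg : R -> R) : (forall x : R, is_derive x 1 g (dg x)) ->
  (forall x, `|g x| <= c) -> (forall x, `|dg x| <= c) ->
  bounded_test (fun x => c^-1 * g (s * x)).
Proof.
move=> ddg gc dgc x.
have dM : is_derive x 1 (fun y : R => s * y) s.
  by apply: is_derive_eq; rewrite /GRing.scale/= mulr1.
have dcomp := @is_derive1_comp R g _ x _ _ (ddg (s * x)) dM.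
have D : is_derive x 1 (fun y => c^-1 * g (s * y)) (c^-1 * (dg (s * x) * s)).
  by apply: is_derive_eq.
split; first by case: D.
- by rewrite normrM gtr0_norm ?invr_gt0// mulrC ler_pdivrMr// mul1r.
- rewrite derive1E (@derive_val _ _ _ _ _ _ _ D).
  rewrite normrM gtr0_norm ?invr_gt0// mulrC ler_pdivrMr// mul1r normrM.
  by rewrite (gtr0_norm s0) -[leRHS]mulr1 ler_pM// ltW.
Qed.

Let cov1_f i : `|Ex (fun w => Y i w * f (s * YS (~: N i) w))| <= c * dl.
Proof.
have tst : bounded_test (fun x => c^-1 * f (s * x)).
  by apply: (scaled_test df) => x; case: (fc x).
have := cov1 i (or_introl tst).
under eq_Rintegral do rewrite mulrCA.
rewrite RintegralZl//; last exact: integrable_mul2.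
by rewrite normrM gtr0_norm ?invr_gt0// ler_pdivrMl.
Qed.

Let cov2_f' i j : j \in N i ->
  `|Ex (fun w => Y i w * Y j w * f' (s * YS (~: (N i :|: N j)) w))
    - Ex (fun w => Y i w * Y j w) * Ex (fun w => f' (s * YS (~: (N i :|: N j)) w))|
  <= c * dl2.
Proof.
move=> ij.
have tst : bounded_test (fun x => c^-1 * f' (s * x)).
  by apply: (scaled_test df') => x; case: (fc x).
have := cov2 ij tst.
under eq_Rintegral do rewrite mulrCA.
rewrite RintegralZl//; last exact: integrable_mul3.
rewrite RintegralZl//; last exact: L3_integrable.
by rewrite mulrCA -mulrBr normrM gtr0_norm ?invr_gt0// ler_pdivrMl.
Qed.

Let mul_partial_sum_le i j S : Ex (fun w => `|Y i w * Y j w * YS S w|) <=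
  #|S|%:R * (3 * t ^+ 3).
Proof.
apply: (@le_trans _ _ (\sum_(k in S) Ex (fun w => `|Y i w * Y j w * Y k w|))).
  rewrite -Rintegral_sumr; last by move=> k; apply: integrable_norm; exact: integrable_mul3.
  apply: le_Rintegral => //.
  - by apply: integrable_norm; exact: integrable_mul3.
  - by apply: integrable_sumr => k; apply: integrable_norm; exact: integrable_mul3.
  - by move=> w _; rewrite mul_partial_sum ler_norm_sum.
rewrite [leRHS]mulr_natl -sumr_const; apply: ler_sum => k _.
exact: Rintegral_mul3_le.
Qed.

Let partial_sum_le S : Ex (fun w => `|YS S w|) <= #|S|%:R * (3 * t).
Proof.
apply: (@le_trans _ _ (\sum_(k in S) Ex (fun w => `|Y k w|))).
  rewrite -Rintegral_sumr; last by move=> k; apply: integrable_norm; exact: L3_integrable.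
  apply: le_Rintegral => //.
  - by apply: integrable_norm; exact: L3_integrable.
  - by apply: integrable_sumr => k; apply: integrable_norm; exact: L3_integrable.
  - by move=> w _; rewrite ler_norm_sum.
rewrite [leRHS]mulr_natl -sumr_const; apply: ler_sum => k _.
exact: Rintegral_mul1_le.
Qed.

Let partial_sumC S w : W w - YS (~: S) w = YS S w.
Proof.
rewrite /partial_sum (bigID (mem S))/= [X in _ + X - _](_ : _ = YS (~: S) w).
  by rewrite addrK; apply: eq_bigl => k; rewrite inE.
by apply: eq_bigl => k; rewrite !inE.
Qed.

(** Compare [f] at [s * W] with [f] at the scaled sum outside [N i]. The value there is handled by
    [cov1], the linear term is the sum over neighbours, and the remainder is at most [c * s ^+ 2]
    times the mean of [|Y i|] and the squared sum over [N i]: at most [K ^ 2] triple products. *)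
Let stein_outer i :
  `|Ex (fun w => Y i w * f (s * W w))
    - s * \sum_(j in N i) Ex (fun w => Y i w * Y j w * f' (s * W w))|
  <= c * dl + c * s ^+ 2 * (K%:R ^+ 2 * (3 * t ^+ 3)).
Proof.
set a := Ex _; set b := \sum_(_ in _) _.
pose e := Ex (fun w => Y i w * f (s * YS (~: N i) w)).
have bE : s * b = Ex (fun w => s * (Y i w * YS (N i) w * f' (s * W w))).
  rewrite RintegralZl//; last exact: integrable_mul3.
  congr (s * _); rewrite /b -Rintegral_sumr; last by move=> j; exact: integrable_mul3.
  by apply: eq_Rintegral => w _; rewrite mul_partial_sum mulr_suml.
have -> : a - s * b = (a - (e + s * b)) + e by ring.
apply: le_trans (ler_normD _ _) _; rewrite [leRHS]addrC lerD//; last exact: cov1_f.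
have e_int : int1 (fun w => Y i w * f (s * YS (~: N i) w)) by exact: integrable_mul2.
have b_int : int1 (fun w => s * (Y i w * YS (N i) w * f' (s * W w))).
  by apply: integrable_mulrl; exact: integrable_mul3.
rewrite bE /e -RintegralD//.
apply: (@le_trans _ _ (c * s ^+ 2 * Ex (fun w => `|Y i w * YS (N i) w * YS (N i) w|))).
  apply: Rintegral_dist_le.
  - exact: integrable_mul2.
  - exact: integrable_addr.
  - exact: integrable_mul3.
  move=> w; set x := s * W w; set y := s * YS (~: N i) w.
  have xy : x - y = s * YS (N i) w by rewrite -mulrBr partial_sumC.
  have -> : Y i w * f x - (Y i w * f y + s * (Y i w * YS (N i) w * f' x)) =
            Y i w * (f x - f y - (x - y) * f' x) by rewrite xy; ring.
  have f''c z : `|f'' z| <= c by case: (fc z).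
  have T := taylor1_le x y df df' f''c.
  rewrite normrM; apply: le_trans (ler_wpM2l (normr_ge0 (Y i w)) T) _.
  have VV : `|YS (N i) w| * `|YS (N i) w| = YS (N i) w ^+ 2.
    by rewrite -expr2 real_normK ?num_real.
  rewrite xy exprMn !normrM -[_ * _ * `|YS _ _|]mulrA VV.
  by rewrite le_eqVlt; apply/orP; left; apply/eqP; ring.
have cs0 : 0 <= c * s ^+ 2 by rewrite mulr_ge0 ?sqr_ge0.
apply: (ler_wpM2l cs0).
apply: (@le_trans _ _ (\sum_(j in N i) Ex (fun w => `|Y i w * Y j w * YS (N i) w|))).
  rewrite -Rintegral_sumr; last by move=> j; apply: integrable_norm; exact: integrable_mul3.
  apply: le_Rintegral => //.
  - by apply: integrable_norm; exact: integrable_mul3.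
  - by apply: integrable_sumr => k; apply: integrable_norm; exact: integrable_mul3.
  - by move=> w _; rewrite [Y i w * _]mul_partial_sum mulr_suml ler_norm_sum.
have T0 : 0 <= 3 * t ^+ 3 by rewrite mulr_ge0// exprn_ge0// ltW.
apply: (@le_trans _ _ (\sum_(j in N i) K%:R * (3 * t ^+ 3))).
  apply: ler_sum => j _; apply: le_trans (mul_partial_sum_le _ _ _) _.
  by rewrite ler_wpM2r// ler_nat.
rewrite sumr_const -[leLHS]mulr_natl [leLHS]mulrA ler_wpM2r//.
by rewrite expr2 ler_wpM2r// ler_nat.
Qed.

(** Both occurrences of [W] are replaced by the sum outside [N i :|: N j], where [cov2] applies. Up
    to the factor [c * s], this costs [2 * K * (3 * t ^+ 3)] in the product and
    [3 * t ^+ 2 * (2 * K * (3 * t))] in the mean of [f']: hence 24 = 6 + 18. *)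
Let stein_inner i j : j \in N i ->
  `|Ex (fun w => Y i w * Y j w * f' (s * W w))
    - Ex (fun w => Y i w * Y j w) * Ex (fun w => f' (s * W w))|
  <= c * dl2 + c * s * (24 * K%:R * t ^+ 3).
Proof.
move=> ij; pose S := N i :|: N j.
have SK : #|S|%:R <= 2 * K%:R :> R.
  rewrite -natrM ler_nat (leq_trans (leq_card_setU _ _))//.
  by rewrite mul2n -addnn leq_add.
set a := Ex (fun w => _ * f' _); set m := Ex (fun w => f' _); set b := Ex _.
pose aS := Ex (fun w => Y i w * Y j w * f' (s * YS (~: S) w)).
pose mS := Ex (fun w => f' (s * YS (~: S) w)).
have -> : a - b * m = (a - aS) + (aS - b * mS) + b * (mS - m) by ring.
have lip w : `|f' (s * W w) - f' (s * YS (~: S) w)| <= c * s * `|YS S w|.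
  have f''c z : `|f'' z| <= c by case: (fc z).
  apply: le_trans (is_derive_lipschitz df' f''c _ _) _.
  by rewrite -mulrBr partial_sumC normrM (gtr0_norm s0) mulrA.
have t3 : 0 <= t ^+ 3 by rewrite exprn_ge0// ltW.
have e1 : `|a - aS| <= c * s * (2 * K%:R * (3 * t ^+ 3)).
  apply: (@le_trans _ _ (c * s * Ex (fun w => `|Y i w * Y j w * YS S w|))).
    apply: Rintegral_dist_le; [exact: integrable_mul3..|] => w.
    by rewrite -mulrBr normrM (normrM _ (YS S w)) [leRHS]mulrCA ler_wpM2l.
  rewrite ler_wpM2l ?mulr_ge0 ?(ltW s0)//.
  apply: le_trans (mul_partial_sum_le _ _ _) _.
  by rewrite ler_wpM2r// mulr_ge0.
have e2 : `|b * (mS - m)| <= c * s * (18 * K%:R * t ^+ 3).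
  have b_le : `|b| <= 3 * t ^+ 2.
    apply: le_trans (le_normr_Rintegral _ _) _ => //; first exact: integrable_mul2.
    exact: Rintegral_mul2_le.
  have m_le : `|mS - m| <= c * s * (2 * K%:R * (3 * t)).
    apply: (@le_trans _ _ (c * s * Ex (fun w => `|YS S w|))).
      apply: Rintegral_dist_le; [exact: L3_integrable..|] => w.
      by rewrite distrC lip.
    rewrite ler_wpM2l ?mulr_ge0 ?(ltW s0)//.
    apply: le_trans (partial_sum_le _) _.
    by rewrite ler_wpM2r// mulr_ge0// ltW.
  have := ler_pM (normr_ge0 b) (normr_ge0 (mS - m)) b_le m_le.
  rewrite -normrM => /le_trans; apply.
  have : 0 <= c * s * (K%:R * t ^+ 3) by apply: mulr_ge0; apply: mulr_ge0 => //; exact: ltW.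
  by lra.
have e3 : `|aS - b * mS| <= c * dl2 by exact: cov2_f'.
apply: le_trans (ler_normD _ _) _.
apply: le_trans (lerD (ler_normD _ _) (lexx _)) _.
by lra.
Qed.

Lemma local_stein_bound :
  `|Ex (fun w => f' (s * W w) - s * W w * f (s * W w))| <=
  c * #|I|%:R * (2 * dl * s + K%:R * dl2 * s + 27 * K%:R ^+ 2 * t ^+ 3 * s ^+ 3).
Proof.
pose m := Ex (fun w => f' (s * W w)).
pose b i j := Ex (fun w => Y i w * Y j w).
pose B := \sum_i \sum_(j in N i) b i j.
have m_le : `|m| <= c.
  apply: le_trans (le_normr_Rintegral _ (L3_integrable (f'S3 _))) _ => //.
  rewrite -[leRHS](probability_Rintegral_cst P).
  apply: le_Rintegral => //.
  - by apply: integrable_norm; exact: L3_integrable.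
  - exact: integrable_cstr.
  - by move=> w _; case: (fc (s * W w)).
(* [sigma ^+ 2 - B] collects the covariances of each [Y i] with the sum outside [N i]; this is the
   place for the unbounded test [id]. *)
have B_le : `|sigma ^+ 2 - B| <= #|I|%:R * dl.
  have -> : sigma ^+ 2 - B = \sum_i Ex (fun w => Y i w * YS (~: N i) w).
    rewrite -sigmaE.
    have -> : Ex (fun w => W w ^+ 2) = \sum_i Ex (fun w => Y i w * W w).
      rewrite -Rintegral_sumr; last by move=> i; exact: integrable_mul2.
      apply: eq_Rintegral => w _; rewrite expr2 {1}/partial_sum mulr_suml.
      by apply: eq_bigl => i; rewrite inE.
    rewrite /B -sumrB; apply: eq_bigr => i _.
    rewrite /b -Rintegral_sumr; last by move=> j; exact: integrable_mul2.
    rewrite -RintegralB//; [|exact: integrable_mul2|].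
      apply: eq_Rintegral => w _; rewrite -mul_partial_sum -mulrBr -(partial_sumC (N i) w).
      by congr (_ * _); ring.
    by apply: integrable_sumr => j; exact: integrable_mul2.
  apply: le_trans (ler_norm_sum _ _ _) _.
  rewrite mulr_natl -sumr_const; apply: ler_sum => i _.
  exact: (cov1 i (or_intror erefl)).
pose a i j := Ex (fun w => Y i w * Y j w * f' (s * W w)).
pose d i := Ex (fun w => Y i w * f (s * W w)).
(* Inserting [1 = s ^+ 2 * sigma ^+ 2] splits the left side into the error in the variance,
   [stein_inner] summed over neighbouring pairs, and [stein_outer] summed over [i]. The moment parts
   of the last two add up to 27 = 24 + 3. *)
have -> : Ex (fun w => f' (s * W w) - s * W w * f (s * W w)) =
    s ^+ 2 * (sigma ^+ 2 - B) * m
    - s ^+ 2 * (\sum_i \sum_(j in N i) (a i j - b i j * m))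
    - s * (\sum_i (d i - s * \sum_(j in N i) a i j)).
  have Wf : int1 (fun w => s * (W w * f (s * W w))).
    by apply: integrable_mulrl; exact: integrable_mul2.
  under eq_Rintegral do rewrite -mulrA.
  rewrite RintegralB//; last exact: L3_integrable.
  rewrite RintegralZl//; last exact: integrable_mul2.
  have -> : Ex (fun w => W w * f (s * W w)) = \sum_i d i.
    rewrite -Rintegral_sumr; last by move=> i; exact: integrable_mul2.
    apply: eq_Rintegral => w _; rewrite {1}/partial_sum mulr_suml.
    by apply: eq_bigl => i; rewrite inE.
  rewrite sumrB -mulr_sumr.
  under [\sum_i \sum_(j in N i) (_ - _)]eq_bigr do rewrite sumrB.
  rewrite sumrB.
  have -> : \sum_i \sum_(j in N i) b i j * m = B * m.
    by rewrite mulr_suml; apply: eq_bigr => i _; rewrite mulr_suml.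
  have ss : s ^+ 2 * sigma ^+ 2 = 1.
    by rewrite -exprMn mulVf ?expr1n// gt_eqF// (lt_le_trans _ sigma1).
  rewrite mulrBr ss -/m; ring.
have sI : #|I|%:R * dl * s <= #|I|%:R * dl.
  by rewrite -[leRHS]mulr1 ler_wpM2l// mulr_ge0.
have T0 : 0 <= t ^+ 3 by rewrite exprn_ge0// ltW.
have e1 : `|s ^+ 2 * (sigma ^+ 2 - B) * m| <= c * #|I|%:R * (dl * s).
  have s20 : 0 <= s ^+ 2 by exact: sqr_ge0.
  have s2s : s ^+ 2 <= s by rewrite expr2 ler_piMr ?(ltW s0).
  rewrite (normrM _ m) (normrM (s ^+ 2)) (ger0_norm s20).
  apply: (@le_trans _ _ (s * (#|I|%:R * dl) * c)).
    by apply: ler_pM => //; [exact: mulr_ge0|exact: ler_pM].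
  by rewrite le_eqVlt; apply/orP; left; apply/eqP; ring.
have e2 : `|s ^+ 2 * (\sum_i \sum_(j in N i) (a i j - b i j * m))| <=
    s ^+ 2 * (#|I|%:R * (K%:R * (c * dl2 + c * s * (24 * K%:R * t ^+ 3)))).
  rewrite normrM ger0_norm ?exprn_ge0 ?(ltW s0)// ler_wpM2l ?exprn_ge0 ?(ltW s0)//.
  apply: le_trans (ler_norm_sum _ _ _) _.
  rewrite mulr_natl -sumr_const; apply: ler_sum => i _.
  apply: le_trans (ler_norm_sum _ _ _) _.
  apply: (@le_trans _ _ (\sum_(j in N i) (c * dl2 + c * s * (24 * K%:R * t ^+ 3)))).
    by apply: ler_sum => j ij; exact: stein_inner.
  rewrite sumr_const -[leLHS]mulr_natl ler_wpM2r ?ler_nat//.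
  by rewrite addr_ge0 ?mulr_ge0// ltW.
have e3 : `|s * (\sum_i (d i - s * \sum_(j in N i) a i j))| <=
    s * (#|I|%:R * (c * dl + c * s ^+ 2 * (K%:R ^+ 2 * (3 * t ^+ 3)))).
  rewrite normrM ger0_norm ?(ltW s0)// ler_wpM2l ?(ltW s0)//.
  apply: le_trans (ler_norm_sum _ _ _) _.
  rewrite mulr_natl -sumr_const; apply: ler_sum => i _; exact: stein_outer.
have e4 : s ^+ 2 * (#|I|%:R * (K%:R * (c * dl2))) <= s * (#|I|%:R * (K%:R * (c * dl2))).
  rewrite ler_wpM2r ?mulr_ge0//.
  by rewrite expr2 ler_piMr ?(ltW s0).
apply: le_trans (ler_normB _ _) _.
apply: le_trans (lerD (ler_normB _ _) (lexx _)) _.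
by lra.
Qed.

End local_stein.

(** * Wasserstein distance to a normal variable *)

Section normal_variable.
Context {R : realType} {dZ : measure_display} {OmZ : measurableType dZ}.
Variables (PZ : probability OmZ R) (Z : {RV PZ >-> R}).
Hypothesis ZN : distribution PZ Z = normal_prob 0 1.
Local Notation mu := (@lebesgue_measure R).
Local Notation phi := (@normal_pdf R 0 1).

(* Z with values in the copy of R that carries the Lebesgue measure, whose
   sigma-algebra has another display than the one of R. *)
Let Z' : OmZ -> measurableTypeR R := Z.

Let measurable_Z' : measurable_fun setT Z'.
Proof. exact: (measurable_funPT Z). Qed.

#[local] HB.instance Definition _ := isMeasurableFun.Build _ _ _ _ Z' measurable_Z'.

Let ge0_integral_Z (f : R -> \bar R) :
  measurable_fun (setT : set (measurableTypeR R)) f ->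
  (forall z, 0 <= f z)%E ->
  (\int[PZ]_w f (Z w) = \int[mu]_z ((phi z)%:E * f z))%E.
Proof.
move=> mf f0; rewrite -ge0_integral_normal//.
have <- := @ge0_integral_distribution _ _ _ _ _ PZ Z' f mf f0.
apply: eq_measure_integral => A mA _.
by rewrite -[LHS]/(distribution PZ Z A) ZN.
Qed.

Lemma normal_variable_integrable (g : R -> R) (r : R) : continuous g ->
  (forall x, `|g x| <= `|x| + r) -> PZ.-integrable setT (EFin \o (g \o Z)).
Proof.
move=> gc gr; have mg : measurable_fun setT g by exact: continuous_measurable_fun.
apply/integrableP; split.
  by apply/measurable_EFinP; exact: measurableT_comp.
rewrite (ge0_integral_Z (f := fun z => `|(g z)%:E|%E))//.
  have i1 := @integrable_normr_normal_pdf R.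
  have i2 : mu.-integrable setT (fun t => (r * phi t)%:E).
    under eq_fun do rewrite EFinM.
    by apply: integrableZl => //; exact: integrable_normal_pdf.
  have /integrableP[m12] := integrableD measurableT i1 i2.
  apply: le_lt_trans; apply: ge0_le_integral => //.
  - by move=> x _; rewrite mule_ge0// lee_fin normal_pdf_ge0.
  - apply: emeasurable_funM.
      by apply/measurable_EFinP; exact: measurable_normal_pdf.
    apply: measurableT_comp => //; apply/measurable_EFinP.
    exact: continuous_measurable_fun.
  - by apply: measurableT_comp.
  - move=> x _; rewrite /= lee_fin -mulrDl normrM mulrC.
    rewrite (ger0_norm (normal_pdf_ge0 _ _ _)) ler_wpM2r ?normal_pdf_ge0//.
    by rewrite (le_trans (gr x))// ler_norm.
apply: measurableT_comp => //; apply/measurable_EFinP.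
exact: continuous_measurable_fun.
Qed.

Lemma normal_variable_mean (g : R -> R) : continuous g ->
  Rintegral PZ setT (g \o Z) = normal_mean g.
Proof.
move=> gc; have mg : measurable_fun setT g by exact: continuous_measurable_fun.
rewrite /normal_mean /Rintegral; congr fine.
rewrite [LHS]integralE [RHS]integralE; congr (_ - _)%E.
- transitivity (\int[mu]_z ((phi z)%:E * (EFin \o g)^\+ z))%E.
    rewrite -ge0_integral_Z//.
      by apply: eq_integral => w _; rewrite !funeposE.
    by apply: measurable_funepos; apply/measurable_EFinP.
  apply: eq_integral => x _; rewrite !funeposE/= -!EFin_max -EFinM; congr EFin.
  by rewrite maxr_pMr ?normal_pdf_ge0// mulr0 mulrC.
- transitivity (\int[mu]_z ((phi z)%:E * (EFin \o g)^\- z))%E.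
    rewrite -ge0_integral_Z//.
      by apply: eq_integral => w _; rewrite !funenegE.
    by apply: measurable_funeneg; apply/measurable_EFinP.
  apply: eq_integral => x _; rewrite !funenegE/= -!EFin_max -EFinM; congr EFin.
  by rewrite maxr_pMr ?normal_pdf_ge0// mulr0 mulrN mulrC.
Qed.

Context {dO : measure_display} {Om : measurableType dO}.
Variables (P : probability Om R) (V : Om -> R) (B : R).
Hypothesis mV : measurable_fun setT V.
Hypothesis iV : P.-integrable setT (EFin \o V).

(** A Lipschitz test is within [e / 2] of a differentiable one, uniformly and hence under both laws,
    so passing to differentiable tests costs at most [e], for every [e > 0]. *)
Lemma wasserstein_le : (forall h dh : R -> R,
    (forall x : R, is_derive x 1 h (dh x)) -> (forall x, `|dh x| <= 1) ->
    `|Rintegral P setT (h \o V) - normal_mean h| <= B) ->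
  (wasserstein P V PZ Z <= B%:E)%E.
Proof.
move=> hB; apply: ub_ereal_sup => _ [h hlip <-].
have hc : continuous h.
  move=> x; apply/cvgrPdist_le => /= r r0; near=> y.
  by apply: le_trans (hlip _ _) _; near: y; exact: cvgr_dist_le.
have growth (g : R -> R) e : 0 <= e -> (forall x, `|g x - h x| <= e) ->
    forall x, `|g x| <= `|x| + (e + `|h 0|).
  move=> e0 ge x.
  have -> : g x = (g x - h x) + ((h x - h 0) + h 0) by ring.
  apply: le_trans (ler_normD _ _) _.
  rewrite addrCA lerD// (le_trans (ler_normD _ _))// lerD2r.
  by rewrite (le_trans (hlip _ _))// subr0.
have intP (g : R -> R) e : continuous g -> 0 <= e -> (forall x, `|g x - h x| <= e) ->
    P.-integrable setT (EFin \o (g \o V)).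
  move=> gc e0 ge.
  apply: (@integrable_le _ _ _ _ _ (fun w => `|V w| + (e + `|h 0|))).
  - by apply: measurableT_comp => //; exact: continuous_measurable_fun.
  - by apply: integrable_addr; [exact: integrable_norm|exact: integrable_cstr].
  - by move=> w; exact: growth.
have hP : P.-integrable setT (EFin \o (h \o V)).
  by apply: (intP h 0) => // x; rewrite subrr normr0.
have hZ : PZ.-integrable setT (EFin \o (h \o Z)).
  by apply: (@normal_variable_integrable h (0 + `|h 0|)) => //;
    apply: growth => // x; rewrite subrr normr0.
have EP : ('E_P[h \o V] = (Rintegral P setT (h \o V))%:E)%E.
  by rewrite unlock /Rintegral fineK//; exact: integrable_fin_num.
have EZ : ('E_PZ[h \o Z] = (Rintegral PZ setT (h \o Z))%:E)%E.
  by rewrite unlock /Rintegral fineK//; exact: integrable_fin_num.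
rewrite EP EZ -EFinB abse_EFin lee_fin.
apply/ler_addgt0Pr => e e0.
have e20 : 0 < e / 2 by rewrite divr_gt0.
have [g [dg [dgE dg1 ge]]] := lipschitz_smoothing e20 hlip.
have gc : continuous g.
  by move=> x; apply: differentiable_continuous; apply/derivable1_diffP; case: (dgE x).
have gP := intP g _ gc (ltW e20) ge.
have gZ := normal_variable_integrable gc (growth g _ (ltW e20) ge).
have close (dT : measure_display) (T : measurableType dT) (Q : probability T R)
    (U : T -> R) :
    Q.-integrable setT (EFin \o (g \o U)) -> Q.-integrable setT (EFin \o (h \o U)) ->
    `|Rintegral Q setT (g \o U) - Rintegral Q setT (h \o U)| <= e / 2.
  move=> i1 i2.
  have := @Rintegral_dist_le _ _ _ Q (g \o U) (h \o U) (fun=> 1) (e / 2) i1 i2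
    (integrable_cstr Q 1).
  rewrite probability_Rintegral_cst normr1 mulr1; apply=> w.
  exact: ge.
have c1 := close _ _ _ _ gP hP; have c2 := close _ _ _ _ gZ hZ.
have c3 := hB g dg dgE dg1; rewrite -normal_variable_mean// in c3.
move: c1 c2 c3.
move: (Rintegral P _ _) (Rintegral P _ _) (Rintegral PZ _ _) (Rintegral PZ _ _).
move=> a b c d; rewrite !ler_norml => /andP[? ?] /andP[? ?] /andP[? ?].
by apply/andP; split; lra.
Unshelve. all: by end_near. Qed.

End normal_variable.

Lemma wasserstein_ge0 (R : realType) (d1 d2 : measure_display)
    (T1 : measurableType d1) (T2 : measurableType d2) (P1 : probability T1 R)
    (X1 : T1 -> R) (P2 : probability T2 R) (X2 : T2 -> R) :
  (0 <= wasserstein P1 X1 P2 X2)%E.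
Proof.
apply: ereal_sup_ubound; exists (cst 0).
  by move=> x y; rewrite subrr normr0.
by rewrite !expectation_cst subee// abse0.
Qed.

Section local_stein_wasserstein.
Context {R : realType} {dO dZ : measure_display}.
Context {Om : measurableType dO} {OmZ : measurableType dZ}.
Variables (P : probability Om R) (PZ : probability OmZ R) (Z : {RV PZ >-> R}).
Hypothesis ZN : distribution PZ Z = normal_prob 0 1.
Local Notation int1 f := (P.-integrable setT (EFin \o f)).
Local Notation Ex f := (Rintegral P setT f).

(** [V] equals the normalized sum only almost surely, because points on the cube faces are missed by
    the open cubes. Expectations of test functions are unaffected. *)
Lemma local_stein_wasserstein (I : finType) (Y : I -> Om -> R) (N : I -> {set I})
    (K : nat) (t dl dl2 sigma : R) (V : Om -> R) :
  (forall i, L3 P (Y i)) ->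
  (forall i, Ex (fun w => `|Y i w| ^+ 3) <= t ^+ 3) -> 0 < t ->
  (forall i, (#|N i| <= K)%N) -> 0 <= dl -> 0 <= dl2 ->
  (forall i g, bounded_test g \/ g = id ->
    `|Ex (fun w => Y i w * g (partial_sum Y (~: N i) w))| <= dl) ->
  (forall i j g, j \in N i -> bounded_test g ->
    `|Ex (fun w => Y i w * Y j w * g (partial_sum Y (~: (N i :|: N j)) w))
      - Ex (fun w => Y i w * Y j w) *
        Ex (fun w => g (partial_sum Y (~: (N i :|: N j)) w))| <= dl2) ->
  1 <= sigma -> Ex (fun w => partial_sum Y [set: I] w ^+ 2) = sigma ^+ 2 ->
  measurable_fun setT V -> {ae P, forall w, V w = sigma^-1 * partial_sum Y [set: I] w} ->
  (wasserstein P V PZ Z <= (stein_const * #|I|%:R *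
    (2 * dl * sigma^-1 + K%:R * dl2 * sigma^-1
     + 27 * K%:R ^+ 2 * t ^+ 3 * sigma^-1 ^+ 3))%:E)%E.
Proof.
move=> Y3 Yt t0 NK dl0 dl20 cov1 cov2 sigma1 sigmaE mV VE.
have W3 : L3 P (partial_sum Y [set: I]) by exact: L3_sum.
have sW3 : L3 P (fun w => sigma^-1 * partial_sum Y [set: I] w) by exact: L3Z.
have iV : int1 V.
  have /integrableP[mW Woo] := L3_integrable sW3.
  apply/integrableP; split; first exact/measurable_EFinP.
  rewrite (ae_eq_integral (fun w => `|(sigma^-1 * partial_sum Y [set: I] w)%:E|%E))//.
  - by apply: measurableT_comp => //; apply/measurable_EFinP.
  - exact: measurableT_comp.
  - by move: VE; apply: filterS => w /= -> _.
apply: wasserstein_le => // h dh hdh dh1.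
have hc : continuous h.
  by move=> x; apply: differentiable_continuous; apply/derivable1_diffP; case: (hdh x).
have [f [f' [f'' [df df' fE fc]]]] := stein_solution hdh dh1.
have c0 : 0 < @stein_const R := stein_const_gt0 R.
have := local_stein_bound Y3 Yt t0 NK dl0 dl20 cov1 cov2 sigma1 sigmaE df df' fc c0.
apply: le_trans; rewrite le_eqVlt; apply/orP; left; apply/eqP; congr `|_|.
under [RHS]eq_Rintegral do rewrite fE.
have ihW : int1 (h \o (fun w => sigma^-1 * partial_sum Y [set: I] w)).
  apply: (@integrable_le _ _ _ _ _
    (fun w => `|sigma^-1 * partial_sum Y [set: I] w| + `|h 0|)).
  - apply: measurableT_comp; first exact: continuous_measurable_fun.
    by case: sW3.
  - apply: integrable_addr; last exact: integrable_cstr.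
    by apply: L3_integrable; exact: L3_norm.
  - move=> w /=; rewrite -[X in h X](subr0 (sigma^-1 * _)).
    have := is_derive_lipschitz hdh dh1 (sigma^-1 * partial_sum Y [set: I] w) 0.
    rewrite mul1r subr0 => hl.
    by rewrite -[h _](subrK (h 0)) (le_trans (ler_normD _ _))// lerD2r.
rewrite RintegralB//; last exact: integrable_cstr.
rewrite probability_Rintegral_cst; congr (_ - _).
rewrite /Rintegral; congr fine; apply: ae_eq_integral => //.
- apply/measurable_EFinP/measurableT_comp => //.
  exact: continuous_measurable_fun.
- by case/integrableP : ihW.
- by move: VE; apply: filterS => w /= -> _.
Qed.

End local_stein_wasserstein.

(** * Counting measures and sums over random finite sets *)

Section counting_measure_on.
Context {R : realType} d (E : measurableType d).

Definition counting_on (S : set E) (D : set E) : \bar R := counting (S `&` D).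

Section measure.
Variable S : set E.

Let counting_on0 : counting_on S set0 = 0%E.
Proof. by rewrite /counting_on setI0 /counting asboolT// fset_set0. Qed.

Let counting_on_ge0 D : (0 <= counting_on S D)%E.
Proof. exact: counting_ge0. Qed.

Let counting_on_sigma_additive : semi_sigma_additive (counting_on S).
Proof.
move=> F mF tF mUF.
have -> : counting_on S (\bigcup_n F n) = (\sum_(0 <= n <oo) counting_on S (F n))%E.
  by rewrite /counting_on setI_bigcupr counting_bigcup//; exact: trivIset_setIl.
by apply: is_cvg_ereal_nneg_natsum_cond => n _ _; exact: counting_ge0.
Qed.

HB.instance Definition _ := isMeasure.Build _ _ _ (counting_on S)
  counting_on0 counting_on_ge0 counting_on_sigma_additive.

End measure.

Lemma counting_finite (S : set E) : finite_set S ->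
  counting S = (#|` fset_set S|)%:R%:E :> \bar R.
Proof. by move=> fS; rewrite /counting asboolT. Qed.

(** For finite [S] the measure is a finite sum of Dirac masses, obtained by enumerating [S]. *)
Lemma ge0_integral_counting_on (S : set E) (f : E -> R) : finite_set S ->
  (forall z, 0 <= f z) -> measurable_fun setT f ->
  (\int[counting_on S]_z (f z)%:E = (\sum_(z \in S) f z)%:E)%E.
Proof.
move=> fS f0 mf; rewrite fsbig_finite//=.
pose s : seq E := fset_set S.
pose m n : {measure set E -> \bar R} := \d_(nth point s n).
have mE D : counting_on S D = msum m (size s) D.
  rewrite /counting_on /msum/= counting_finite; last exact: finite_setIl.
  transitivity ((\sum_(z <- s) \1_D z)%:E : \bar R); last first.
    rewrite (big_nth point) big_mkord -sumEFin.
    by apply: eq_bigr => i _; rewrite diracE indicE.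
  congr EFin.
  have -> : fset_set (S `&` D) = [fset z in fset_set S | z \in D]%fset.
    apply/fsetP => z; rewrite in_fset_set; last exact: finite_setIl.
    by rewrite !inE/= in_fset_set// in_setI.
  rewrite -[#|` _|%fset]/(size _) -sum1_size natr_sum big_fset/= big_mkcond.
  by apply: eq_bigr => z _; rewrite indicE; case: ifP.
rewrite (eq_measure_integral (msum m (size s))); last by move=> D _ _; exact: mE.
rewrite ge0_integral_measure_sum//; [|by move=> z _; rewrite lee_fin|exact/measurable_EFinP].
rewrite (big_nth point) big_mkord -sumEFin.
apply: eq_bigr => i _; rewrite integral_dirac//; last exact/measurable_EFinP.
by rewrite diracT mul1e.
Qed.

Lemma counting_set0 : counting (set0 : set E) = 0%E :> \bar R.
Proof. by rewrite /counting asboolT// fset_set0. Qed.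

End counting_measure_on.

Section random_finite_set.
Context {R : realType} d d' (T : measurableType d) (E : measurableType d').
Variable N : T -> set E.
Hypothesis fN : forall t, finite_set (N t).
Hypothesis mN : forall D, measurable D ->
  measurable_fun setT (fun t => counting (N t `&` D) : \bar R).

(* The random set restricted to the event that it has [n] points; its counting
   measures are bounded, hence a finite kernel. *)
Let Nn n t : set E := [set z | N t z /\ counting (N t) = n%:R%:E :> \bar R].

Let eventn n := [set t | counting (N t) = n%:R%:E :> \bar R].

Let mevent n : measurable (eventn n).
Proof.
have mc : measurable_fun setT (fun t => counting (N t) : \bar R).
  have -> : (fun t => counting (N t) : \bar R) = (fun t => counting (N t `&` setT)).
    by apply/funext => t; rewrite setIT.
  exact: mN.
rewrite -[X in measurable X]setTI.
exact: (mc measurableT [set n%:R%:E]).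
Qed.

Let NnE n t D : counting (Nn n t `&` D) =
  (counting (N t `&` D) * (\1_(eventn n) t)%:E)%E :> \bar R.
Proof.
rewrite indicE; case: (boolP (t \in eventn n)) => [/set_mem te|/negP te].
  rewrite mule1; congr counting; apply/seteqP; split=> z /= [].
    by move=> [].
  by move=> ? ?; do !split.
rewrite mule0 (_ : Nn n t `&` D = set0) ?counting_set0//.
by apply/seteqP; split=> z //= [[_ ?] _]; apply: te; rewrite inE.
Qed.

Let kn n t : {measure set E -> \bar R} := counting_on (Nn n t).

Let mkn n U : measurable U -> measurable_fun setT (kn n ^~ U).
Proof.
move=> mU; rewrite [X in measurable_fun _ X](_ : _ = fun t =>
  (counting (N t `&` U) * (\1_(eventn n) t)%:E)%E); last by apply/funext => t; exact: NnE.
apply: emeasurable_funM; first exact: mN.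
exact/measurable_EFinP/measurable_indic.
Qed.

HB.instance Definition _ n := isKernel.Build _ _ _ _ _ (kn n) (@mkn n).

Let kn_bound n : measure_fam_uub (kn n).
Proof.
exists n.+1%:R => t; rewrite /kn/= /counting_on NnE setIT indicE.
case: (boolP (t \in _)) => [/set_mem te|_].
  by rewrite mule1 te lte_fin ltr_nat.
by rewrite mule0 lte_fin ltr0n.
Qed.

HB.instance Definition _ n := Kernel_isFinite.Build _ _ _ _ R (kn n) (@kn_bound n).

Let counting_series t D :
  counting (N t `&` D) = (\sum_(0 <= n <oo) counting (Nn n t `&` D))%E :> \bar R.
Proof.
have [m cm] : exists m, counting (N t) = m%:R%:E :> \bar R.
  by rewrite counting_finite//; eexists.
have te : t \in eventn m by rewrite inE.
rewrite (@nneseriesD1 _ _ m)//.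
rewrite eseries0 ?adde0; last first.
  move=> k _ /= km; rewrite NnE indicE (_ : t \in _ = false) ?mule0//.
  apply/negbTE/negP => /set_mem; rewrite /eventn/= cm => -[] /eqP.
  by rewrite eqr_nat eq_sym => /eqP; exact/eqP.
by rewrite NnE indicE te mule1.
Qed.

(** For a finite kernel the mass of a section is measurable. Slicing by the number of points
    produces finite kernels, and at each [t] exactly one slice can contribute. *)
Lemma measurable_counting_xsection (A : set (T * E)) : measurable A ->
  measurable_fun setT (fun t => counting (N t `&` xsection A t) : \bar R).
Proof.
move=> mA; rewrite [X in measurable_fun _ X](_ : _ = fun t =>
  (\sum_(0 <= n <oo) kn n t (xsection A t))%E); last first.
  by apply/funext => t; rewrite counting_series.
apply: ge0_emeasurable_sum => // n _.
by apply: measurable_fun_xsection_finite_kernel; rewrite inE.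
Qed.

Import HBNNSimple.

(** The sum is an integral against a counting measure depending on [t]. Approximation of [G] by
    simple functions reduces measurability to that of the masses of sections. *)
Lemma ge0_measurable_sum_random_set (G : T * E -> R) :
  (forall z, 0 <= G z) -> measurable_fun setT G ->
  measurable_fun setT (fun t => \sum_(z \in N t) G (t, z)).
Proof.
move=> G0 mG; apply/measurable_EFinP.
rewrite [X in measurable_fun _ X](_ : _ = fun t =>
  (\int[counting_on (N t)]_z (G (t, z))%:E)%E); last first.
  apply/funext => t; rewrite /= ge0_integral_counting_on//.
  exact: measurableT_comp mG _.
have mG' : measurable_fun setT (EFin \o G) by exact/measurable_EFinP.
have G0' z : (0 <= (EFin \o G) z)%E by rewrite lee_fin.
pose G_ := nnsfun_approx measurableT mG'.
apply: (@measurable_fun_xsection_integral _ _ _ _ _ (EFin \o G)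
  (fun t => counting_on (N t)) G_).
- by move=> a b ab; exact/nd_nnsfun_approx.
- by move=> z; exact: cvg_nnsfun_approx.
- move=> n r; apply: measurable_counting_xsection.
  exact: measurable_funPTI.
Qed.

Lemma measurable_sum_random_set (G : T * E -> R) : measurable_fun setT G ->
  measurable_fun setT (fun t => \sum_(z \in N t) G (t, z)).
Proof.
move=> mG.
rewrite [X in measurable_fun _ X](_ : _ = fun t =>
  \sum_(z \in N t) G^\+ (t, z) - \sum_(z \in N t) G^\- (t, z)); last first.
  apply/funext => t; rewrite !fsbig_finite//= -sumrB.
  by apply: eq_bigr => z _; rewrite -[in LHS](funrposBneg G).
apply: measurable_funB; apply: ge0_measurable_sum_random_set.
- exact: funrpos_ge0.
- exact: measurable_funrpos.
- exact: funrneg_ge0.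
- exact: measurable_funrneg.
Qed.

End random_finite_set.

Local Notation edist := Defs.edist.

(** * Boxes and windows *)

Section boxes.
Context {R : realType} {d : nat}.
Local Notation pt := (d.-tuple R).
Implicit Types (x y a b : pt).

Lemma measurable_coordinates (A : 'I_d -> set R) : (forall i, measurable (A i)) ->
  measurable [set x : pt | forall i, A i (tnth x i)].
Proof.
move=> mA; rewrite [X in measurable X](_ : _ =
    \bigcap_(i in [set: 'I_d]) ((@tnth d R)^~ i @^-1` A i)); last first.
  by apply/seteqP; split=> x h i => [_|]; exact: h.
apply: fin_bigcap_measurable => // i _.
by rewrite -[X in measurable X]setTI; exact: measurable_tnth.
Qed.

Lemma measurable_closed_box a b : measurable (closed_box a b).
Proof.
rewrite (_ : closed_box a b =
    [set x | forall i, [set` `[tnth a i, tnth b i]] (tnth x i)]).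
  by apply: (measurable_coordinates (A := fun i => `[tnth a i, tnth b i]%classic)).
by apply/seteqP; split=> x h i; have := h i; rewrite /= in_itv.
Qed.

Lemma measurable_open_box a b : measurable (open_box a b).
Proof.
rewrite (_ : open_box a b =
    [set x | forall i, [set` `]tnth a i, tnth b i[] (tnth x i)]).
  by apply: (measurable_coordinates (A := fun i => `]tnth a i, tnth b i[%classic)).
by apply/seteqP; split=> x h i; have := h i; rewrite /= in_itv.
Qed.

Lemma window_closed_box (lam : R) : window lam =
  closed_box [tuple - (lam `^ d%:R^-1 / 2) | i < d] [tuple lam `^ d%:R^-1 / 2 | i < d].
Proof.
by apply/seteqP; split=> x h i; have := h i; rewrite !tnth_mktuple.
Qed.

Lemma measurable_window (lam : R) : measurable (window lam : set pt).
Proof. by rewrite window_closed_box; exact: measurable_closed_box. Qed.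

Lemma edist_le (x y : pt) (D : R) : 0 <= D ->
  (forall i, `|tnth x i - tnth y i| <= D) -> edist x y <= d%:R * D.
Proof.
move=> D0 xyD; have dD : 0 <= d%:R * D by rewrite mulr_ge0.
rewrite /edist -[leRHS]ger0_norm// -sqrtr_sqr ler_sqrt ?sqr_ge0//.
apply: (@le_trans _ _ (\sum_(i < d) D ^+ 2)).
  apply: ler_sum => i _; rewrite -[leLHS]real_normK ?num_real//.
  by rewrite lerXn2r ?nnegrE.
rewrite sumr_const card_ord -[leLHS]mulr_natl exprMn ler_wpM2r ?sqr_ge0//.
by rewrite -natrX ler_nat; case: (d) => // n; rewrite leq_pmulr.
Qed.

Lemma edist_ge (x y : pt) i : `|tnth x i - tnth y i| <= edist x y.
Proof.
rewrite /edist -sqrtr_sqr ler_sqrt; last by apply: sumr_ge0 => j _; exact: sqr_ge0.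
by rewrite (bigD1 i)//= lerDl sumr_ge0// => j _; exact: sqr_ge0.
Qed.

Lemma bounded_closed_box a b : bounded_region (closed_box a b).
Proof.
pose D := \sum_(i < d) `|tnth b i - tnth a i|.
exists (d%:R * D) => x y ax ay; apply: edist_le.
  exact: sumr_ge0.
move=> i; rewrite /D (bigD1 i)//= ler_wpDr ?sumr_ge0//.
have /andP[? ?] := ax i; have /andP[? ?] := ay i.
have ab : 0 <= tnth b i - tnth a i by lra.
by rewrite (ger0_norm ab) ler_norml; apply/andP; split; lra.
Qed.

Lemma bounded_window (lam : R) : bounded_region (window lam : set pt).
Proof. by rewrite window_closed_box; exact: bounded_closed_box. Qed.

Lemma bounded_regionS (A B : set pt) : A `<=` B -> bounded_region B -> bounded_region A.
Proof. by move=> AB [r Br]; exists r => x y /AB Bx /AB By; exact: Br. Qed.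

End boxes.

Lemma measurable_eq_tuple (R : realType) (d : nat) dT (T : measurableType dT)
    (f g : T -> d.-tuple R) : measurable_fun setT f -> measurable_fun setT g ->
  measurable [set t | f t = g t].
Proof.
move=> /measurable_fun_tnthP mf /measurable_fun_tnthP mg.
rewrite [X in measurable X](_ : _ = \bigcap_(i in [set: 'I_d])
    [set t | tnth (f t) i == tnth (g t) i]); last first.
  apply/seteqP; split=> t /= h; first by move=> i _ /=; rewrite h.
  by apply: eq_from_tnth => i; apply/eqP; exact: (h i).
apply: fin_bigcap_measurable => // i _.
rewrite -[X in measurable X]setTI.
have H := measurable_fun_eqr (mf i) (mg i).
have H2 := H measurableT [set true].
exact: H2.
Qed.

(** * Measurability of score sums *)

Section scores_measurability.
Context {R : realType} {d : nat} {dM : measure_display} {M : measurableType dM}.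
Local Notation pt := (d.-tuple R).
Local Notation conf := (marked_config R d M).
Variables (xi : pt * M -> conf -> set pt -> R).
Hypothesis xiS : is_score xi.

Lemma measurable_score_at (lam : R) :
  measurable_fun setT (fun z : pt * conf => score_at xi z.1 z.2 (window lam)).
Proof.
have [mxi xi0] := xiS.
pose W : set pt := window lam.
have mW : measurable W by exact: measurable_window.
pose N (t : pt * conf) : set (pt * M) := points t.2 `&` fst @^-1` W.
have fN t : finite_set (N t).
  by apply: points_locally_finite; exact: bounded_window.
have mfW : measurable (@fst pt M @^-1` W).
  by rewrite -[X in measurable X]setTI; exact: measurable_fst.
have mN D : measurable D ->
    measurable_fun setT (fun t => counting (N t `&` D) : \bar R).
  move=> mD; rewrite [X in measurable_fun _ X](_ : _ =
    (fun phi : conf => counting (phi `&` (fst @^-1` W `&` D))) \o snd); last first.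
    by apply/funext => t; rewrite /N /= setIA.
  apply: measurableT_comp => //.
  by apply: (@measurable_evaluation _ _ _ _ fst); exact: measurableI.
(* The sum over the marks at [x] becomes a sum over all points in the window, weighted by the
   indicator that the position equals [x]: a measurable function summed over a random finite set. *)
pose G (u : (pt * conf) * (pt * M)) : R :=
  \1_[set v : (pt * conf) * (pt * M) | v.2.1 = v.1.1] u * xi u.2 u.1.2 W.
have mG : measurable_fun setT G.
  apply: measurable_funM.
    apply: measurable_indic; apply: measurable_eq_tuple.
      exact: measurableT_comp.
    exact: measurableT_comp.
  have := mxi W mW.
  pose e (u : (pt * conf) * (pt * M)) := (u.2, u.1.2).
  move=> mxiW.
  apply: (measurableT_comp (f := fun z : (pt * M) * conf => xi z.1 z.2 W) (g := e)) => //.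
  apply: measurable_fun_pair => //.
  exact: measurableT_comp.
rewrite [X in measurable_fun _ X](_ : _ = fun t => \sum_(z \in N t) G (t, z)).
  exact: measurable_sum_random_set.
apply/funext => -[x phi] /=; rewrite /score_at -/W.
have G0 z : z.1 <> x -> G ((x, phi), z) = 0.
  by move=> zx; rewrite /G indicE memNset ?mul0r.
(* For [x] outside the window both sums vanish: one by the convention on scores, the other because
   no point of [N] has position [x]. *)
have [Wx|nWx] := pselect (W x); last first.
  rewrite !fsbig1//.
    move=> [y m] /= [_ Wy]; apply: G0 => /= yx; apply: nWx; by rewrite -yx.
  by move=> m _; rewrite xi0// => -[].
rewrite -(fsbig_widen ((fun m => (x, m)) @` [set m | points phi (x, m)]) (N (x, phi))).
- rewrite fsbig_image; last by move=> m m' _ _ [].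
  apply: eq_fsbigr => m _.
  by rewrite /G indicE mem_set//= mul1r.
- by move=> _ [m pm <-]; split.
- move=> [y m] [[py Wy] nP]; apply: G0 => /= yx; apply: nP.
  by exists m => //=; rewrite -yx.
Qed.

Context {dO : measure_display} {Om : measurableType dO} {P : probability Om R}.
Variable X : @marked_point_process R d dM dO M Om.

Lemma finite_ground (B : set pt) w : bounded_region B ->
  finite_set (points (ground (X w)) `&` B).
Proof. exact: points_locally_finite. Qed.

Let measurable_ground_count (B D : set pt) : measurable B -> measurable D ->
  measurable_fun setT (fun w => counting (points (ground (X w)) `&` B `&` D) : \bar R).
Proof.
move=> mB mD.
have := measurable_num_points X (measurableI _ _ mB mD).
by congr measurable_fun; apply/funext => w; rewrite /num_points setIA.
Qed.

Lemma measurable_ground_sum (B : set pt) (f : pt * conf -> R) :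
  measurable B -> bounded_region B -> measurable_fun setT f ->
  measurable_fun setT (fun w => \sum_(x \in points (ground (X w)) `&` B) f (x, X w : conf)).
Proof.
move=> mB bB mf.
pose e (u : Om * pt) := (u.2, X u.1 : conf).
have me : measurable_fun setT e.
  by apply: measurable_fun_pair => //; exact: measurableT_comp.
apply: (@measurable_sum_random_set _ _ _ _ _ (fun w => points (ground (X w)) `&` B)
   _ _ (f \o e)).
- by move=> w; exact: finite_ground.
- by move=> D; exact: measurable_ground_count.
- exact: measurableT_comp.
Qed.

Lemma measurable_score_sum (lam : R) (A : set pt) :
  measurable A -> bounded_region A -> measurable_fun setT (score_sum X xi lam A).
Proof.
move=> mA bA.
exact: (measurable_ground_sum mA bA (measurable_score_at lam)).
Qed.

End scores_measurability.

(** * Campbell's formula *)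

Section campbell.
Context {R : realType} {d : nat} {dM dO : measure_display}.
Context {M : measurableType dM} {Om : measurableType dO}.
Variable P : probability Om R.
Local Notation pt := (d.-tuple R).
Local Notation conf := (marked_config R d M).
Variables (X : @marked_point_process R d dM dO M Om) (palm : R.-pker pt ~> conf).
Hypothesis palmP : is_palm P X palm.
Variable B : set pt.
Hypotheses (mB : measurable B) (bB : bounded_region B).
Local Notation I := (intensity_measure P X).
Hypothesis IB : (I B < +oo)%E.

Let N w : set pt := points (ground (X w)) `&` B.
Let fN w : finite_set (N w). Proof. exact: finite_ground. Qed.

Let marked_points w : set (pt * conf) := (fun x => (x, X w : conf)) @` N w.

Let counting_marked w (C : set (pt * conf)) :
  counting (marked_points w `&` C) =
  counting (N w `&` [set x | C (x, X w : conf)]) :> \bar R.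
Proof.
rewrite -[RHS](counting_image_inj (f := fun x => (x, X w : conf))); last first.
  by move=> x y _ _ [].
congr counting; apply/seteqP; split=> [_ [[x Nx <-] Cx]|_ [x [Nx Cx] <-]].
  by exists x.
by split=> //; exists x.
Qed.

Let kL w : {measure set (pt * conf) -> \bar R} := counting_on (marked_points w).

Let mkL U : measurable U -> measurable_fun setT (kL ^~ U).
Proof.
move=> mU.
pose e (u : Om * pt) := (u.2, X u.1 : conf).
have me : measurable_fun setT e.
  by apply: measurable_fun_pair => //; exact: measurableT_comp.
have mD D : measurable D ->
    measurable_fun setT (fun w => counting (N w `&` D) : \bar R).
  move=> mD; have := measurable_num_points X (measurableI _ _ mB mD).
  by congr measurable_fun; apply/funext => w; rewrite /num_points /N setIA.
have meU : measurable (e @^-1` U) by rewrite -[X in measurable X]setTI; exact: me.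
have := measurable_counting_xsection fN mD meU.
congr measurable_fun; apply/funext => w; rewrite /kL/= /counting_on counting_marked.
by congr counting; apply/seteqP; split=> x [Nx] /=; rewrite /xsection/= ?inE.
Qed.

Let pair_conf (x : pt) (phi : conf) : pt * conf := (x, phi).

Let measurable_pair_conf x : measurable_fun setT (pair_conf x).
Proof. exact: measurable_fun_pair. Qed.

Let palm_at x : {measure set (pt * conf) -> \bar R} :=
  measure_function_pushforward__canonical__measure_function_Measure
    (palm x) (measurable_pair_conf x).

Let indicB_ge0 (x : pt) : 0 <= \1_B x :> R. Proof. by []. Qed.

(** The law of [(x, phi)], with [phi] distributed according to the Palm measure at [x], restricted
    to locations in [B]. *)
Let kR (x : pt) : {measure set (pt * conf) -> \bar R} :=
  mscale (NngNum (indicB_ge0 x)) (palm_at x).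

Let kRE x U : kR x U = ((\1_B x)%:E * palm x (xsection U x))%E.
Proof.
rewrite /kR/= /mscale/= /palm_at/= /pushforward; congr (_ * palm x _)%E.
by apply/seteqP; split=> phi /=; rewrite /xsection/= inE.
Qed.

Let mkR U : measurable U -> measurable_fun setT (kR ^~ U).
Proof.
move=> mU; rewrite [X in measurable_fun _ X](_ : _ = fun x =>
  ((\1_B x)%:E * palm x (xsection U x))%E); last by apply/funext => x; exact: kRE.
apply: emeasurable_funM; first exact/measurable_EFinP/measurable_indic.
by apply: measurable_fun_xsection_finite_kernel; rewrite inE.
Qed.

Let rectangles :=
  [set A `*` E | A in @measurable _ pt & E in @measurable _ conf].

Let mixture_rectangle A E : measurable A -> measurable E ->
  mixture P mkL (A `*` E) = mixture (intensity_measure P X) mkR (A `*` E).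
Proof.
move=> mA mE; rewrite /mixture.
have mXE : measurable (X @^-1` E) by exact: measurable_funPTI.
transitivity (\int[P]_(w in X @^-1` E) num_points X (B `&` A) w)%E.
  rewrite [RHS]integral_mkcond; apply: eq_integral => w _.
  rewrite /kL/= /counting_on counting_marked patchE.
  case: ifPn => [/set_mem XE|/negP XE].
    rewrite /num_points setIA; congr counting.
    by apply/seteqP; split=> x [? ] // [].
  rewrite (_ : _ `&` _ = set0) ?counting_set0//.
  by apply/seteqP; split=> x // [_ [_ /= XwE]]; apply: XE; rewrite inE.
rewrite palmP//; last exact: measurableI.
rewrite [LHS]integral_mkcond; apply: eq_integral => x _.
rewrite kRE patchE indicE in_setI.
case: (x \in B); rewrite ?mul0e//= mul1e.
case: ifPn => xA; first by rewrite in_xsectionX.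
by rewrite notin_xsectionX// measure0.
Qed.

(** Both sides integrate [f] against a mixture on pairs of a location and a configuration: counting
    measures mixed by [P], Palm laws mixed by the intensity measure. [is_palm] gives equality on
    rectangles; these form a generating pi-system, and the total mass is the finite [I B]. *)
Lemma campbell (f : pt * conf -> R) : (forall z, 0 <= f z) -> measurable_fun setT f ->
  (\int[P]_w (\sum_(x \in points (ground (X w)) `&` B) f (x, X w : conf))%:E =
   \int[I]_x ((\1_B x)%:E * \int[palm x]_phi (f (x, phi))%:E))%E.
Proof.
move=> f0 mf.
have mEf : measurable_fun setT (EFin \o f) by exact/measurable_EFinP.
transitivity (\int[mixture P mkL]_z (f z)%:E)%E.
  rewrite ge0_integral_mixture//.
  apply: eq_integral => w _; rewrite ge0_integral_counting_on//.
    by rewrite fsbig_image// => x y _ _ [].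
  exact: finite_image.
transitivity (\int[mixture (intensity_measure P X) mkR]_z (f z)%:E)%E.
  apply: eq_measure_integral => C mC _.
  apply: (measure_unique rectangles (fun=> setT)) => //.
  - exact: measurable_prod_measurableType.
  - move=> _ _ [A1 mA1 [E1 mE1 <-]] [A2 mA2 [E2 mE2 <-]].
    exists (A1 `&` A2); first exact: measurableI.
    by exists (E1 `&` E2); [exact: measurableI|rewrite setXI].
  - by move=> _; exists setT => //; exists setT => //; rewrite setXTT.
  - by rewrite bigcup_const.
  - by move=> _ [A mA [E mE <-]]; exact: mixture_rectangle.
  - move=> _; apply: (@le_lt_trans _ _ (mixture P mkL (setT `*` setT))).
      by rewrite setXTT.
    rewrite mixture_rectangle//.
    rewrite /mixture (eq_integral (fun x => (\1_B x)%:E)); last first.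
      by move=> x _; rewrite kRE in_xsectionX ?inE// prob_kernel mule1.
    by rewrite integral_indic// setIT.
rewrite ge0_integral_mixture//; apply: eq_integral => x _.
rewrite ge0_integral_mscale//=; last by move=> z _; rewrite lee_fin.
congr (_ * _)%E; rewrite ge0_integral_pushforward//.
by move=> z _; rewrite lee_fin.
Qed.

End campbell.

(** * Inequalities for the moment exponents *)

Lemma sum_expr3_le (R : realType) (I : Type) (s : seq I) (a : I -> R) :
  (forall i, 0 <= a i) ->
  (\sum_(i <- s) a i) ^+ 3 <= 3 * (size s)%:R ^+ 2 * \sum_(i <- s) a i ^+ 3.
Proof.
move=> a0; set n : R := (size s)%:R.
have sum1 : \sum_(i <- s) (1 : R) = n by rewrite big_const_seq count_predT iter_addr_0.
have sumc c : \sum_(i <- s) c = n * c by rewrite -sum1 mulr_suml; under [RHS]eq_bigr do rewrite mul1r.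
set S := \sum_(i <- s) a i ^+ 3.
have -> : (\sum_(i <- s) a i) ^+ 3 =
    \sum_(i <- s) \sum_(j <- s) \sum_(k <- s) a i * a j * a k.
  rewrite 2!exprSr expr1 mulr_suml.
  under eq_bigr do rewrite mulr_sumr.
  rewrite mulr_suml; apply: eq_bigr => i _; rewrite mulr_suml.
  by apply: eq_bigr => j _; rewrite mulr_sumr.
(* [mulr3_le_sum] for every product of the expanded cube; the three resulting triple sums are equal,
   hence the factor 3. *)
apply: (@le_trans _ _
    (\sum_(i <- s) \sum_(j <- s) \sum_(k <- s) (a i ^+ 3 + a j ^+ 3 + a k ^+ 3))).
  by do 3! (apply: ler_sum => ? _); exact: mulr3_le_sum.
under eq_bigr => i _ do under eq_bigr => j _ do rewrite big_split/= sumc -/S.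
under eq_bigr => i _ do rewrite big_split/= sumc -mulr_sumr big_split/= sumc -/S.
rewrite big_split/= sumc -mulr_sumr big_split/= -mulr_sumr sumc -/S.
by rewrite le_eqVlt; apply/orP; left; apply/eqP; ring.
Qed.

Section moment_exponents.
Context {R : realType} (p1 p2 : R).
Hypotheses (p11 : 1 <= p1) (p21 : 1 <= p2) (p123 : 3 <= p1 * p2 / (p1 + p2 - 1)).

Let p123' : 3 * (p1 + p2 - 1) <= p1 * p2.
Proof.
have z0 : 0 < p1 + p2 - 1 by move: p11 p21; lra.
by rewrite -(ler_pdivlMr _ _ z0).
Qed.

(** The assumption reads [3 * (p2 - 1) <= p1 * (p2 - 3)]. With [p2 <= 3] the right side is at most
    0, so [p2 = 1], and then [3 * p1 <= p1]. *)
Lemma score_exponent_gt3 : 3 < p2.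
Proof.
rewrite ltNge; apply/negP => p23.
have : 0 <= p1 * (3 - p2) by apply: mulr_ge0; move: p11 p23; lra.
have := p123' => le3 p13.
have p2E : p2 = 1 by move: le3 p13 p21; lra.
by move: le3 p11; rewrite p2E; lra.
Qed.

(** A case distinction does the work of Young's inequality. If n^2 <= y^(p2-3), the product is at
    most y^p2. Otherwise y <= n^(2/(p2-3)), and the product is at most n^(2 p2/(p2-3)); this
    exponent is at most [p1 - 1] precisely when [3 * (p1 + p2 - 1) <= p1 * p2]. *)
Lemma sqr_mul_cube_le (n y : R) : 1 <= n -> 0 <= y ->
  n ^+ 2 * y ^+ 3 <= n `^ (p1 - 1) + y `^ p2.
Proof.
move=> n1; rewrite le_eqVlt => /predU1P[<-|y0].
  by rewrite expr0n/= mulr0 addr_ge0// powR_ge0.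
have p23 := score_exponent_gt3.
have n0 : 0 < n by lra.
have [le|gt] := leP (n ^+ 2) (y `^ (p2 - 3)).
  rewrite ler_wpDl ?powR_ge0//.
  apply: (@le_trans _ _ (y `^ (p2 - 3) * y ^+ 3)).
    by rewrite ler_wpM2r// exprn_ge0// ltW.
  rewrite -powR_mulrn ?(ltW y0)// -powRD ?subrK//.
  by rewrite (gt_eqF y0) implybT.
rewrite ler_wpDr ?powR_ge0//.
have q0 : 0 < p2 - 3 by lra.
have yn : y <= n `^ (2 / (p2 - 3)).
  have -> : y = (y `^ (p2 - 3)) `^ (p2 - 3)^-1.
    by rewrite -powRrM mulfV ?gt_eqF// powRr1// ltW.
  rewrite powRrM powR_mulrn ?(ltW n0)//.
  by rewrite ge0_ler_powR ?nnegrE ?invr_ge0 ?powR_ge0 ?exprn_ge0 ?(ltW n0) ?(ltW q0) ?(ltW gt).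
apply: (@le_trans _ _ (n `^ 2 * (n `^ (2 / (p2 - 3))) ^+ 3)).
  rewrite powR_mulrn ?(ltW n0)// ler_wpM2l ?exprn_ge0 ?(ltW n0)//.
  by rewrite lerXn2r ?nnegrE ?powR_ge0 ?(ltW y0).
rewrite -powR_mulrn ?powR_ge0// -powRrM -powRD; last by rewrite (gt_eqF n0) implybT.
rewrite ler_powR//.
have -> : 2 + 2 / (p2 - 3) * 3 = (2 * p2) / (p2 - 3) by field; rewrite gt_eqF.
by rewrite ler_pdivrMr//; have := p123'; nra.
Qed.

End moment_exponents.

(** * Stationarity *)

Section stationarity.
Context {R : realType} {d : nat} {dM dO : measure_display}.
Context {M : measurableType dM} {Om : measurableType dO}.
Variable P : probability Om R.
Local Notation pt := (d.-tuple R).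
Variables (X : @marked_point_process R d dM dO M Om).
Hypothesis statX : stationary P X.

Lemma translate_inj (v : pt) : injective (translate v).
Proof.
move=> x y xy; apply: eq_from_tnth => i.
by have := congr1 (fun z => tnth z i) xy; rewrite !tnth_mktuple => /addIr.
Qed.

(** Stationarity concerns events of ground configurations, so both integrals are rewritten over the
    law of the count. Translations are injective, hence preserve counts. *)
Lemma stationary_num_points (v : pt) (B : set pt) (g : \bar R -> \bar R) :
  measurable B -> measurable (translate v @` B) ->
  measurable_fun setT g -> (forall y, 0 <= g y)%E ->
  (\int[P]_w g (num_points X (translate v @` B) w) = \int[P]_w g (num_points X B w))%E.
Proof.
move=> mB mvB mg g0.
have mX := measurable_num_points X mB.
have mvX := measurable_num_points X mvB.
transitivity (\int[pushforward P (num_points X (translate v @` B))]_y g y)%E.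
  by rewrite ge0_integral_pushforward.
transitivity (\int[pushforward P (num_points X B)]_y g y)%E; last first.
  by rewrite ge0_integral_pushforward.
pose m1 : {measure set (\bar R) -> \bar R} :=
  measure_function_pushforward__canonical__measure_function_Measure P mvX.
apply: (@eq_measure_integral _ _ _ setT
  (measure_function_pushforward__canonical__measure_function_Measure P mX) m1).
move=> A mA _; rewrite /= /pushforward.
pose E : set (point_config R d) :=
  (fun phi : point_config R d => counting (points phi `&` translate v @` B) : \bar R) @^-1` A.
have mE : measurable E.
  rewrite -[X in measurable X]setTI.
  exact: (@measurable_evaluation R d _ _ id _ mvB).
have := statX v mE; rewrite -[RHS]/(P (num_points X (translate v @` B) @^-1` A)) => <-.
have cE w : counting (points (Defs.shift v (ground (X w))) `&` translate v @` B) =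
    counting (points (ground (X w)) `&` B) :> \bar R.
  rewrite -[RHS](counting_image_inj (f := translate v)); last first.
    by move=> ? ? _ _; exact: translate_inj.
  congr counting; apply/seteqP; split=> [_ [[x Xx <-] [y By /translate_inj yx]]|].
    by exists x => //; split=> //; rewrite -yx.
  by move=> _ [x [Xx Bx] <-]; split; exists x.
by congr (P _); apply/seteqP; split=> w; rewrite /E /= /num_points cE.
Qed.

Lemma stationary_intensity (v : pt) (B : set pt) :
  measurable B -> measurable (translate v @` B) ->
  intensity_measure P X (translate v @` B) = intensity_measure P X B.
Proof.
move=> mB mvB.
have ge0 C w : (0 <= num_points X C w)%E by exact: counting_ge0.
transitivity (\int[P]_w `|num_points X (translate v @` B) w|)%E.
  by apply: eq_integral => w _; rewrite gee0_abs.
rewrite (@stationary_num_points v B abse)//.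
by apply: eq_integral => w _; rewrite gee0_abs.
Qed.

Definition unit_cube (v : pt) : set pt :=
  [set x | forall i, `|tnth x i - tnth v i| <= 1 / 2].

Lemma unit_cube_closed_box v : unit_cube v =
  closed_box [tuple tnth v i - 1 / 2 | i < d] [tuple tnth v i + 1 / 2 | i < d].
Proof.
apply/seteqP; split=> x h i; have := h i; rewrite !tnth_mktuple.
  by rewrite ler_norml => /andP[? ?]; apply/andP; split; lra.
by move=> /andP[? ?]; rewrite ler_norml; apply/andP; split; lra.
Qed.

Lemma measurable_unit_cube v : measurable (unit_cube v).
Proof. by rewrite unit_cube_closed_box; exact: measurable_closed_box. Qed.

Lemma translate_window1 v : translate v @` window 1 = unit_cube v.
Proof.
apply/seteqP; split=> [_ [x wx <-] i|x qx].
  rewrite tnth_mktuple addrK ler_norml.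
  by have := wx i; rewrite powR1.
exists [tuple tnth x i - tnth v i | i < d]; last first.
  by apply: eq_from_tnth => i; rewrite !tnth_mktuple subrK.
by move=> i; have := qx i; rewrite tnth_mktuple ler_norml powR1.
Qed.

Lemma unit_cube_num_points v (g : \bar R -> \bar R) :
  measurable_fun setT g -> (forall y, 0 <= g y)%E ->
  (\int[P]_w g (num_points X (unit_cube v) w) =
   \int[P]_w g (num_points X (window 1) w))%E.
Proof.
move=> mg g0; rewrite -(translate_window1 v) stationary_num_points//.
  exact: measurable_window.
by rewrite translate_window1; exact: measurable_unit_cube.
Qed.

Lemma unit_cube_intensity v mu : has_intensity P X mu ->
  intensity_measure P X (unit_cube v) = mu%:E.
Proof.
move=> <-; rewrite -(translate_window1 v) stationary_intensity//.
  exact: measurable_window.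
by rewrite translate_window1; exact: measurable_unit_cube.
Qed.

End stationarity.

(** * Third moment of the scores in a unit cube *)

Section unit_cube_moment.
Context {R : realType} {d : nat} {dM dO : measure_display}.
Context {M : measurableType dM} {Om : measurableType dO}.
Variable P : probability Om R.
Local Notation pt := (d.-tuple R).
Local Notation conf := (marked_config R d M).
Variables (X : @marked_point_process R d dM dO M Om) (palm : R.-pker pt ~> conf).
Variable (xi : pt * M -> conf -> set pt -> R).
Variables (mu p1 p2 : R).
Hypothesis statX : stationary P X.
Hypothesis muX : has_intensity P X mu.
Hypothesis palmX : is_palm P X palm.
Hypothesis xiS : is_score xi.
Hypotheses (p11 : 1 <= p1) (p21 : 1 <= p2) (p123 : 3 <= p1 * p2 / (p1 + p2 - 1)).
Hypothesis moment1 : has_point_moment P X p1.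
Hypothesis moment2 : has_score_moment xi palm p2.

Let mu0 : 0 <= mu.
Proof. by rewrite -lee_fin -muX; apply: integral_ge0 => w _; exact: counting_ge0. Qed.

Let p10 : p1 != 0. Proof. by rewrite gt_eqF//; move: p11; lra. Qed.
Let p20 : p2 != 0. Proof. by rewrite gt_eqF//; move: p21; lra. Qed.

Lemma point_moment_finite :
  (\int[P]_w (num_points X (window 1) w `^ p1) < +oo)%E.
Proof.
have := poweR_Lnorm P (num_points X (window 1)) p10.
rewrite (eq_integral (fun w => num_points X (window 1) w `^ p1)%E); last first.
  by move=> w _; rewrite gee0_abs//; exact: counting_ge0.
by move=> <-; exact: poweR_lty.
Qed.

Lemma score_moment_finite : exists2 b : R, 0 <= b &
  forall lam x, 0 < lam -> window lam x ->
  (\int[palm x]_phi (`|score_at xi x phi (window lam)| `^ p2)%:E <= b%:E)%E.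
Proof.
pose S : \bar R := ereal_sup [set 'N[palm z.2]_(p2%:E)
                    [(fun phi => (score_at xi z.2 phi (window z.1))%:E)]
             | z in [set z : R * pt | (0 < z.1)%R /\ window z.1 z.2]]%E.
have Soo : (S < +oo)%E by exact: moment2.
(* The maximum with 0 excludes the value [-oo] of the supremum without exhibiting an index. *)
have [b bE] : exists b : R, (maxe S 0 `^ p2 = b%:E)%E.
  exists (fine (maxe S 0 `^ p2)%E); rewrite fineK// fin_num_poweR//.
  by rewrite ge0_fin_numE ?le_max ?lexx ?orbT// gt_max Soo ltry.
exists b; first by rewrite -lee_fin -bE poweR_ge0.
move=> lam x lam0 xlam; rewrite -bE.
have -> : (\int[palm x]_phi (`|score_at xi x phi (window lam)| `^ p2)%:E =
    'N[palm x]_(p2%:E) [(fun phi => (score_at xi x phi (window lam))%:E)] `^ p2)%E.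
  by rewrite poweR_Lnorm//; apply: eq_integral => phi _; rewrite abse_EFin poweR_EFin.
apply: gt0_ler_poweR.
- by move: p21; lra.
- by rewrite in_itv/= leey Lnorm_ge0.
- by rewrite in_itv/= leey le_max lexx orbT.
- by rewrite le_max; apply/orP; left; apply: ereal_sup_ubound; exists (lam, x).
Qed.

(** The cube is cut by the window because the score moment is controlled only there. Absolute values
    make overlapping covers harmless. *)
Definition cube_score_sum (lam : R) (v : pt) (w : Om) : R :=
  \sum_(x \in points (ground (X w)) `&` (unit_cube v `&` window lam))
    `|score_at xi x (X w) (window lam)|.

Let cube_finite lam v w :
  finite_set (points (ground (X w)) `&` (unit_cube v `&` window lam)).
Proof.
by apply: finite_ground; apply: bounded_regionS (bounded_window lam); exact: subIsetr.
Qed.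

Lemma measurable_cube_score_sum lam v : measurable_fun setT (cube_score_sum lam v).
Proof.
have mB : measurable (unit_cube v `&` window lam : set pt).
  by apply: measurableI; [exact: measurable_unit_cube|exact: measurable_window].
have bB : bounded_region (unit_cube v `&` window lam : set pt).
  by apply: bounded_regionS (bounded_window lam); exact: subIsetr.
apply: (@measurable_ground_sum _ _ _ _ _ _ X _
  (fun z : pt * conf => `|score_at xi z.1 z.2 (window lam)|) mB bB).
by apply: measurableT_comp => //; exact: measurable_score_at.
Qed.

Lemma cube_score_sum_ge0 lam v w : 0 <= cube_score_sum lam v w.
Proof. exact: fsumr_ge0. Qed.

(** With n points, [sum_expr3_le] leaves terms n^2 y^3, each at most n^(p1-1) + y^p2. Summing the
    first part over the n points gives n^p1. *)
Let cube_cube_le lam v w :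
  ((cube_score_sum lam v w ^+ 3)%:E <=
   3%:E * (num_points X (unit_cube v) w `^ p1 +
    (\sum_(x \in points (ground (X w)) `&` (unit_cube v `&` window lam))
       `|score_at xi x (X w) (window lam)| `^ p2)%:E))%E.
Proof.
set B := unit_cube v `&` window lam; pose a (x : pt) := `|score_at xi x (X w) (window lam)|.
have fB := cube_finite lam v w.
rewrite /cube_score_sum !fsbig_finite//= -/B.
pose s : seq pt := fset_set (points (ground (X w)) `&` B).
rewrite -/s; pose n : R := (size s)%:R.
apply: (@le_trans _ _ (3 * (n `^ p1 + \sum_(x <- s) a x `^ p2))%:E).
  rewrite lee_fin; apply: le_trans (sum_expr3_le _ _) _; first by move=> x; exact: normr_ge0.
  rewrite -/n -mulrA ler_wpM2l// mulr_sumr.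
  have [s0|s0] := posnP (size s).
    by rewrite (size0nil s0) !big_nil addr0 powR_ge0.
  have n1 : 1 <= n by rewrite ler1n.
  apply: (@le_trans _ _ (\sum_(x <- s) (n `^ (p1 - 1) + a x `^ p2))).
    by apply: ler_sum => x _; exact: sqr_mul_cube_le.
  rewrite big_split/= lerD2r big_const_seq count_predT iter_addr_0 -mulr_natl -/n.
  by rewrite mulr_powRB1//; move: p11 n1; lra.
rewrite EFinM; apply: lee_wpmul2l; first by rewrite lee_fin.
rewrite EFinD leeD2r//.
have nE : n%:E = counting (points (ground (X w)) `&` B) :> \bar R.
  by rewrite counting_finite.
rewrite -poweR_EFin nE; apply: gt0_ler_poweR.
- by move: p11; lra.
- by rewrite in_itv/= leey counting_ge0.
- by rewrite in_itv/= leey counting_ge0.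
- rewrite /num_points.
  have fQ : finite_set (points (ground (X w)) `&` unit_cube v).
    by apply: finite_ground; rewrite unit_cube_closed_box; exact: bounded_closed_box.
  rewrite !counting_finite// lee_fin ler_nat; apply: fsubset_leq_card.
  by rewrite -fset_set_sub//; apply: setIS; exact: subIsetl.
Qed.

(** By stationarity the count in the cube is distributed as that in [window 1], and Campbell's
    formula bounds the mean of the score part by [b * mu]; neither bound involves [lam] or [v]. The
    summand 1 makes the constant positive. *)
Lemma cube_third_moment : exists2 C : R, 0 < C &
  forall lam v, 0 < lam -> (\int[P]_w (cube_score_sum lam v w ^+ 3)%:E <= C%:E)%E.
Proof.
have [b b0 bP] := score_moment_finite.
pose b1 : R := fine (\int[P]_w (num_points X (window 1) w `^ p1))%E.
have b1E : b1%:E = (\int[P]_w (num_points X (window 1) w `^ p1))%E.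
  rewrite fineK// ge0_fin_numE ?point_moment_finite//.
  by apply: integral_ge0 => w _; exact: poweR_ge0.
have b10 : 0 <= b1 by rewrite -lee_fin b1E; apply: integral_ge0 => w _; exact: poweR_ge0.
exists (3 * (b1 + b * mu) + 1); first by rewrite ltr_wpDl// mulr_ge0// addr_ge0// mulr_ge0.
move=> lam v lam0.
set B := unit_cube v `&` window lam.
have mQ := measurable_unit_cube v.
have mB : measurable B by apply: measurableI => //; exact: measurable_window.
have bB : bounded_region B.
  by apply: bounded_regionS (bounded_window lam); exact: subIsetr.
pose f (z : pt * conf) : R := `|score_at xi z.1 z.2 (window lam)| `^ p2.
have mf : measurable_fun setT f.
  have -> : f = ((@powR R) ^~ p2) \o
    (fun z : pt * conf => `|score_at xi z.1 z.2 (window lam)|) by [].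
  apply: measurableT_comp; first exact: measurable_powR.
  by apply: measurableT_comp => //; exact: measurable_score_at.
have f0 z : 0 <= f z by exact: powR_ge0.
have IQ := unit_cube_intensity statX v muX.
have IBQ : (intensity_measure P X B <= intensity_measure P X (unit_cube v))%E.
  by apply: le_measure; rewrite ?inE//; exact: subIsetl.
have IB : (intensity_measure P X B < +oo)%E by rewrite (le_lt_trans IBQ)// IQ ltry.
have mN : measurable_fun setT (fun w => num_points X (unit_cube v) w `^ p1)%E.
  apply: (@measurableT_comp _ _ _ _ _ _ (poweR ^~ p1)); first exact: measurable_poweR.
  exact: measurable_num_points.
have mS : measurable_fun setT
    (fun w => \sum_(x \in points (ground (X w)) `&` B) f (x, X w : conf)).
  exact: measurable_ground_sum.
apply: (@le_trans _ _ (\int[P]_w (3%:E * (num_points X (unit_cube v) w `^ p1 +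
    (\sum_(x \in points (ground (X w)) `&` B) f (x, X w : conf))%:E)))%E).
  apply: ge0_le_integral => //.
  - by move=> w _; rewrite lee_fin exprn_ge0// cube_score_sum_ge0.
  - by apply/measurable_EFinP/measurable_funX; exact: measurable_cube_score_sum.
  - apply: emeasurable_funM => //; apply: emeasurable_funD => //.
    exact/measurable_EFinP.
have S0 w : (0 <= (\sum_(x \in points (ground (X w)) `&` B) f (x, X w : conf))%:E)%E.
  by rewrite lee_fin fsumr_ge0.
have mSE : measurable_fun setT
    (fun w => (\sum_(x \in points (ground (X w)) `&` B) f (x, X w : conf))%:E).
  exact/measurable_EFinP.
have N0 w : (0 <= num_points X (unit_cube v) w `^ p1)%E by exact: poweR_ge0.
rewrite ge0_integralZl//; last 2 first.
- exact: emeasurable_funD.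
- by move=> w _; exact: adde_ge0.
rewrite ge0_integralD//.
rewrite (unit_cube_num_points statX v (g := fun y => (y `^ p1)%E))//; last 2 first.
  - exact: measurable_poweR.
  - by move=> y; exact: poweR_ge0.
rewrite -b1E (campbell palmX)//.
have cB : (\int[intensity_measure P X]_x
    ((\1_B x)%:E * \int[palm x]_phi (f (x, phi))%:E) <= (b * mu)%:E)%E.
  apply: (@le_trans _ _ (\int[intensity_measure P X]_x (b%:E * (\1_B x)%:E))%E).
    apply: ge0_le_integral => //.
    - by move=> x _; rewrite mule_ge0// ?lee_fin// integral_ge0// => phi _; rewrite lee_fin.
    - apply: emeasurable_funM; first exact/measurable_EFinP/measurable_indic.
      apply: (measurable_fun_integral_finite_kernel (EFin \o f) palm).
        by move=> z; rewrite lee_fin.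
      exact/measurable_EFinP.
    - apply: emeasurable_funM => //; exact/measurable_EFinP/measurable_indic.
    - move=> x _; rewrite indicE; case: (boolP (x \in B)) => [/set_mem[_ Wx]|_].
        by rewrite mul1e mule1; exact: bP.
      by rewrite mul0e mule0.
  rewrite ge0_integralZl//; last exact/measurable_EFinP/measurable_indic.
  rewrite integral_indic// setIT EFinM lee_wpmul2l ?lee_fin//.
  by rewrite (le_trans IBQ)// IQ.
apply: (@le_trans _ _ (3%:E * (b1%:E + (b * mu)%:E))%E).
  by apply: lee_wpmul2l; rewrite ?lee_fin// leeD2l.
by rewrite -EFinD -EFinM lee_fin lerDl.
Qed.

End unit_cube_moment.

(** * Third moments of score sums over boxes *)

Lemma fsum_setI (R : realType) (T : choiceType) (S A : set T) (g : T -> R) :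
  finite_set S ->
  \sum_(x \in S `&` A) g x = \sum_(x <- fset_set S) \1_A x * g x.
Proof.
move=> fS; rewrite fsbig_mkcondr fsbig_finite//=; apply: eq_bigr => x _.
by rewrite indicE; case: ifP => _; rewrite ?mul1r ?mul0r.
Qed.

Section cover.
Context {R : realType} {d : nat}.
Local Notation pt := (d.-tuple R).

Definition lattice_center (a : pt) (m : nat) (k : {ffun 'I_d -> 'I_m}) : pt :=
  [tuple tnth a i + (k i)%:R + 1 / 2 | i < d].

Lemma unit_cube_cover (a : pt) (m : nat) (x : pt) :
  (forall i, tnth a i <= tnth x i < tnth a i + m%:R) ->
  exists k, unit_cube (lattice_center a (m := m) k) x.
Proof.
move=> ax.
have lt i : (Num.truncn (tnth x i - tnth a i) < m)%N.
  have /andP[ai xi] := ax i.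
  rewrite -(ltr_nat R); apply: (@le_lt_trans _ _ (tnth x i - tnth a i)); last by lra.
  by rewrite truncn_le subr_ge0.
exists [ffun i => Ordinal (lt i)] => i.
rewrite tnth_mktuple ffunE/=.
have /andP[ai xi] := ax i.
have x0 : 0 <= tnth x i - tnth a i by lra.
have := truncn_itv x0.
move: (Num.truncn _) => n /andP[nx]; rewrite -natr1 => xn.
by rewrite ler_norml; apply/andP; split; lra.
Qed.

End cover.

Section score_sum_moments.
Context {R : realType} {d : nat} {dM dO : measure_display}.
Context {M : measurableType dM} {Om : measurableType dO}.
Variable P : probability Om R.
Local Notation pt := (d.-tuple R).
Local Notation conf := (marked_config R d M).
Local Notation Ex f := (Rintegral P setT f).
Variables (X : @marked_point_process R d dM dO M Om) (palm : R.-pker pt ~> conf).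
Variable (xi : pt * M -> conf -> set pt -> R).
Hypothesis xiS : is_score xi.

(** All sums are written over one list, the points in the window, so that only indicators remain to
    be compared. Adjacent unit cubes share faces, hence an inequality between absolute values. *)
Lemma score_sum_cover_le (lam : R) (A : set pt) (a : pt) (m : nat) w :
  A `<=` window lam ->
  (forall x, A x -> forall i, tnth a i <= tnth x i < tnth a i + m%:R) ->
  `|score_sum X xi lam A w| <=
  \sum_(k : {ffun 'I_d -> 'I_m}) cube_score_sum X xi lam (lattice_center a k) w.
Proof.
move=> AW Aa; set G := points (ground (X w)) `&` window lam.
have fG : finite_set G by apply: finite_ground; exact: bounded_window.
have -> : score_sum X xi lam A w =
    \sum_(x <- fset_set G) \1_A x * score_at xi x (X w) (window lam).
  rewrite -fsum_setI// /score_sum; congr (\sum_(x \in _) _).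
  apply/seteqP; split=> x [].
    by move=> Gx Ax; split=> //; split=> //; exact: AW.
  by move=> [Gx _] Ax; split.
have cE k : cube_score_sum X xi lam (lattice_center a k) w =
    \sum_(x <- fset_set G) \1_(unit_cube (lattice_center a (m := m) k)) x *
      `|score_at xi x (X w) (window lam)|.
  rewrite -fsum_setI// /cube_score_sum; congr (\sum_(x \in _) _).
  by rewrite /G -setIA; congr (_ `&` _); rewrite setIC.
under [leRHS]eq_bigr do rewrite cE.
rewrite exchange_big/=; apply: le_trans (ler_norm_sum _ _ _) _.
apply: ler_sum => x _; rewrite normrM -mulr_suml ler_wpM2r//.
rewrite indicE; case: (boolP (x \in A)) => [/set_mem/Aa/unit_cube_cover[k Qx]|_].
  rewrite normr1 (bigD1 k)//= indicE mem_set// lerDl; apply: sumr_ge0 => j _.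
  by rewrite indicE.
by rewrite normr0; apply: sumr_ge0 => j _; rewrite indicE.
Qed.

Variable C : R.
Hypothesis C0 : 0 < C.
Hypothesis cubeC : forall lam v, 0 < lam ->
  (\int[P]_w (cube_score_sum X xi lam v w ^+ 3)%:E <= C%:E)%E.

Let cube_ge0 lam v w : 0 <= cube_score_sum X xi lam v w.
Proof. exact: cube_score_sum_ge0. Qed.

Let cubeL3 lam v : 0 < lam ->
  L3 P (cube_score_sum X xi lam v) /\
  Ex (fun w => cube_score_sum X xi lam v w ^+ 3) <= C.
Proof.
move=> lam0.
have mc := measurable_cube_score_sum X xiS lam v.
have CE := cubeC v lam0.
split; first split=> //.
  apply/integrableP; split.
    by apply/measurable_EFinP; apply: measurable_funX; exact: measurableT_comp.
  apply: (@le_lt_trans _ _ C%:E); last exact: ltry.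
  apply: le_trans CE; rewrite le_eqVlt; apply/orP; left; apply/eqP.
  apply: eq_integral => w _.
  by rewrite abse_EFin ger0_norm ?exprn_ge0// ger0_norm.
rewrite -lee_fin /Rintegral fineK//.
rewrite ge0_fin_numE; first by rewrite (le_lt_trans CE)// ltry.
by apply: integral_ge0 => w _; rewrite lee_fin exprn_ge0.
Qed.

(** The cubed sum over n unit cubes has mean at most [3 * C * n ^+ 3]. Since [kappa >= 1],
    [3 * C <= kappa ^+ 3], and no cube root has to be taken. *)
Let kappa : R := 3 * C + 1.

Lemma score_sum_L3 (lam : R) (A : set pt) (a : pt) (m : nat) : 0 < lam ->
  measurable A -> A `<=` window lam ->
  (forall x, A x -> forall i, tnth a i <= tnth x i < tnth a i + m%:R) ->
  L3 P (score_sum X xi lam A) /\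
  Ex (fun w => `|score_sum X xi lam A w| ^+ 3) <= (kappa * m%:R ^+ d) ^+ 3.
Proof.
move=> lam0 mA AW Aa.
have bA : bounded_region A by apply: bounded_regionS AW _; exact: bounded_window.
have mS : measurable_fun setT (score_sum X xi lam A) by exact: measurable_score_sum.
pose Q (k : {ffun 'I_d -> 'I_m}) := cube_score_sum X xi lam (lattice_center a k).
have Q3 k : L3 P (Q k) by case: (cubeL3 (lattice_center a k) lam0).
have QC k : Ex (fun w => Q k w ^+ 3) <= C by case: (cubeL3 (lattice_center a k) lam0).
have iQ k : P.-integrable setT (EFin \o (fun w => Q k w ^+ 3)).
  have [_] := Q3 k; apply: eq_integrabler => w.
  by rewrite ger0_norm// /Q.
have sumQ3 : L3 P (fun w => \sum_k Q k w) by exact: L3_sum.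
have leQ w := score_sum_cover_le w AW Aa.
have S3 : L3 P (score_sum X xi lam A).
  apply: (L3_le mS sumQ3 (L3_cst P 0)) => w.
  by rewrite normr0 addr0 (le_trans (leQ w))// ler_norm.
split=> //.
pose n : R := #|{ffun 'I_d -> 'I_m}|%:R.
have nE : n = m%:R ^+ d by rewrite /n card_ffun !card_ord natrX.
apply: (@le_trans _ _ (Ex (fun w => 3 * n ^+ 2 * \sum_k Q k w ^+ 3))).
  apply: le_Rintegral => //.
  - by case: S3.
  - by apply: integrable_mulrl; exact: integrable_sumr.
  move=> w _; apply: (@le_trans _ _ ((\sum_k Q k w) ^+ 3)).
    rewrite lerXn2r ?nnegrE//.
    by apply: sumr_ge0 => k _; exact: cube_ge0.
  apply: le_trans (sum_expr3_le _ _) _; first by move=> k; exact: cube_ge0.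
  rewrite (_ : size (index_enum _) = #|{ffun 'I_d -> 'I_m}|)//.
  by rewrite -sum1_size -sum1_card; exact: eq_bigl.
rewrite RintegralZl//; last exact: integrable_sumr.
rewrite Rintegral_sumr//.
apply: (@le_trans _ _ (3 * n ^+ 2 * (n * C))).
  rewrite ler_wpM2l ?mulr_ge0 ?sqr_ge0//.
  by rewrite /n mulr_natl -sumr_const; apply: ler_sum => k _; exact: QC.
rewrite -nE exprMn.
have n0 : 0 <= n by exact: ler0n.
have -> : 3 * n ^+ 2 * (n * C) = 3 * C * n ^+ 3 by ring.
rewrite ler_wpM2r ?exprn_ge0// /kappa.
have k1 : 1 <= 3 * C + 1 by move: C0; lra.
apply: (@le_trans _ _ (3 * C + 1)); first by rewrite lerDl.
by rewrite -[leLHS]expr1 ler_weXn2l.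
Qed.

(** With [t = kappa * m%:R ^+ d], the mean is at most [3 * t], and
    [(a + b) ^+ 3 <= 4 * (a ^+ 3 + b ^+ 3)] gives the factor 4 (1 + 27) = 112, which is below 125,
    the cube of 5. *)
Lemma centered_score_sum_L3 (lam : R) (A : set pt) (a : pt) (m : nat) : 0 < lam ->
  (0 < m)%N -> measurable A -> A `<=` window lam ->
  (forall x, A x -> forall i, tnth a i <= tnth x i < tnth a i + m%:R) ->
  [/\ L3 P (centered_score_sum P X xi lam A),
      Ex (centered_score_sum P X xi lam A) = 0 &
      Ex (fun w => `|centered_score_sum P X xi lam A w| ^+ 3) <=
        (5 * kappa * m%:R ^+ d) ^+ 3].
Proof.
move=> lam0 m0 mA AW Aa.
have [S3 SE] := score_sum_L3 lam0 mA AW Aa.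
set H := score_sum X xi lam A in S3 SE *.
have EH : fine 'E_P[H]%E = Ex H by rewrite unlock.
have kap : 0 < kappa by rewrite /kappa; move: C0; lra.
set t := kappa * m%:R ^+ d in SE *.
have t0 : 0 < t by rewrite mulr_gt0// exprn_gt0// ltr0n.
have cE w : centered_score_sum P X xi lam A w = H w - Ex H.
  by rewrite /centered_score_sum -/H EH.
have c3 : L3 P (centered_score_sum P X xi lam A).
  by apply: (@eq_L3 _ _ _ _ (fun w => H w - Ex H)) => //; exact/L3B/L3_cst.
split=> //.
  transitivity (Ex (fun w => H w - Ex H)).
    by apply: eq_Rintegral => w _; exact: cE.
  rewrite RintegralB//; [|exact: L3_integrable|exact: integrable_cstr].
  by rewrite probability_Rintegral_cst subrr.
have EH3 : `|Ex H| <= 3 * t.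
  apply: le_trans (le_normr_Rintegral _ (L3_integrable S3)) _ => //.
  exact: Rintegral_mul1_le.
apply: (@le_trans _ _ (Ex (fun w => 4 * (`|H w| ^+ 3 + (3 * t) ^+ 3)))).
  apply: le_Rintegral => //.
  - by case: c3.
  - apply: integrable_mulrl; apply: integrable_addr; last exact: integrable_cstr.
    by case: S3.
  move=> w _; rewrite cE.
  have t30 : 0 <= 3 * t by rewrite mulr_ge0// ltW.
  have le1 : `|H w - Ex H| <= `|H w| + 3 * t.
    by apply: le_trans (ler_normB _ _) _; rewrite lerD2l.
  apply: (@le_trans _ _ ((`|H w| + 3 * t) ^+ 3)).
    by rewrite lerXn2r ?nnegrE// addr_ge0.
  move: (`|H w|) (3 * t) (normr_ge0 (H w)) t30 => x y x0 y0.
  have : 0 <= (x + y) * (x - y) ^+ 2 by rewrite mulr_ge0 ?sqr_ge0 ?addr_ge0.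
  by lra.
rewrite RintegralZl//; last first.
  by apply: integrable_addr; [case: S3|exact: integrable_cstr].
rewrite RintegralD//; [|by case: S3|exact: integrable_cstr].
rewrite probability_Rintegral_cst.
have -> : (5 * kappa * m%:R ^+ d) ^+ 3 = 125 * t ^+ 3 by rewrite /t; ring.
have : 0 <= t ^+ 3 by rewrite exprn_ge0// ltW.
by move: SE; lra.
Qed.

End score_sum_moments.

(** * Absence of points on faces *)

Section null_faces.
Context {R : realType} {d : nat} {dM dO : measure_display}.
Context {M : measurableType dM} {Om : measurableType dO}.
Variable P : probability Om R.
Local Notation pt := (d.-tuple R).
Variables (X : @marked_point_process R d dM dO M Om) (mu : R).
Hypothesis statX : stationary P X.
Hypothesis muX : has_intensity P X mu.
Local Notation I := (intensity_measure P X).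

Let lattice_sum_lt (a : pt) (m : nat) :
  (\sum_(k : {ffun 'I_d -> 'I_m}) I (unit_cube (lattice_center a k)) < +oo)%E.
Proof.
rewrite (eq_bigr (fun=> mu%:E)); last first.
  by move=> k _; exact: unit_cube_intensity.
by rewrite sumEFin ltry.
Qed.

(** Finitely many unit cubes, each of intensity [mu], cover the box. *)
Lemma bounded_intensity (a b : pt) : (I (closed_box a b) < +oo)%E.
Proof.
pose m := (Num.truncn (\sum_(i < d) `|tnth b i - tnth a i|)).+1.
apply: le_lt_trans (lattice_sum_lt a m).
have mQ k : measurable (unit_cube (lattice_center a k) : set pt).
  exact: measurable_unit_cube.
apply: (@le_trans _ _ (I (\big[setU/set0]_(k : {ffun 'I_d -> 'I_m})
    unit_cube (lattice_center a k)))); last first.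
  elim: (index_enum _) => [|k s IH]; first by rewrite !big_nil measure0.
  rewrite !big_cons; apply: le_trans (measureU2 _ _ _) _ => //.
    exact: bigsetU_measurable.
  exact: leeD2l.
apply: le_measure; rewrite ?inE.
- exact: measurable_closed_box.
- exact: bigsetU_measurable.
move=> x abx.
have [k Qx] : exists k, unit_cube (lattice_center a (m := m) k) x.
  apply: unit_cube_cover => i; have /andP[ax xb] := abx i.
  rewrite ax/= -ltrBlDl; apply: le_lt_trans (truncnS_gt _).
  rewrite (bigD1 i)//= (le_trans (_ : _ <= `|tnth b i - tnth a i|))//.
    by apply: (le_trans _ (ler_norm _)); lra.
  by rewrite lerDl sumr_ge0.
by rewrite -bigcup_seq; exists k => //=; rewrite mem_index_enum.
Qed.

Lemma translate_closed_box (v a b : pt) :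
  translate v @` closed_box a b = closed_box (translate v a) (translate v b).
Proof.
apply/seteqP; split=> [_ [x abx <-] i|x abx].
  by have := abx i; rewrite !tnth_mktuple !lerD2r.
exists [tuple tnth x i - tnth v i | i < d]; last first.
  by apply: eq_from_tnth => i; rewrite !tnth_mktuple subrK.
by move=> i; have := abx i; rewrite !tnth_mktuple lerBrDr lerBlDr.
Qed.

(* The translates of a face along its normal are disjoint, have the same
   intensity and stay in a box of finite intensity. *)
Lemma intensity_face (a b : pt) i : tnth a i = tnth b i -> I (closed_box a b) = 0%E.
Proof.
move=> abi.
pose v (j : nat) : pt := [tuple if k == i then j.+1%:R^-1 else 0 : R | k < d].
pose F j : set pt := closed_box (translate (v j) a) (translate (v j) b).
have mF j : measurable (F j) by exact: measurable_closed_box.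
have IF j : I (F j) = I (closed_box a b).
  rewrite /F -translate_closed_box stationary_intensity//; first exact: measurable_closed_box.
  by rewrite translate_closed_box; exact: measurable_closed_box.
have tF : trivIset setT F.
  apply/trivIsetP => j k _ _ jk; rewrite -subset0 => x [Fj Fk].
  have := Fj i; have := Fk i; rewrite !tnth_mktuple eqxx abi => /andP[k1 k2] /andP[j1 j2].
  have : (j.+1%:R : R)^-1 = k.+1%:R^-1.
    by apply/(addrI (tnth b i))/eqP; rewrite eq_le (le_trans j1 k2) (le_trans k1 j2).
  by move/invr_inj/eqP; rewrite eqr_nat eqSS (negbTE jk).
pose b' : pt := [tuple tnth b k + 1 | k < d].
have FB j : F j `<=` closed_box a b'.
  move=> x Fx k; have := Fx k; rewrite !tnth_mktuple => /andP[x1 x2].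
  have [e0 e1] : 0 <= (if k == i then j.+1%:R^-1 else 0 : R) /\
                 (if k == i then j.+1%:R^-1 else 0 : R) <= 1.
    case: ifP => _; last by split.
    by split; [rewrite invr_ge0|rewrite invf_le1// ler1n].
  by apply/andP; split; lra.
have Ioo := bounded_intensity a b'.
have UF : (I (\bigcup_j F j) <= I (closed_box a b'))%E.
  apply: le_measure; rewrite ?inE.
  - exact: bigcup_measurable.
  - exact: measurable_closed_box.
  by move=> x [j _]; exact: FB.
have I0 : (0 <= I (closed_box a b))%E by exact: measure_ge0.
have Iab : I (closed_box a b) \is a fin_num.
  by rewrite (ge0_fin_numE I0); exact: bounded_intensity.
have nle (n : nat) : (n%:R * fine (I (closed_box a b)) <= fine (I (closed_box a b'))).
  rewrite -lee_fin fineK; last first.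
    by rewrite (ge0_fin_numE (measure_ge0 _ _)); exact: Ioo.
  apply: le_trans UF; rewrite measure_bigcup//=.
  rewrite (eq_eseriesr (g := fun=> I (closed_box a b))); last by move=> j _; exact: IF.
  apply: le_trans (nneseries_lim_ge n _); last by [].
  rewrite (eq_bigr (fun=> (fine (I (closed_box a b)))%:E)); last by move=> j _; rewrite fineK.
  rewrite sumEFin (eq_bigl xpredT) ?sumr_const_nat ?subn0 ?mulr_natl// => j.
  by rewrite in_setT.
apply/eqP; rewrite -[X in X == _]fineK// eqe; apply/eqP.
apply/eqP; rewrite eq_le fine_ge0// andbT leNgt; apply/negP => c0.
have := nle (Num.truncn (fine (I (closed_box a b')) / fine (I (closed_box a b)))).+1.
by rewrite leNgt -ltr_pdivrMr// truncnS_gt.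
Qed.

Lemma num_points_face (a b : pt) i : tnth a i = tnth b i ->
  {ae P, forall w, points (ground (X w)) `&` closed_box a b = set0}.
Proof.
move=> abi.
have I0 := intensity_face abi.
have mN := measurable_num_points X (measurable_closed_box a b).
have : ae_eq P setT (num_points X (closed_box a b)) (cst 0%E).
  apply/(ae_eq_integral_abs P measurableT mN).
  rewrite -[RHS]I0 /intensity_measure; apply: eq_integral => w _.
  by rewrite gee0_abs//; exact: counting_ge0.
apply: filterS => w /= /(_ Logic.I) cw.
have fS : finite_set (points (ground (X w)) `&` closed_box a b).
  by apply: finite_ground; exact: bounded_closed_box.
apply/seteqP; split=> // x Sx.
move: cw; rewrite /num_points counting_finite// => -[] /eqP.
rewrite pnatr_eq0 cardfs_eq0 => /eqP f0.
by have : x \in fset_set (points (ground (X w)) `&` closed_box a b);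
  [rewrite in_fset_set// inE|rewrite f0 inE].
Qed.

End null_faces.

(** * Distances and the grid of cubes *)

Section distances.
Context {R : realType} {d : nat}.
Local Notation pt := (d.-tuple R).
Implicit Types (A B : set pt) (x y : pt).

Lemma edist_ge0 x y : 0 <= edist x y. Proof. exact: sqrtr_ge0. Qed.

Lemma diam_ge0 A : 0 <= diam A.
Proof.
rewrite /diam; set S := [set _ | _ in _ & _ in _].
have [[[r Sr] [M SM]]|nS] := pselect (has_sup S); last by rewrite sup_out.
apply: (@le_trans _ _ r); first by case: Sr => x Ax [y Ay <-]; exact: edist_ge0.
by apply: ub_le_sup => //; exists M.
Qed.

Lemma diam_le A D : 0 <= D -> (forall x y, A x -> A y -> edist x y <= D) ->
  diam A <= D.
Proof.
move=> D0 AD; rewrite /diam; set S := [set _ | _ in _ & _ in _].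
have [->|/set0P S0] := eqVneq S set0; first by rewrite sup0.
by apply: ge_sup => // _ [x Ax [y Ay <-]]; exact: AD.
Qed.

Lemma set_dist_ge A B D : A !=set0 -> B !=set0 ->
  (forall x y, A x -> B y -> D <= edist x y) -> D <= set_dist A B.
Proof.
move=> [x Ax] [y By] AD; apply: lb_le_inf.
  by exists (edist x y), x => //; exists y.
by move=> _ [x' Ax' [y' By' <-]]; exact: AD.
Qed.

End distances.

Section grid.
Context {R : realType} {d : nat}.
Local Notation pt := (d.-tuple R).
Variables (lam : R) (n : nat).
Hypotheses (lam0 : 0 < lam) (n0 : (0 < n)%N).
Local Notation L := (lam `^ d%:R^-1).
Local Notation idx := {ffun 'I_d -> 'I_n}.

Definition mesh : R := L / n%:R.
Local Notation s := mesh.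

Definition grid_level (j : nat) : R := - (L / 2) + s * j%:R.

Definition grid_lo (k : idx) : pt := [tuple grid_level (k i) | i < d].
Definition grid_hi (k : idx) : pt := [tuple grid_level (k i).+1 | i < d].
Definition grid_cube (k : idx) : set pt := open_box (grid_lo k) (grid_hi k).

Lemma mesh_gt0 : 0 < s.
Proof. by rewrite divr_gt0 ?powR_gt0// ltr0n. Qed.

Let mesh_n : s * n%:R = L. Proof. by rewrite divfK// pnatr_eq0 -lt0n. Qed.

Let levelS j : grid_level j.+1 = grid_level j + s.
Proof. by rewrite /grid_level -natr1; ring. Qed.

Let level_le j k : (j <= k)%N -> grid_level j <= grid_level k.
Proof. by move=> jk; rewrite lerD2l ler_wpM2l ?ler_nat// ltW// mesh_gt0. Qed.

Let level0 : grid_level 0 = - (L / 2).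
Proof. by rewrite /grid_level mulr0 addr0. Qed.

Let leveln : grid_level n = L / 2.
Proof. by rewrite /grid_level mesh_n; field. Qed.

Lemma measurable_grid_cube k : measurable (grid_cube k).
Proof. exact: measurable_open_box. Qed.

Lemma grid_cube_window k : grid_cube k `<=` window lam.
Proof.
move=> x kx i; have := kx i; rewrite !tnth_mktuple => /andP[x1 x2].
have := level_le (leq0n (k i)); have := level_le (ltn_ord (k i)).
rewrite level0 leveln => h1 h2.
by apply/andP; split; lra.
Qed.

Lemma grid_cube_inj k j x : grid_cube k x -> grid_cube j x -> k = j.
Proof.
move=> kx jx; apply/ffunP => i; apply/val_inj => /=.
have := kx i; have := jx i; rewrite !tnth_mktuple => /andP[j1 j2] /andP[k1 k2].
apply/eqP; rewrite eqn_leq; apply/andP; split; rewrite leqNgt; apply/negP => lt.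
  by have := level_le lt; lra.
by have := level_le lt; lra.
Qed.

Lemma grid_cube_nonempty k : grid_cube k !=set0.
Proof.
exists [tuple grid_level (k i) + s / 2 | i < d] => i; rewrite !tnth_mktuple levelS.
by have := mesh_gt0 => s0; apply/andP; split; lra.
Qed.

Lemma grid_long_sides k : 1 <= s -> long_sides (grid_lo k) (grid_hi k).
Proof. by move=> s1 i; rewrite !tnth_mktuple levelS; lra. Qed.

Lemma grid_hyperrect1 k : 1 <= s -> hyperrect1 (grid_cube k).
Proof. by move=> s1; exists (grid_lo k), (grid_hi k); split=> //; exact: grid_long_sides. Qed.

(** Adjacency in the sup norm, phrased without truncated subtraction. It includes [k] itself and the
    cubes that touch cube [k] only in a corner. *)
Definition grid_nbhd (k : idx) : {set idx} :=
  [set j : idx | [forall i, (k i <= (j i).+1)%N && (j i <= (k i).+1)%N]].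

Lemma card_grid_nbhd k : (#|grid_nbhd k| <= 3 ^ d)%N.
Proof.
pose F i : pred 'I_n := fun j => (k i <= j.+1)%N && (j <= (k i).+1)%N.
have -> : #|grid_nbhd k| = #|(family F : simpl_pred idx)|.
  apply: eq_card => j; rewrite !inE; apply/forallP/familyP => h i; exact: (h i).
rewrite card_family -[in leqRHS](card_ord d).
have le3 i : (#|F i| <= 3)%N.
  (* Each coordinate of a neighbour lies among three consecutive integers from [(k i).-1] on; for
     [k i = 0] the truncated predecessor merely makes the list longer than necessary. *)
  rewrite cardE -(size_map val) -[in leqRHS](size_iota (k i).-1 3).
  apply: uniq_leq_size; first by rewrite map_inj_uniq ?enum_uniq//; exact: val_inj.
  move=> x /mapP[j]; rewrite mem_enum => Fj ->; rewrite mem_iota.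
  have /andP[j1 j2] : (k i <= j.+1)%N && (j <= (k i).+1)%N := Fj.
  case: (nat_of_ord (k i)) j1 j2 => [|p] /= j1 j2.
    by rewrite (leq_ltn_trans j2).
  by rewrite (j1 : (p <= j)%N) addn3; exact: j2.
rewrite foldrE big_map big_enum -prod_nat_const.
exact: leq_prod.
Qed.

Lemma grid_hyperrect2 k j : 1 <= s -> j \in grid_nbhd k ->
  hyperrect2 (grid_cube k `|` grid_cube j).
Proof.
move=> s1; rewrite inE => /forallP kj.
exists (grid_lo k), (grid_hi k), (grid_lo j), (grid_hi j).
split; [exact: grid_long_sides|exact: grid_long_sides| |by []].
(* The coordinatewise larger of the two lower corners lies in both closures, as the levels differ by
   at most one mesh. *)
exists [tuple Num.max (grid_level (k i)) (grid_level (j i)) | i < d].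
have s0 := mesh_gt0.
split=> i; rewrite !tnth_mktuple; have /andP[k1 k2] := kj i;
  have := level_le k1; have := level_le k2; rewrite !levelS => h1 h2;
  by rewrite le_max ge_max lexx ?orbT/=; apply/andP; split; lra.
Qed.

(** Non-neighbours differ by at least 2 in some coordinate, so the width of a whole cube separates
    them in that direction. *)
Lemma grid_dist k j x y : grid_cube k x -> grid_cube j y -> j \notin grid_nbhd k ->
  s <= edist x y.
Proof.
move=> kx jy; rewrite inE negb_forall => /existsP[i]; rewrite negb_and -!ltnNge => ij.
apply: le_trans (edist_ge x y i).
have := kx i; have := jy i; rewrite !tnth_mktuple => /andP[y1 y2] /andP[x1 x2].
case/orP: ij => ij; have := level_le ij; rewrite !levelS => lev.
  by apply: (le_trans _ (ler_norm _)); move: x1 y2; rewrite levelS; lra.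
rewrite distrC; apply: (le_trans _ (ler_norm _)).
by move: y1 x2; rewrite levelS; lra.
Qed.

Lemma grid_cube_diam k : diam (grid_cube k) <= d%:R * s.
Proof.
have s0 := mesh_gt0.
apply: diam_le => [|x y kx ky]; first by rewrite mulr_ge0 ?ler0n ?(ltW s0).
apply: edist_le => [|i]; first exact: ltW.
have := kx i; have := ky i; rewrite !tnth_mktuple levelS => /andP[y1 y2] /andP[x1 x2].
by rewrite ler_norml; apply/andP; split; lra.
Qed.

Lemma grid_pair_diam k j : j \in grid_nbhd k ->
  diam (grid_cube k `|` grid_cube j) <= d%:R * (2 * s).
Proof.
have s0 := mesh_gt0.
rewrite inE => /forallP kj.
apply: diam_le => [|x y xkj ykj]; first by do 2 (apply: mulr_ge0 => //); exact: ltW.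
apply: edist_le => [|i]; first by apply: mulr_ge0 => //; exact: ltW.
have /andP[k1 k2] := kj i.
have := level_le k1; have := level_le k2; rewrite !levelS => h1 h2.
have bnd z : (grid_cube k `|` grid_cube j) z ->
    Num.min (grid_level (k i)) (grid_level (j i)) <= tnth z i <=
    Num.max (grid_level (k i)) (grid_level (j i)) + s.
  move=> [] zi; have := zi i; rewrite !tnth_mktuple levelS => /andP[z1 z2];
    by rewrite ge_min -lerBlDr le_max; apply/andP; split; apply/orP;
    do ?[by left; lra|by right; lra].
have /andP[x1 x2] := bnd x xkj; have /andP[y1 y2] := bnd y ykj.
have : Num.max (grid_level (k i)) (grid_level (j i)) <=
       Num.min (grid_level (k i)) (grid_level (j i)) + s.
  by rewrite ge_max -!lerBlDr !le_min; apply/andP; split; apply/andP; split; lra.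
by move=> mm; rewrite ler_norml; apply/andP; split; lra.
Qed.

Lemma window_diam (B : set pt) : B `<=` window lam -> diam B <= d%:R * L.
Proof.
move=> BW; have L0 : 0 <= L by exact: powR_ge0.
apply: diam_le => [|x y Bx By]; first exact: mulr_ge0.
apply: edist_le => // i.
have /andP[x1 x2] := BW _ Bx i; have /andP[y1 y2] := BW _ By i.
by rewrite ler_norml; apply/andP; split; lra.
Qed.

(** A slice through the entire window, degenerate in direction [i]. The levels used are the [n.+1]
    values from 0 to [n], both window faces included. *)
Definition grid_face (i : 'I_d) (j : nat) : set pt :=
  closed_box [tuple if c == i then grid_level j else - (L / 2) | c < d]
             [tuple if c == i then grid_level j else L / 2 | c < d].

Lemma grid_cover x : window lam x -> (forall i (j : 'I_n.+1), ~ grid_face i j x) ->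
  exists k, grid_cube k x.
Proof.
move=> Wx nface.
have s0 := mesh_gt0.
have nlev i (j : nat) : (j <= n)%N -> tnth x i != grid_level j.
  move=> jn; apply/eqP => xij; apply: (nface i (Ordinal (jn : (j < n.+1)%N))) => c.
  rewrite !tnth_mktuple/=; case: eqP => [->|_]; first by rewrite xij lexx.
  exact: Wx.
have x0 i : 0 <= (tnth x i + L / 2) / s.
  by have /andP[x1 _] := Wx i; rewrite divr_ge0 ?(ltW s0)//; lra.
pose q i := Num.truncn ((tnth x i + L / 2) / s).
have qx i : grid_level (q i) <= tnth x i < grid_level (q i) + s.
  have /andP := truncn_itv (x0 i); rewrite -/(q i) ler_pdivlMr// ltr_pdivrMr//.
  move=> -[h1 h2]; move: h2; rewrite -(natr1 (q i)) => h2; rewrite /grid_level.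
  by apply/andP; split; lra.
(* Truncation could give [n] only on the upper window face, which is an excluded level. *)
have qn i : (q i < n)%N.
  rewrite ltnNge; apply/negP => nq.
  have /andP[q1 _] := qx i; have /andP[_ x2] := Wx i.
  have := level_le nq; rewrite leveln => h.
  have : tnth x i == grid_level n by rewrite eq_le leveln x2; lra.
  by rewrite (negbTE (nlev i n (leqnn n))).
exists [ffun i => Ordinal (qn i)] => i.
rewrite !tnth_mktuple ffunE/= levelS.
have /andP[q1 ->] := qx i; rewrite andbT lt_neqAle q1 andbT eq_sym.
by apply: nlev; exact: ltnW.
Qed.

Lemma grid_cube_lattice k (m : nat) : s <= m%:R ->
  forall x, grid_cube k x -> forall i,
  tnth (grid_lo k) i <= tnth x i < tnth (grid_lo k) i + m%:R.
Proof.
move=> sm x kx i; have := kx i; rewrite !tnth_mktuple levelS => /andP[x1 x2].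
by apply/andP; split; lra.
Qed.

Definition grid_union (S : {set idx}) : set pt := \bigcup_(k in [set k | k \in S]) grid_cube k.

Lemma grid_union_window S : grid_union S `<=` window lam.
Proof. by move=> x [k _]; exact: grid_cube_window. Qed.

Lemma grid_union_hyperrects S : 1 <= s -> disjoint_hyperrects (grid_union S).
Proof.
move=> s1; exists #|S|, (fun i => grid_cube (enum_val i)); split.
- by move=> i; exact: grid_hyperrect1.
- apply/trivIsetP => i j _ _ ij; rewrite -subset0 => x [xi xj].
  by move/eqP: ij; apply; apply/enum_val_inj/(grid_cube_inj xi xj).
- apply/seteqP; split=> x [k kS kx].
    by exists (enum_rank_in kS k) => //; rewrite enum_rankK_in.
  by exists (enum_val k) => //; exact: enum_valP.
Qed.

Lemma indic_grid_union S x : \1_(grid_union S) x = \sum_(k in S) \1_(grid_cube k) x :> R.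
Proof.
rewrite indicE; case: (boolP (x \in grid_union S)) => [/set_mem[k kS kx]|/negP nU].
  rewrite (bigD1 k)//= indicE mem_set// big1 ?addr0// => j /andP[_ jk].
  by rewrite indicE memNset// => jx; move/eqP: jk; apply; exact: (grid_cube_inj jx kx).
rewrite big1// => k kS; rewrite indicE memNset// => kx; apply: nU.
by rewrite inE; exists k.
Qed.

End grid.

(** * Score sums over the grid *)

Section window_score_sums.
Context {R : realType} {d : nat} {dM dO : measure_display}.
Context {M : measurableType dM} {Om : measurableType dO}.
Local Notation pt := (d.-tuple R).
Local Notation conf := (marked_config R d M).
Variables (X : @marked_point_process R d dM dO M Om).
Variable (xi : pt * M -> conf -> set pt -> R).
Variable lam : R.

Lemma score_sumE (A : set pt) w : A `<=` window lam ->
  score_sum X xi lam A w =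
  \sum_(x <- fset_set (points (ground (X w)) `&` window lam))
     \1_A x * score_at xi x (X w) (window lam).
Proof.
move=> AW; rewrite -fsum_setI; last by apply: finite_ground; exact: bounded_window.
by rewrite -setIA (setIidr AW).
Qed.

(** The identity between indicators is demanded only at points of the process, so a face without
    points can be ignored. *)
Lemma score_sum_partition (I : finType) (Q : pred I) (F : I -> set pt) (A : set pt) w :
  A `<=` window lam -> (forall i, F i `<=` window lam) ->
  (forall x, points (ground (X w)) x -> window lam x ->
     \1_A x = \sum_(i | Q i) \1_(F i) x :> R) ->
  score_sum X xi lam A w = \sum_(i | Q i) score_sum X xi lam (F i) w.
Proof.
move=> AW FW AF; rewrite score_sumE//.
under [RHS]eq_bigr do rewrite score_sumE//.
rewrite exchange_big/=; apply: eq_big_seq => x.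
rewrite in_fset_set; last by apply: finite_ground; exact: bounded_window.
by rewrite inE => -[gx Wx]; rewrite AF// mulr_suml.
Qed.

End window_score_sums.

Section grid_score_sums.
Context {R : realType} {d : nat} {dM dO : measure_display}.
Context {M : measurableType dM} {Om : measurableType dO}.
Variable P : probability Om R.
Local Notation pt := (d.-tuple R).
Local Notation conf := (marked_config R d M).
Local Notation Ex f := (Rintegral P setT f).
Variables (X : @marked_point_process R d dM dO M Om).
Variable (xi : pt * M -> conf -> set pt -> R).
Variables (lam : R) (n : nat).
Hypotheses (lam0 : 0 < lam) (n0 : (0 < n)%N).
Local Notation idx := {ffun 'I_d -> 'I_n}.
Local Notation cube := (@grid_cube R d lam n).
Local Notation Y := (fun k : idx => centered_score_sum P X xi lam (cube k)).

Lemma score_sum_grid_union (S : {set idx}) w :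
  score_sum X xi lam (grid_union lam S) w =
  \sum_(k in S) score_sum X xi lam (cube k) w.
Proof.
apply: score_sum_partition; first exact: grid_union_window.
  by move=> k; exact: grid_cube_window.
by move=> x _ _; exact: indic_grid_union.
Qed.

(** What the open cubes miss of the window lies on finitely many faces, each of which almost surely
    carries no point. *)
Lemma total_score_grid (mu : R) : stationary P X -> has_intensity P X mu ->
  {ae P, forall w, total_score X xi lam w = \sum_k score_sum X xi lam (cube k) w}.
Proof.
move=> statX muX.
have face (i : 'I_d) (j : 'I_n.+1) :
    {ae P, forall w, points (ground (X w)) `&` grid_face lam n i j = set0}.
  by apply: (num_points_face statX muX (i := i)); rewrite !tnth_mktuple eqxx.
have faces : {ae P, forall w, forall i (j : 'I_n.+1),
    points (ground (X w)) `&` grid_face lam n i j = set0}.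
  by apply: filter_forall => i; apply: filter_forall => j; exact: face.
apply: filterS faces => w wface.
rewrite /total_score.
apply: (@score_sum_partition _ _ _ _ _ _ X xi lam idx xpredT) => //.
  by move=> k; exact: grid_cube_window.
move=> x gx Wx; have [k kx] : exists k, cube k x.
  apply: grid_cover => // i j fx.
  by have : (points (ground (X w)) `&` grid_face lam n i j) x by []; rewrite wface.
rewrite (bigD1 k)//= !indicE !mem_set// big1 ?addr0// => j jk.
by rewrite indicE memNset// => jx; move/eqP: jk; apply; exact: (grid_cube_inj _ _ jx kx).
Qed.

Hypothesis xiS : is_score xi.
Variable C : R.
Hypothesis C0 : 0 < C.
Hypothesis cubeC : forall lam v, 0 < lam ->
  (\int[P]_w (cube_score_sum X xi lam v w ^+ 3)%:E <= C%:E)%E.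

Let m := (Num.truncn (mesh (d := d) lam n)).+1.

Let meshm : mesh (d := d) lam n <= m%:R.
Proof. exact/ltW/truncnS_gt. Qed.

Let score_sum_cube_L3 k : L3 P (score_sum X xi lam (cube k)).
Proof.
by have [] := score_sum_L3 xiS C0 cubeC lam0 (@measurable_grid_cube _ _ lam n k)
  (@grid_cube_window _ _ lam n lam0 n0 k) (@grid_cube_lattice _ _ lam n k m meshm).
Qed.

Lemma centered_score_sum_cube k :
  [/\ L3 P (Y k), Ex (Y k) = 0 &
      Ex (fun w => `|Y k w| ^+ 3) <= (5 * (3 * C + 1) * m%:R ^+ d) ^+ 3].
Proof.
exact: (centered_score_sum_L3 xiS C0 cubeC lam0 _ (@measurable_grid_cube _ _ lam n k)
  (@grid_cube_window _ _ lam n lam0 n0 k) (@grid_cube_lattice _ _ lam n k m meshm)).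
Qed.

Lemma centered_score_sum_grid_union (S : {set idx}) w :
  centered_score_sum P X xi lam (grid_union lam S) w = partial_sum Y S w.
Proof.
rewrite /centered_score_sum /partial_sum sumrB score_sum_grid_union; congr (_ - _).
rewrite unlock; transitivity (Ex (fun w => \sum_(k in S) score_sum X xi lam (cube k) w)).
  by apply: eq_Rintegral => w' _; exact: score_sum_grid_union.
by rewrite Rintegral_sumr// => k; exact: L3_integrable.
Qed.

Hypothesis statX : stationary P X.
Variable mu : R.
Hypothesis muX : has_intensity P X mu.

Lemma measurable_total_score : measurable_fun setT (total_score X xi lam).
Proof.
by apply: measurable_score_sum => //; [exact: measurable_window|exact: bounded_window].
Qed.

Lemma total_score_centered_grid :
  {ae P, forall w, total_score X xi lam w - fine 'E_P[total_score X xi lam]%E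
           = partial_sum Y [set: idx] w}.
Proof.
have mT := measurable_total_score.
have EE : fine 'E_P[total_score X xi lam]%E =
    \sum_k fine 'E_P[score_sum X xi lam (cube k)]%E.
  rewrite unlock.
  transitivity (Ex (fun w => \sum_k score_sum X xi lam (cube k) w)); last first.
    by rewrite Rintegral_sumr// => k; exact: L3_integrable.
  congr fine; apply: ae_eq_integral => //.
  - exact/measurable_EFinP.
  - by apply/measurable_EFinP; case: (L3_sum (index_enum _) xpredT score_sum_cube_L3).
  by apply: filterS (total_score_grid statX muX) => w wE _; rewrite wE.
apply: filterS (total_score_grid statX muX) => w ->.
rewrite EE -sumrB /partial_sum; apply: eq_bigl => k; by rewrite inE.
Qed.

Lemma variance_total_score_grid :
  'V_P[total_score X xi lam]%E = (Ex (fun w => partial_sum Y [set: idx] w ^+ 2))%:E.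
Proof.
have mT := measurable_total_score.
have W3 : L3 P (partial_sum Y [set: idx]).
  by apply: L3_sum => k; case: (centered_score_sum_cube k).
have iW : P.-integrable setT (EFin \o (fun w => partial_sum Y [set: idx] w ^+ 2)).
  by apply: eq_integrabler (integrable_mul2 W3 W3) => w.
rewrite /Rintegral fineK; last exact: integrable_fin_num.
rewrite /variance unlock unlock; apply: ae_eq_integral => //.
- apply/measurable_EFinP; apply: measurable_funM; exact: measurable_funB.
- by case/integrableP: iW.
apply: filterS total_score_centered_grid => w; rewrite unlock => wE _ /=.
by rewrite expr2 -wE.
Qed.

End grid_score_sums.

(** * Mixing on the grid *)

Lemma covariance_Rintegral (R : realType) (dO : measure_display)
    (Om : measurableType dO) (P : probability Om R) (f g : Om -> R) :
  P.-integrable setT (EFin \o f) -> P.-integrable setT (EFin \o g) ->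
  P.-integrable setT (EFin \o (fun w => f w * g w)) ->
  covariance P f g = (Rintegral P setT (fun w => f w * g w) -
                      Rintegral P setT f * Rintegral P setT g)%:E.
Proof.
move=> fi gi fgi; rewrite covarianceE; [|exact/Lfun1_integrable..].
rewrite unlock EFinB EFinM /Rintegral !fineK//; exact: integrable_fin_num.
Qed.

Lemma bounded_test_L3 (R : realType) (dO : measure_display)
    (Om : measurableType dO) (P : probability Om R) (f : Om -> R) (g : R -> R) :
  bounded_test g -> measurable_fun setT f -> L3 P (fun w => g (f w)).
Proof.
move=> gb mf; apply: (@L3_bounded _ _ _ _ _ 1) => [|w]; last by case: (gb (f w)).
apply: measurableT_comp => //; apply: continuous_measurable_fun => x.
by apply: differentiable_continuous; apply/derivable1_diffP; case: (gb x).
Qed.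

(** Here [A] and [B] are the means of the square of a sum with and without the test, and [c] is the
    mean of the test. Twice the cross term is the full error minus those of the two squares: three
    errors, then halved. *)
Lemma polarization_le (R : realFieldType) (A B a1 a2 a3 b1 b2 b3 c e : R) :
  A = a1 + 2 * a2 + a3 -> B = b1 + 2 * b2 + b3 ->
  `|a1 - b1 * c| <= e -> `|a3 - b3 * c| <= e -> `|A - B * c| <= e ->
  `|a2 - b2 * c| <= 3 / 2 * e.
Proof.
move=> -> -> h1 h3; have -> : a1 + 2 * a2 + a3 - (b1 + 2 * b2 + b3) * c =
  (a1 - b1 * c) + 2 * (a2 - b2 * c) + (a3 - b3 * c) by ring.
move: (a1 - b1 * c) (a2 - b2 * c) (a3 - b3 * c) h1 h3 => x y z hx hz h.
suff : 2 * `|y| <= 3 * e by lra.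
rewrite -[2]ger0_norm// -normrM.
have -> : 2 * y = (x + 2 * y + z) - x - z by ring.
apply: le_trans (ler_normB _ _) _; have := ler_normB (x + 2 * y + z) x.
by move: hx hz h; lra.
Qed.

Section local_mixing.
Context {R : realType} {d : nat} {dM dO dZ : measure_display}.
Context {M : measurableType dM} {Om : measurableType dO} {OmZ : measurableType dZ}.
Variables (P : probability Om R) (PZ : probability OmZ R) (Z : {RV PZ >-> R}).
Hypothesis ZN : distribution PZ Z = normal_prob 0 1.
Local Notation pt := (d.-tuple R).
Local Notation conf := (marked_config R d M).
Local Notation Ex f := (Rintegral P setT f).
Variables (X : @marked_point_process R d dM dO M Om).
Variable (xi : pt * M -> conf -> set pt -> R).
Variables (lam : R) (n : nat).
Hypotheses (d0 : (0 < d)%N) (lam0 : 0 < lam) (n0 : (0 < n)%N).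
Hypothesis xiS : is_score xi.
Variable C : R.
Hypothesis C0 : 0 < C.
Hypothesis cubeC : forall lam v, 0 < lam ->
  (\int[P]_w (cube_score_sum X xi lam v w ^+ 3)%:E <= C%:E)%E.
Local Notation idx := {ffun 'I_d -> 'I_n}.
Local Notation cube := (@grid_cube R d lam n).
Local Notation Y := (fun k : idx => centered_score_sum P X xi lam (cube k)).
Local Notation s := (mesh (d := d) lam n).
Local Notation L := (lam `^ d%:R^-1).
Local Notation N := (@grid_nbhd d n).

Variables (g0 g1 g3 : R) (rate : R -> R).
Hypotheses (g00 : 0 < g0) (g10 : 0 < g1) (g30 : 0 < g3).
Hypothesis mix : forall (j : nat) (g : R -> R) (A B : set pt), mixing_test j g A ->
  disjoint_hyperrects B -> B `<=` window lam ->
  g3 * Num.max (ln (Num.max (diam A) (diam B))) 1 <= set_dist A B ->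
  (`| covariance P (fun w => (centered_score_sum P X xi lam A w ^+ j)%R)
                   (fun w => g (centered_score_sum P X xi lam B w)) |
   <= (g1 * Num.max (diam A `^ g0) 1 * Num.max (diam B `^ g0) 1
          * rate (set_dist A B))%:E)%E.
Hypothesis s1 : 1 <= s.
Hypothesis rate_s : forall x, s <= x -> 0 <= rate x <= rate s.
Hypothesis log_s : g3 * Num.max (ln (2 * d%:R * L)) 1 <= s.

(** One or two neighbouring cubes have diameter at most [2 * d%:R * s]. The far set lies in the
    window, of diameter at most [d%:R * L]; the extra factor 2 lets [2 * d%:R * L] dominate both
    diameters, as the logarithmic condition demands. *)
Definition mixing_error : R :=
  g1 * (2 * d%:R * s) `^ g0 * (2 * d%:R * L) `^ g0 * rate s.

Let d1 : 1 <= d%:R :> R. Proof. by rewrite ler1n. Qed.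

Let sL : s <= L.
Proof.
rewrite /mesh ler_pdivrMr ?ltr0n// -[leLHS]mulr1; apply: ler_wpM2l.
  exact: powR_ge0.
by rewrite ler1n.
Qed.

Lemma mixing_error_ge0 : 0 <= mixing_error.
Proof.
have /andP[r0 _] := rate_s (lexx s).
by rewrite /mixing_error !mulr_ge0 ?powR_ge0// ltW.
Qed.

Let max_powR_le (x y : R) : 0 <= x <= y -> 1 <= y ->
  Num.max (x `^ g0) 1 <= y `^ g0.
Proof.
move=> /andP[x0 xy] y1; rewrite ge_max; apply/andP; split.
  by apply: ge0_ler_powR; rewrite ?nnegrE ?(ltW g00)//; lra.
have -> : 1 = 1 `^ g0 :> R by rewrite powR1.
by apply: ge0_ler_powR; rewrite ?nnegrE ?(ltW g00)//; lra.
Qed.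

Lemma mixing_grid (j : nat) (g : R -> R) (T S : {set idx}) :
  T != finset.set0 -> S != finset.set0 ->
  (forall k l, k \in T -> l \in S -> l \notin N k) ->
  diam (grid_union lam T) <= d%:R * (2 * s) ->
  mixing_test j g (grid_union lam T) ->
  (`| covariance P (fun w => (partial_sum Y T w ^+ j)%R)
                   (fun w => g (partial_sum Y S w)) | <= mixing_error%:E)%E.
Proof.
move=> /set0Pn[k0 k0T] /set0Pn[l0 l0S] TS dT tst.
have sub (U : {set idx}) : grid_union lam U `<=` window lam by exact: grid_union_window.
have far : s <= set_dist (grid_union lam T) (grid_union lam S).
  apply: set_dist_ge.
  - have [x kx] := grid_cube_nonempty lam0 n0 k0.
    by exists x, k0.
  - have [x lx] := grid_cube_nonempty lam0 n0 l0.
    by exists x, l0.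
  - move=> x y [k kT kx] [l lS ly].
    exact: (grid_dist lam0 n0 kx ly (TS _ _ kT lS)).
have dS := @window_diam _ _ lam _ (sub S).
have L1 : 1 <= L by exact: le_trans s1 sL.
have d2 : 1 <= 2 * d%:R :> R by move: d1; lra.
have dL : 1 <= 2 * d%:R * L by exact: mulr_ege1.
have ds : 1 <= 2 * d%:R * s by exact: mulr_ege1.
have dLL : d%:R * L <= 2 * d%:R * L.
  by rewrite -mulrA ler_peMl ?ler1n// mulr_ge0// powR_ge0.
have dT0 := diam_ge0 (grid_union lam T); have dS0 := diam_ge0 (grid_union lam S).
have dTL : diam (grid_union lam T) <= 2 * d%:R * L.
  by apply: le_trans dT _; rewrite mulrCA mulrA; apply: ler_wpM2l.
have logle : g3 * Num.max (ln (Num.max (diam (grid_union lam T))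
    (diam (grid_union lam S)))) 1 <= set_dist (grid_union lam T) (grid_union lam S).
  apply: le_trans far; apply: le_trans log_s; apply: (ler_wpM2l (ltW g30)).
  rewrite ge_max !le_max lexx orbT andbT; apply/orP; left.
  set D := Num.max _ _.
  have DL : D <= 2 * d%:R * L by rewrite /D ge_max dTL/= (le_trans dS).
  (* A vanishing diameter is covered by the convention that [ln] is 0 on nonpositive arguments. *)
  have [D0|D0] := leP D 0; first by rewrite ln0// ln_ge0.
  by rewrite ler_ln// posrE; lra.
have := mix tst (grid_union_hyperrects lam0 n0 S s1) (sub S) logle.
have eqU (U : {set idx}) : centered_score_sum P X xi lam (grid_union lam U) = partial_sum Y U.
  by apply/funext => w; exact: (centered_score_sum_grid_union lam0 n0 xiS C0 cubeC).
rewrite !eqU => /le_trans; apply; rewrite lee_fin /mixing_error.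
have /andP[r0 r1] := rate_s far.
have max0 x : 0 <= Num.max x 1 :> R by rewrite le_max ler01 orbT.
have max1 x : 0 <= g1 * Num.max x 1 by apply: mulr_ge0 => //; exact: ltW.
apply: ler_pM => //; first exact: mulr_ge0.
apply: ler_pM => //.
  apply: (ler_wpM2l (ltW g10)); apply: max_powR_le => //.
  by rewrite dT0 (le_trans dT)// mulrCA mulrA.
by apply: max_powR_le => //; rewrite dS0 (le_trans dS).
Qed.

Let Y3 k : L3 P (Y k).
Proof. by have [] := centered_score_sum_cube lam0 n0 xiS C0 cubeC k. Qed.

Let EY k : Ex (Y k) = 0.
Proof. by have [] := centered_score_sum_cube lam0 n0 xiS C0 cubeC k. Qed.

Let YS3 S : L3 P (partial_sum Y S).
Proof. exact: L3_sum. Qed.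

Let gYS3 S g : bounded_test g \/ g = id -> L3 P (fun w => g (partial_sum Y S w)).
Proof.
by case=> [gb|->//]; apply: bounded_test_L3 => //; case: (YS3 S).
Qed.

Let partial_sum1 k w : partial_sum Y [set k] w = Y k w.
Proof. by rewrite /partial_sum big_set1. Qed.

Let partial_sum0 w : partial_sum Y finset.set0 w = 0.
Proof. by rewrite /partial_sum big_set0. Qed.

Let grid_union1 k : grid_union lam [set k] = cube k.
Proof.
by apply/seteqP; split=> [x [l /set1P ->]//|x kx]; exists k => //; exact: set11.
Qed.

Let grid_union2 k l : grid_union lam [set k; l] = cube k `|` cube l.
Proof.
apply/seteqP; split=> [x [i /set2P[->|->]]|x [kx|lx]]; [by left|by right| |].
  by exists k => //; exact: set21.
by exists l => //; exact: set22.
Qed.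

Lemma mixing_grid1 k g : bounded_test g \/ g = id ->
  `|Ex (fun w => Y k w * g (partial_sum Y (~: N k) w))| <= mixing_error.
Proof.
move=> gt; have gL := gYS3 (~: N k) gt.
have [S0|S0] := eqVneq (~: N k) finset.set0.
  rewrite S0; under eq_Rintegral do rewrite partial_sum0 mulrC.
  rewrite RintegralZl//; last exact: L3_integrable.
  by rewrite EY mulr0 normr0 mixing_error_ge0.
have h1 : hyperrect1 (grid_union lam [set k]).
  by rewrite grid_union1; exact: grid_hyperrect1.
rewrite -lee_fin; apply: le_trans (@mixing_grid 1 g [set k] (~: N k) _ S0 _ _ _).
- have -> : (fun w => partial_sum Y [set k] w ^+ 1) = Y k.
    by apply/funext => w; rewrite expr1 partial_sum1.
  rewrite covariance_Rintegral; [|exact: L3_integrable..|exact: integrable_mul2].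
  by rewrite EY mul0r subr0.
- by apply/set0Pn; exists k; exact: set11.
- by move=> i l /set1P ->; rewrite inE.
- rewrite grid_union1; apply: le_trans (grid_cube_diam lam0 n0 k) _.
  by apply: ler_wpM2l => //; move: s1; lra.
- by left.
Qed.

(** [S] may be any set off both neighbourhoods: polarization uses the same [S] for the pairs [k, l],
    [k, k] and [l, l], a cube being incident to itself. *)
Lemma mixing_grid2 k l g (S : {set idx}) : bounded_test g -> l \in N k ->
  S \subset ~: (N k :|: N l) -> S != finset.set0 ->
  `|Ex (fun w => partial_sum Y [set k; l] w ^+ 2 * g (partial_sum Y S w)) -
    Ex (fun w => partial_sum Y [set k; l] w ^+ 2) *
    Ex (fun w => g (partial_sum Y S w))| <= mixing_error.
Proof.
move=> gb lk SN S0; have gL := gYS3 S (or_introl gb).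
have h2 : hyperrect2 (grid_union lam [set k; l]).
  by rewrite grid_union2; exact: grid_hyperrect2.
rewrite -lee_fin; apply: le_trans (@mixing_grid 2 g [set k; l] S _ S0 _ _ _).
- rewrite covariance_Rintegral//.
  + by apply: eq_integrabler (integrable_mul2 (YS3 [set k; l]) (YS3 [set k; l])) => w.
  + exact: L3_integrable.
  + by apply: eq_integrabler (integrable_mul3 (YS3 [set k; l]) (YS3 [set k; l]) gL) => w.
- by apply/set0Pn; exists k; exact: set21.
- move=> i j /set2P[->|->] /(fintype.subsetP SN); rewrite finset.in_setC finset.in_setU negb_or;
  by case/andP.
- by rewrite grid_union2; exact: grid_pair_diam.
- by right.
Qed.

Lemma mixing_grid_product k l g : l \in N k -> bounded_test g ->
  `|Ex (fun w => Y k w * Y l w * g (partial_sum Y (~: (N k :|: N l)) w)) -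
    Ex (fun w => Y k w * Y l w) *
    Ex (fun w => g (partial_sum Y (~: (N k :|: N l)) w))| <= 3 / 2 * mixing_error.
Proof.
move=> lk gb; set S := ~: _.
have e0 := mixing_error_ge0.
have gL := gYS3 S (or_introl gb).
have [S0|S0] := eqVneq S finset.set0.
  rewrite S0; under eq_Rintegral do rewrite partial_sum0 mulrC.
  rewrite RintegralZl//; last exact: integrable_mul2.
  under [X in _ - _ * X]eq_Rintegral do rewrite partial_sum0.
  by rewrite probability_Rintegral_cst mulrC subrr normr0 mulr_ge0.
have kk : k \in N k by rewrite inE; apply/forallP => i; rewrite leqnSn.
have ll : l \in N l by rewrite inE; apply/forallP => i; rewrite leqnSn.
have SS1 : S \subset ~: (N k :|: N k) by rewrite finset.setUid finset.setCS finset.subsetUl.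
have SS2 : S \subset ~: (N l :|: N l) by rewrite finset.setUid finset.setCS finset.subsetUr.
have Skl := mixing_grid2 gb lk (subxx S) S0.
have Sk := mixing_grid2 gb kk SS1 S0; have Sl := mixing_grid2 gb ll SS2 S0.
move: Sk Sl; rewrite !finset.setUid.
have sq i : (fun w => partial_sum Y [set i] w ^+ 2) = (fun w => Y i w * Y i w).
  by apply/funext => w; rewrite partial_sum1.
have sqG i : (fun w => partial_sum Y [set i] w ^+ 2 * g (partial_sum Y S w)) =
    (fun w => Y i w * Y i w * g (partial_sum Y S w)).
  by apply/funext => w; rewrite partial_sum1.
rewrite !sq !sqG => Sk Sl.
have [kl|kl] := eqVneq k l.
  by subst l; apply: le_trans Sk _; move: e0; lra.
have pkl w : partial_sum Y [set k; l] w = Y k w + Y l w.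
  by rewrite /partial_sum big_setU1 ?inE// big_set1.
have i2 i j : P.-integrable setT (EFin \o (fun w => Y i w * Y j w)).
  exact: integrable_mul2.
have i3 i j : P.-integrable setT (EFin \o
    (fun w => Y i w * Y j w * g (partial_sum Y S w))).
  exact: integrable_mul3.
have E2 : Ex (fun w => partial_sum Y [set k; l] w ^+ 2) =
    Ex (fun w => Y k w * Y k w) + 2 * Ex (fun w => Y k w * Y l w)
    + Ex (fun w => Y l w * Y l w).
  rewrite -RintegralZl// -!RintegralD//; last exact: integrable_mulrl.
    by apply: eq_Rintegral => w _; rewrite pkl; ring.
  by apply: integrable_addr => //; exact: integrable_mulrl.
have E3 : Ex (fun w => partial_sum Y [set k; l] w ^+ 2 * g (partial_sum Y S w)) =
    Ex (fun w => Y k w * Y k w * g (partial_sum Y S w))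
    + 2 * Ex (fun w => Y k w * Y l w * g (partial_sum Y S w))
    + Ex (fun w => Y l w * Y l w * g (partial_sum Y S w)).
  rewrite -RintegralZl// -!RintegralD//; last exact: integrable_mulrl.
    by apply: eq_Rintegral => w _; rewrite pkl; ring.
  by apply: integrable_addr => //; exact: integrable_mulrl.
exact: (polarization_le E3 E2 Sk Sl Skl).
Qed.

Lemma wasserstein_grid_le (mu sigma : R) : stationary P X -> has_intensity P X mu ->
  1 <= sigma -> 'V_P[total_score X xi lam]%E = (sigma ^+ 2)%:E ->
  (wasserstein P (normalized_score P X xi lam) PZ Z <=
   (stein_const * n%:R ^+ d *
     ((2 + 3 / 2 * 3 ^+ d) * mixing_error * sigma^-1 +
      27 * (3 ^+ d) ^+ 2 * (5 * (3 * C + 1) * (2 * s) ^+ d) ^+ 3 * sigma^-1 ^+ 3))%:E)%E.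
Proof.
move=> statX muX sigma1 VE.
have e0 := mixing_error_ge0.
pose m := (Num.truncn s).+1.
have s0 : 0 <= s by exact: le_trans s1.
have m2 : m%:R <= 2 * s.
  have := truncn_le s; rewrite s0 /m -(natr1 (Num.truncn s)).
  by move: s1; lra.
have kap : 0 < 5 * (3 * C + 1) by move: C0; lra.
set t := 5 * (3 * C + 1) * (2 * s) ^+ d.
have t0 : 0 < t by rewrite mulr_gt0// exprn_gt0//; move: s1; lra.
have Yt k : Ex (fun w => `|Y k w| ^+ 3) <= t ^+ 3.
  have [_ _] := centered_score_sum_cube lam0 n0 xiS C0 cubeC k.
  move=> /le_trans; apply; rewrite lerXn2r ?nnegrE ?(ltW t0)//.
    by apply: mulr_ge0; [exact: ltW|exact: exprn_ge0].
  by apply: (ler_wpM2l (ltW kap)); rewrite lerXn2r ?nnegrE// mulr_ge0.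
have := @local_stein_wasserstein _ _ _ _ _ P PZ Z ZN idx Y N (3 ^ d) t mixing_error
  (3 / 2 * mixing_error) sigma (normalized_score P X xi lam) Y3 Yt t0 (@card_grid_nbhd d n)
  e0 _ mixing_grid1 mixing_grid_product sigma1.
move=> /(_ _ _ _ _)/le_trans; apply.
- by rewrite mulr_ge0.
- have := variance_total_score_grid lam0 n0 xiS C0 cubeC statX muX.
  by rewrite VE => -[].
- rewrite /normalized_score.
  apply: measurable_funM => //; apply: measurable_funB => //.
  exact: measurable_total_score.
- apply: filterS (total_score_centered_grid lam0 n0 xiS C0 cubeC statX muX) => w wE.
  by rewrite /normalized_score wE VE sqrtr_sqr ger0_norm 1?mulrC// (le_trans ler01).
rewrite lee_fin card_ffun !card_ord !natrX le_eqVlt; apply/orP; left; apply/eqP.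
ring.
Qed.

End local_mixing.

(** * Passage from the mesh to a free scale *)

Section scale.
Context {R : realType} {d : nat} {dM dO dZ : measure_display}.
Context {M : measurableType dM} {Om : measurableType dO} {OmZ : measurableType dZ}.
Variables (P : probability Om R) (PZ : probability OmZ R) (Z : {RV PZ >-> R}).
Hypothesis ZN : distribution PZ Z = normal_prob 0 1.
Local Notation pt := (d.-tuple R).
Local Notation conf := (marked_config R d M).
Local Notation Ex f := (Rintegral P setT f).
Variables (X : @marked_point_process R d dM dO M Om).
Variable (xi : pt * M -> conf -> set pt -> R).
Hypotheses (d0 : (0 < d)%N) (xiS : is_score xi).
Variable C : R.
Hypothesis C0 : 0 < C.
Hypothesis cubeC : forall lam v, 0 < lam ->
  (\int[P]_w (cube_score_sum X xi lam v w ^+ 3)%:E <= C%:E)%E.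
Variable mu : R.
Hypotheses (statX : stationary P X) (muX : has_intensity P X mu).
Local Notation L lam := (lam `^ d%:R^-1).

Lemma side_exp (lam : R) : 0 <= lam -> L lam ^+ d = lam.
Proof.
move=> lam0; rewrite -powR_mulrn ?powR_ge0// -powRrM mulVf ?powRr1//.
by rewrite pnatr_eq0 -lt0n.
Qed.

(** The number of cubes per side is an integer, so [r] is met only up to a factor 2: with [n] the
    integer part of [L / r], [n >= 1] gives [L / r < n + 1 <= 2 * n]. *)
Lemma mesh_scale (lam r : R) : 0 < lam -> 1 <= r <= L lam ->
  exists n, [/\ (0 < n)%N, n%:R * r <= L lam, r <= mesh (d := d) lam n &
    mesh (d := d) lam n <= 2 * r].
Proof.
move=> lam0 /andP[r1 rL]; have r0 : 0 < r by lra.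
have Lr0 : 0 <= L lam / r by rewrite divr_ge0 ?powR_ge0// ltW.
pose n := Num.truncn (L lam / r).
have /andP[n1 n2] := truncn_itv Lr0; rewrite -/n in n1 n2.
have n0 : (0 < n)%N by rewrite /n truncn_gt0 ler_pdivlMr// mul1r.
have n0R : 0 < n%:R :> R by rewrite ltr0n.
have ge1 : 1 <= n%:R :> R by rewrite ler1n.
exists n; split=> //.
- by rewrite -ler_pdivlMr.
- by rewrite /mesh ler_pdivlMr// mulrC -ler_pdivlMr.
- rewrite /mesh ler_pdivrMr//; move: n2; rewrite ltr_pdivrMr// -(natr1 n).
  nra.
Qed.

(** [K] is fixed before [rate], [lam] and [r], so either kind of mixing is settled by a choice of
    [r]. The first summand is the number of cubes times the mixing error, the second the moment
    term. *)
Lemma wasserstein_scale_le (g0 g1 : R) : 0 < g0 -> 0 < g1 ->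
  exists2 K : R, 0 < K & forall (g3 : R) (rate : R -> R) (lam r sigma : R),
  0 < g3 -> 0 < lam ->
  (forall (j : nat) (g : R -> R) (A B : set pt), mixing_test j g A ->
    disjoint_hyperrects B -> B `<=` window lam ->
    g3 * Num.max (ln (Num.max (diam A) (diam B))) 1 <= set_dist A B ->
    (`| covariance P (fun w => (centered_score_sum P X xi lam A w ^+ j)%R)
                     (fun w => g (centered_score_sum P X xi lam B w)) |
     <= (g1 * Num.max (diam A `^ g0) 1 * Num.max (diam B `^ g0) 1
            * rate (set_dist A B))%:E)%E) ->
  1 <= r <= L lam -> g3 * Num.max (ln (2 * d%:R * L lam)) 1 <= r ->
  (forall x y, r <= x <= y -> 0 <= rate y <= rate x) ->
  1 <= sigma -> 'V_P[total_score X xi lam]%E = (sigma ^+ 2)%:E ->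
  (wasserstein P (normalized_score P X xi lam) PZ Z <=
   (K * (lam / r ^+ d * r `^ g0 * L lam `^ g0 * rate r * sigma^-1 +
         lam * r ^+ (2 * d) * sigma^-1 ^+ 3))%:E)%E.
Proof.
move=> g00 g10.
set b1 := stein_const * (2 + 3 / 2 * 3 ^+ d) * g1 * (4 * d%:R) `^ g0 * (2 * d%:R) `^ g0 : R.
(* [8 ^+ d] is the cube of the [2 ^+ d] in the moment bound. One factor [s ^+ d] turns the number of
   cubes into [lam]; the remaining two are bounded through [s <= 2 * r], whence [4 ^+ d]. *)
set b2 := stein_const * 27 * (3 ^+ d) ^+ 2 * (5 * (3 * C + 1)) ^+ 3 * 8 ^+ d * 4 ^+ d : R.
have c0 : 0 < @stein_const R by exact: stein_const_gt0.
have b10 : 0 < b1.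
  by rewrite /b1 !mulr_gt0// ?powR_gt0 ?mulr_gt0 ?ltr0n// addr_gt0// mulr_gt0// exprn_gt0.
have kap : 0 < 3 * C + 1 by move: C0; lra.
have b20 : 0 < b2 by rewrite /b2 !mulr_gt0// ?exprn_gt0// ?mulr_gt0.
exists (b1 + b2); first exact: addr_gt0.
move=> g3 rate lam r sigma g30 lam0 mix r1L logr rateD sigma1 VE.
have [n [n0 nr rs sr]] := mesh_scale lam0 r1L.
have /andP[r1 rL] := r1L.
have r0 : 0 < r by lra.
set s := mesh lam n in rs sr.
have s1 : 1 <= s by exact: le_trans rs.
have rate_s x : s <= x -> 0 <= rate x <= rate s by move=> sx; apply: rateD; rewrite rs.
have log_s := le_trans logr rs.
have := wasserstein_grid_le ZN d0 lam0 n0 xiS C0 cubeC g00 g10 g30 mix s1 rate_s log_s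
  statX muX sigma1 VE.
move=> /le_trans; apply; rewrite lee_fin.
have si0 : 0 < sigma^-1 by rewrite invr_gt0; lra.
have L0 : 0 <= L lam by exact: powR_ge0.
have LE := side_exp (ltW lam0).
have ns : n%:R * s = L lam by rewrite /s /mesh mulrC divfK// pnatr_eq0 -lt0n.
have main2 : stein_const * n%:R ^+ d * (27 * (3 ^+ d) ^+ 2 *
    (5 * (3 * C + 1) * (2 * s) ^+ d) ^+ 3 * sigma^-1 ^+ 3) <=
    b2 * (lam * r ^+ (2 * d) * sigma^-1 ^+ 3).
  have e8 : 8 ^+ d = (2 ^+ d) ^+ 3 :> R by rewrite exprAC; congr (_ ^+ d); ring.
  have eL : n%:R ^+ d * s ^+ d = lam by rewrite -exprMn ns LE.
  pose B := stein_const * 27 * (3 ^+ d) ^+ 2 * (5 * (3 * C + 1)) ^+ 3 * 8 ^+ d * sigma^-1 ^+ 3.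
  have -> : stein_const * n%:R ^+ d * (27 * (3 ^+ d) ^+ 2 *
      (5 * (3 * C + 1) * (2 * s) ^+ d) ^+ 3 * sigma^-1 ^+ 3) =
    B * (n%:R ^+ d * s ^+ d * (s ^+ d) ^+ 2).
    by rewrite /B e8 (exprMn _ 2 s); move: (n%:R ^+ d) (s ^+ d) (3 ^+ d) (2 ^+ d); intros; ring.
  have -> : b2 * (lam * r ^+ (2 * d) * sigma^-1 ^+ 3) =
    B * (n%:R ^+ d * s ^+ d * (4 ^+ d * r ^+ (2 * d))).
    by rewrite eL /b2 /B; move: (r ^+ _) (8 ^+ d) (3 ^+ d) (4 ^+ d); intros; ring.
  have B0 : 0 <= B by rewrite /B !mulr_ge0 ?exprn_ge0 ?mulr_ge0 ?ltW.
  apply: (ler_wpM2l B0); rewrite eL; apply: (ler_wpM2l (ltW lam0)).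
  rewrite exprM -[in leRHS]exprMn exprAC.
  rewrite lerXn2r ?nnegrE ?mulr_ge0 ?sqr_ge0 ?(ltW r0)//.
  have -> : 4 * r ^+ 2 = (2 * r) ^+ 2 by ring.
  by rewrite lerXn2r ?nnegrE ?mulr_ge0 ?(ltW r0)// (le_trans ler01).
have main1 : stein_const * n%:R ^+ d * ((2 + 3 / 2 * 3 ^+ d) *
    mixing_error (d := d) lam n g0 g1 rate * sigma^-1) <=
    b1 * (lam / r ^+ d * r `^ g0 * L lam `^ g0 * rate r * sigma^-1).
  have nd : n%:R ^+ d <= lam / r ^+ d.
    rewrite -[in leRHS]LE -expr_div_n lerXn2r ?nnegrE ?divr_ge0 ?(ltW r0)//.
    by rewrite ler_pdivlMr.
  have sg : (2 * d%:R * s) `^ g0 <= (4 * d%:R) `^ g0 * r `^ g0.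
    rewrite -powRM ?mulr_ge0 ?(ltW r0)//.
    have s0 : 0 <= s by exact: le_trans s1.
    apply: ge0_ler_powR; rewrite ?nnegrE ?(ltW g00) ?(mulr_ge0 _ s0) ?(mulr_ge0 _ (ltW r0))//.
    have -> : 4 * d%:R * r = 2 * d%:R * (2 * r) by ring.
    by apply: ler_wpM2l => //; rewrite mulr_ge0.
  have Lg : (2 * d%:R * L lam) `^ g0 = (2 * d%:R) `^ g0 * L lam `^ g0.
    by rewrite powRM// mulr_ge0.
  have /andP[rt0 rt1] : 0 <= rate s <= rate r by apply: rateD; rewrite lexx.
  rewrite /mixing_error Lg -/s.
  pose A := stein_const * (2 + 3 / 2 * 3 ^+ d) * g1 * (2 * d%:R) `^ g0 * L lam `^ g0 * sigma^-1.
  have -> : stein_const * n%:R ^+ d * ((2 + 3 / 2 * 3 ^+ d) *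
      (g1 * (2 * d%:R * s) `^ g0 * ((2 * d%:R) `^ g0 * L lam `^ g0) * rate s) * sigma^-1) =
    A * (n%:R ^+ d * (2 * d%:R * s) `^ g0 * rate s).
    rewrite /A; move: (n%:R ^+ d) (3 ^+ d) (_ `^ g0) (_ `^ g0) (_ `^ g0) (rate s).
    by intros; ring.
  have -> : b1 * (lam / r ^+ d * r `^ g0 * L lam `^ g0 * rate r * sigma^-1) =
    A * (lam / r ^+ d * ((4 * d%:R) `^ g0 * r `^ g0) * rate r).
    rewrite /A /b1; move: (lam / r ^+ d) (3 ^+ d) (_ `^ g0) (_ `^ g0) (_ `^ g0) (_ `^ g0) (rate r).
    by intros; ring.
  have A0 : 0 <= A.
    by rewrite /A !mulr_ge0 ?powR_ge0 ?(ltW c0) ?(ltW g10) ?(ltW si0)// addr_ge0 ?mulr_ge0.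
  apply: (ler_wpM2l A0); apply: ler_pM => //.
    by rewrite mulr_ge0 ?powR_ge0 ?exprn_ge0.
  by apply: ler_pM => //; rewrite ?powR_ge0 ?exprn_ge0.
have T10 : 0 <= lam / r ^+ d * r `^ g0 * L lam `^ g0 * rate r * sigma^-1.
  have /andP[rt0 _] : 0 <= rate r <= rate r by apply: rateD; rewrite !lexx.
  rewrite mulr_ge0 ?(ltW si0)// mulr_ge0// !mulr_ge0 ?powR_ge0 ?(ltW lam0)//.
  by rewrite invr_ge0 exprn_ge0 ?(ltW r0).
have T20 : 0 <= lam * r ^+ (2 * d) * sigma^-1 ^+ 3.
  by rewrite !mulr_ge0 ?exprn_ge0 ?(ltW si0) ?(ltW lam0) ?(ltW r0).
rewrite [in leLHS]mulrDr; apply: le_trans (lerD main1 main2) _.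
move: T10 T20; move: (_ * sigma^-1) (_ * sigma^-1 ^+ 3) => T1 T2 T10 T20.
have := mulr_ge0 (ltW b20) T10; have := mulr_ge0 (ltW b10) T20.
lra.
Qed.

End scale.

(** * Growth of powers, logarithm and variance *)

Section growth.
Context {R : realType}.
Implicit Types a b k lam : R.

Lemma powR_near_ge a k : 0 < a -> \forall lam \near +oo, k <= lam `^ a.
Proof.
move=> a0; have [k0|k0] := leP k 0.
  by near=> lam; rewrite (le_trans k0)// powR_ge0.
near=> lam.
have -> : k = k `^ a^-1 `^ a by rewrite -powRrM mulVf ?gt_eqF// powRr1// ltW.
apply: ge0_ler_powR; rewrite ?nnegrE ?powR_ge0//; first exact: ltW.
Unshelve. all: by end_near. Qed.

Lemma ln_near_ge k : \forall lam \near (+oo : set_system R), k <= ln lam.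
Proof.
near=> lam.
have : expR k <= lam by near: lam; exact: nbhs_pinfty_ge.
move=> kl; rewrite -[leLHS]expRK ler_ln ?posrE ?expR_gt0//.
Unshelve. all: by end_near. Qed.

(** Half of the exponent dominates the logarithm, the other half the constant. *)
Lemma ln_near_le_powR a k : 0 < a -> \forall lam \near +oo, k * ln lam <= lam `^ a.
Proof.
move=> a0; have a2 : 0 < a / 2 by lra.
near=> lam.
have l1 : 1 <= lam by near: lam; exact: nbhs_pinfty_ge.
have ln0 : 0 <= ln lam by exact: ln_ge0.
have lnle : ln lam <= (a / 2)^-1 * lam `^ (a / 2).
  rewrite mulrC ler_pdivlMr// mulrC -ln_powR.
  by apply/ltW/ln_sublinear/powR_gt0; lra.
have kp : `|k| * (a / 2)^-1 <= lam `^ (a / 2) by near: lam; exact: powR_near_ge.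
have -> : a = a / 2 + a / 2 by lra.
rewrite powRD; last by apply/implyP => _; rewrite gt_eqF//; lra.
apply: (@le_trans _ _ (`|k| * ((a / 2)^-1 * lam `^ (a / 2)))).
  apply: (@le_trans _ _ (`|k| * ln lam)); first by rewrite ler_wpM2r ?ler_norm.
  by rewrite ler_wpM2l.
by rewrite mulrA ler_wpM2r ?powR_ge0.
Unshelve. all: by end_near. Qed.

End growth.

Section variance.
Context {R : realType} {d : nat} {dM dO : measure_display}.
Context {M : measurableType dM} {Om : measurableType dO}.
Variable P : probability Om R.
Local Notation pt := (d.-tuple R).
Local Notation conf := (marked_config R d M).
Local Notation Ex f := (Rintegral P setT f).
Variables (X : @marked_point_process R d dM dO M Om).
Variable (xi : pt * M -> conf -> set pt -> R).
Hypotheses (d0 : (0 < d)%N) (xiS : is_score xi).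
Variable C : R.
Hypothesis C0 : 0 < C.
Hypothesis cubeC : forall lam v, 0 < lam ->
  (\int[P]_w (cube_score_sum X xi lam v w ^+ 3)%:E <= C%:E)%E.

(** The whole window is covered by at most [2 * L] unit cubes per side; [4 ^+ d] is the square of
    that factor 2 in each dimension, and 3 comes from [Rintegral_mul2_le]. *)
Lemma variance_total_score_le (lam : R) : 1 <= lam ->
  exists v, ('V_P[total_score X xi lam] = v%:E)%E /\
    v <= 3 * (5 * (3 * C + 1)) ^+ 2 * 4 ^+ d * lam ^+ 2.
Proof.
move=> lam1; have lam0 : 0 < lam by lra.
set L := lam `^ d%:R^-1.
have L1 : 1 <= L by rewrite /L -[leLHS](powRr0 lam) ler_powR// invr_ge0.
pose m := (Num.truncn L).+1.
have m2 : m%:R <= 2 * L.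
  have := truncn_le L; rewrite (le_trans ler01 L1) /m -(natr1 (Num.truncn L)).
  by move: L1; lra.
have Wm (x : pt) : window lam x -> forall i,
    tnth [tuple - (L / 2) | i < d] i <= tnth x i < tnth [tuple - (L / 2) | i < d] i + m%:R.
  move=> Wx i; have /andP[x1 x2] := Wx i; rewrite tnth_mktuple x1/=.
  by apply: le_lt_trans x2 _; have := truncnS_gt L; rewrite -/m -/L; lra.
have [c3 _ cE] := centered_score_sum_L3 xiS C0 cubeC lam0 (ltn0Sn _)
  (measurable_window lam) (@subset_refl _ _) Wm.
set c := centered_score_sum P X xi lam (window lam) in c3 cE.
have kap : 0 < 5 * (3 * C + 1) by move: C0; lra.
set kappa := 5 * (3 * C + 1) in kap cE *.
exists (Ex (fun w => c w * c w)); split.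
  rewrite /Rintegral fineK; last by apply: integrable_fin_num => //; exact: integrable_mul2.
  by rewrite /variance unlock unlock /c /centered_score_sum unlock.
have t0 : 0 < kappa * m%:R ^+ d by rewrite mulr_gt0// exprn_gt0// ltr0n.
apply: le_trans (ler_norm _) _.
apply: le_trans (le_normr_Rintegral _ (integrable_mul2 c3 c3)) _ => //.
apply: le_trans (Rintegral_mul2_le t0 c3 c3 cE cE) _.
rewrite exprMn mulrA -[leRHS]mulrA; apply: ler_wpM2l; first by rewrite mulr_ge0 ?sqr_ge0.
rewrite -[lam in leRHS](side_exp d0 (ltW lam0)) -!exprM (mulnC d 2) !exprM -exprMn -/L.
have L0 : 0 <= L by lra.
rewrite lerXn2r ?nnegrE ?mulr_ge0 ?sqr_ge0//.
have -> : 4 * L ^+ 2 = (2 * L) ^+ 2 by ring.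
by rewrite lerXn2r ?nnegrE ?ler0n ?mulr_ge0.
Qed.

Lemma variance_growth_le2 (nu c : R) : 0 < c ->
  (\forall lam \near +oo, ((c * lam `^ nu)%:E <= 'V_P[total_score X xi lam])%E) ->
  nu <= 2.
Proof.
move=> c0 Vnu; rewrite leNgt; apply/negP => nu2.
pose K := 3 * (5 * (3 * C + 1)) ^+ 2 * 4 ^+ d.
near (pinfty_nbhs R) => lam.
have l1 : 1 <= lam by near: lam; exact: nbhs_pinfty_ge.
have lam0 : 0 < lam by lra.
have [v [VE vle]] := variance_total_score_le l1.
have : ((c * lam `^ nu)%:E <= 'V_P[total_score X xi lam])%E by near: lam.
rewrite VE lee_fin => /le_trans/(_ vle); rewrite -/K => cK.
have : K / c + 1 <= lam `^ (nu - 2).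
  by near: lam; apply: powR_near_ge; lra.
have E : lam `^ nu = lam `^ (nu - 2) * lam ^+ 2.
  rewrite -powR_mulrn ?(ltW lam0)// -powRD; first by congr (_ `^ _); ring.
  by rewrite (gt_eqF lam0) implybT.
move: cK; rewrite E mulrA ler_pM2r ?exprn_gt0// mulrC -ler_pdivlMr// => cK.
by move=> /le_trans/(_ cK); lra.
Unshelve. all: by end_near. Qed.

End variance.

(** * Exponents under polynomial mixing *)

Section rate_exponents.
Context {R : realType}.
Variables (d : nat) (nu g0 g2 : R).
Hypotheses (d0 : (0 < d)%N) (nu23 : 2 / 3 < nu) (nu2 : nu <= 2).
Hypotheses (g00 : 0 < g0) (g20 : 0 < g2).

Let x1 : 1 <= d%:R :> R. Proof. by rewrite ler1n. Qed.

Local Notation gamma2_large :=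
  (Num.max (3 * (- nu * d%:R + 2 * d%:R + 2 * g0) / (3 * nu - 2))
           (6 * (- nu * d%:R + d%:R + g0) / (3 * nu - 2) + g0) < g2).

(** If the difference were at most 0, clearing the denominator in the second condition would give 3
    nu d + 6 g0 < 0. *)
Let large_gap : gamma2_large -> 0 < 3 * d%:R + g2 - g0.
Proof.
rewrite gt_max => /andP[_]; have D0 : 0 < 3 * nu - 2 by move: nu23; lra.
rewrite -ltrBrDr ltr_pdivrMr// => h; rewrite ltNge; apply/negP => b0.
have h1 : 0 <= (3 * nu - 2) * (g0 - g2 - 3 * d%:R) by rewrite mulr_ge0 ?(ltW D0)//; lra.
have h2 : 0 < nu * d%:R by rewrite mulr_gt0//; move: nu23 x1; lra.
by move: h h1 h2 g00; lra.
Qed.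

(** If [g0 >= 3 * d%:R + g2], the first quotient in [tau] is at least 2, whereas it must stay below
    [nu - 2 / 3], which is at most 4/3 as [nu <= 2]. *)
Let tau_gap : tau d nu g0 g2 < 3 / 2 * nu - 1 -> 0 < 3 * d%:R + g2 - g0.
Proof.
have a0 : 0 < 3 * d%:R + g2 by move: x1 g20; lra.
have -> : 3 / 2 * nu - 1 = 3 / 2 * (nu - 2 / 3) by field.
rewrite /tau ltr_pM2l; last by lra.
rewrite gt_max ltr_pdivrMr// => /andP[h _]; rewrite ltNge; apply/negP => b0.
have h1 : 0 <= (2 - nu) * d%:R by rewrite mulr_ge0//; move: nu2; lra.
have h2 : 0 <= (2 - nu) * g2 by rewrite mulr_ge0 ?(ltW g20)//; move: nu2; lra.
by move: h b0 h1 h2 x1 g20; lra.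
Qed.

(** Either side makes the second denominator of [tau] positive. Denominators can then be cleared,
    and the entries of the two maxima correspond one to one. *)
Lemma gamma2_large_tau : gamma2_large <-> tau d nu g0 g2 < 3 / 2 * nu - 1.
Proof.
have D0 : 0 < 3 * nu - 2 by move: nu23; lra.
have a0 : 0 < 3 * d%:R + g2 by move: x1 g20; lra.
suff E : 0 < 3 * d%:R + g2 - g0 -> gamma2_large = (tau d nu g0 g2 < 3 / 2 * nu - 1).
  by split=> h; [rewrite -E//; exact: large_gap|rewrite E//; exact: tau_gap].
move=> b0.
have -> : 3 / 2 * nu - 1 = 3 / 2 * (nu - 2 / 3) by field.
rewrite /tau ltr_pM2l; last by lra.
rewrite !gt_max -ltrBrDr !ltr_pdivrMr//.
by congr andb; apply/idP/idP => h; lra.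
Qed.

Hypothesis large : gamma2_large.

Lemma tau_gt0 : 0 < tau d nu g0 g2.
Proof.
rewrite /tau mulr_gt0 ?divr_gt0// lt_max; apply/orP; left.
have nud : 0 < nu * d%:R by rewrite mulr_gt0//; move: nu23 x1; lra.
by rewrite divr_gt0//; move: nud g00 g20 x1; lra.
Qed.

Lemma tau_le2 : tau d nu g0 g2 <= 2.
Proof. by move/gamma2_large_tau : large; move: nu2; lra. Qed.

(** This is the condition that the mixing term does not exceed the moment term at the scale r =
    lam^(tau/(2d)): the comparison of the exponents of [lam], multiplied by 2d. *)
Lemma tau_gap_ge : 2 * nu * d%:R + 2 * g0 <= tau d nu g0 g2 * (3 * d%:R + g2 - g0).
Proof.
have b0 := large_gap large.
have a0 : 0 < 3 * d%:R + g2 by move: x1 g20; lra.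
have nud0 : 0 < nu * d%:R by rewrite mulr_gt0//; move: nu23 x1; lra.
(* In the first case [3 * d%:R + g2 - g0] is at least two thirds of [3 * d%:R + g2], and the first
   entry of [tau] suffices. In the second, [g0 > d%:R >= nu * d%:R / 2], and the second entry
   does. *)
have [g0a|g0a] := leP (3 * g0) (3 * d%:R + g2).
  have t1 : 3 / 2 * ((2 * nu * d%:R + 2 * g0) / (3 * d%:R + g2)) <= tau d nu g0 g2.
    by rewrite /tau ler_pM2l ?divr_gt0// le_max lexx.
  apply: le_trans (_ : _ <= 3 / 2 * ((2 * nu * d%:R + 2 * g0) / (3 * d%:R + g2)) * (3 * d%:R + g2 - g0)) _.
    set a := 3 * d%:R + g2 in a0 b0 g0a *; set u := 2 * nu * d%:R + 2 * g0.
    have u0 : 0 < u by rewrite /u; move: nud0 g00; lra.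
    rewrite mulrA [leRHS]mulrAC ler_pdivlMr// [leRHS]mulrAC; nra.
  by rewrite ler_pM2r.
have t2 : 3 / 2 * ((nu * d%:R + 2 * g0) / (3 * d%:R + g2 - g0)) <= tau d nu g0 g2.
  by rewrite /tau ler_pM2l ?divr_gt0// le_max lexx orbT.
apply: le_trans (_ : _ <= 3 / 2 * ((nu * d%:R + 2 * g0) / (3 * d%:R + g2 - g0)) * (3 * d%:R + g2 - g0)) _.
  rewrite -[leRHS]mulrA divfK ?gt_eqF//.
  have : 0 <= (2 - nu) * d%:R by rewrite mulr_ge0//; move: nu2; lra.
  by move: g0a g20 nud0; lra.
by rewrite ler_pM2r.
Qed.

End rate_exponents.

Lemma ler_pM5 (R : numDomainType) (a1 a2 a3 a4 a5 b1 b2 b3 b4 b5 : R) :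
  0 <= a1 -> 0 <= a2 -> 0 <= a3 -> 0 <= a4 -> 0 <= a5 ->
  a1 <= b1 -> a2 <= b2 -> a3 <= b3 -> a4 <= b4 -> a5 <= b5 ->
  a1 * a2 * a3 * a4 * a5 <= b1 * b2 * b3 * b4 * b5.
Proof. by move=> *; do 4 (apply: ler_pM => //; rewrite ?mulr_ge0//). Qed.

(** * Rates of convergence *)

Section rates.
Context {R : realType} {d : nat} {dM dO dZ : measure_display}.
Context {M : measurableType dM} {Om : measurableType dO} {OmZ : measurableType dZ}.
Variables (P : probability Om R) (PZ : probability OmZ R) (Z : {RV PZ >-> R}).
Hypothesis ZN : distribution PZ Z = normal_prob 0 1.
Local Notation pt := (d.-tuple R).
Local Notation conf := (marked_config R d M).
Variables (X : @marked_point_process R d dM dO M Om).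
Variable (xi : pt * M -> conf -> set pt -> R).
Hypotheses (d0 : (0 < d)%N) (xiS : is_score xi).
Variable C : R.
Hypothesis C0 : 0 < C.
Hypothesis cubeC : forall lam v, 0 < lam ->
  (\int[P]_w (cube_score_sum X xi lam v w ^+ 3)%:E <= C%:E)%E.
Variable mu : R.
Hypotheses (statX : stationary P X) (muX : has_intensity P X mu).
Variables nu c : R.
Hypotheses (nu23 : 2 / 3 < nu) (c0 : 0 < c).
Hypothesis Vnu :
  \forall lam \near +oo, ((c * lam `^ nu)%:E <= 'V_P[total_score X xi lam])%E.
Local Notation L lam := (lam `^ d%:R^-1).

Let d1 : 1 <= d%:R :> R. Proof. by rewrite ler1n. Qed.

Let e : R := (Num.sqrt c)^-1.

Let e0 : 0 < e. Proof. by rewrite invr_gt0 sqrtr_gt0. Qed.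

Lemma standard_deviation_near : \forall lam \near +oo, exists sigma : R,
  [/\ 1 <= sigma, 'V_P[total_score X xi lam]%E = (sigma ^+ 2)%:E &
      sigma^-1 <= e * lam `^ (- (nu / 2))].
Proof.
have nu0 : 0 < nu by move: nu23; lra.
near=> lam.
have l1 : 1 <= lam by near: lam; exact: nbhs_pinfty_ge.
have [v [VE _]] := variance_total_score_le d0 xiS C0 cubeC l1.
have : ((c * lam `^ nu)%:E <= 'V_P[total_score X xi lam])%E by near: lam.
rewrite VE lee_fin => cv.
have cl : c^-1 <= lam `^ nu by near: lam; exact: powR_near_ge.
have v1 : 1 <= v.
  by apply: le_trans cv; rewrite mulrC -ler_pdivrMr// mul1r.
have p0 : 0 < lam `^ (nu / 2) by apply: powR_gt0; lra.
exists (Num.sqrt v); split.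
- by rewrite -[leLHS]sqrtr1 ler_sqrt//; lra.
- by rewrite sqr_sqrtr//; lra.
rewrite powRN /e -invfM lef_pV2 ?posrE ?mulr_gt0 ?sqrtr_gt0//; last by lra.
rewrite powRrM -[2^-1]/(2^-1) powR12_sqrt ?powR_ge0// -sqrtrM ?ler_sqrt ?(ltW c0)//.
by lra.
Unshelve. all: by end_near. Qed.

Lemma sigma_cube_le (sigma lam : R) : 1 <= sigma ->
  sigma^-1 <= e * lam `^ (- (nu / 2)) ->
  sigma^-1 ^+ 3 <= e ^+ 3 * lam `^ (- (3 / 2) * nu).
Proof.
move=> s1 h; have -> : - (3 / 2) * nu = - (nu / 2) * 3%:R by field.
rewrite powRrM powR_mulrn ?powR_ge0// -exprMn.
by rewrite lerXn2r ?nnegrE ?mulr_ge0 ?powR_ge0 ?(ltW e0)// invr_ge0; lra.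
Qed.

Lemma ln_side_le (lam : R) : 1 <= lam -> ln (2 * d%:R) <= ln lam -> 1 <= ln lam ->
  Num.max (ln (2 * d%:R * L lam)) 1 <= 2 * ln lam.
Proof.
move=> l1 ld le1; rewrite ge_max; apply/andP; split; last by lra.
rewrite lnM ?posrE ?mulr_gt0 ?powR_gt0 ?ltr0n//; last by lra.
rewrite ln_powR.
have : d%:R^-1 * ln lam <= ln lam.
  by rewrite ler_piMl ?invf_le1 ?ltr0n//; lra.
by lra.
Qed.

Lemma exponential_rate : exponential_mixing P X xi ->
  exists K : R, \forall lam \near +oo,
    (wasserstein P (normalized_score P X xi lam) PZ Z
     <= (K * (ln lam ^+ (3 * d) * lam `^ (- (3 / 2) * nu + 1)))%:E)%E.
Proof.
move=> [g0 [g1 [g2 [g3 [[g00 g10 g20 g30] [lam0 lam00 mix]]]]]].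
have [K K0 KP] := wasserstein_scale_le ZN d0 xiS C0 cubeC statX muX g00 g10.
(* The part [2 * g3] meets the logarithmic separation condition. The rest makes the exponential
   factor at the scale [b * ln lam] at most the power of [lam] with exponent - (2 g0 + 3/2 nu),
   which absorbs the polynomial factors. *)
pose b := 2 * g3 + (2 * g0 + 3 / 2 * nu) / g2.
have b' : 0 < (2 * g0 + 3 / 2 * nu) / g2 by rewrite divr_gt0//; move: nu23 g00; lra.
have b0 : 0 < b by rewrite /b; lra.
have bg : 2 * g0 + 3 / 2 * nu <= g2 * b.
  have -> : g2 * b = 2 * (g2 * g3) + (2 * g0 + 3 / 2 * nu) by rewrite /b; field; lra.
  by rewrite lerDr mulr_ge0// mulr_ge0// ltW.
exists (K * (1 + b ^+ (2 * d) * e ^+ 3)).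
have dV0 : 0 < d%:R^-1 :> R by rewrite invr_gt0 ltr0n.
near=> lam.
have l1 : 1 <= lam by near: lam; exact: nbhs_pinfty_ge.
have ll : lam0 <= lam by near: lam; apply: nbhs_pinfty_ge; exact: num_real.
have le1 : 1 <= ln lam by near: lam; exact: ln_near_ge.
have lb : b^-1 <= ln lam by near: lam; exact: ln_near_ge.
have ld : ln (2 * d%:R) <= ln lam by near: lam; exact: ln_near_ge.
have bL : b * ln lam <= L lam by near: lam; exact: ln_near_le_powR.
have [sigma [sigma1 VE sigmaE]] : exists sigma : R,
  [/\ 1 <= sigma, 'V_P[total_score X xi lam]%E = (sigma ^+ 2)%:E &
      sigma^-1 <= e * lam `^ (- (nu / 2))].
  by near: lam; exact: standard_deviation_near.
have l0 : 0 < lam by lra.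
have r1 : 1 <= b * ln lam by rewrite mulrC -ler_pdivrMr// mul1r.
have rL : 1 <= b * ln lam <= L lam by rewrite r1.
have logr : g3 * Num.max (ln (2 * d%:R * L lam)) 1 <= b * ln lam.
  apply: le_trans (_ : _ <= g3 * (2 * ln lam)) _.
    by apply: (ler_wpM2l (ltW g30)); exact: ln_side_le.
  by rewrite mulrCA mulrA; apply: ler_wpM2r; rewrite /b; lra.
have anti x y : b * ln lam <= x <= y -> 0 <= expR (- g2 * y) <= expR (- g2 * x).
  by move=> /andP[_ xy]; rewrite expR_ge0 ler_expR !mulNr lerN2 ler_pM2l.
have := KP g3 (fun r => expR (- g2 * r)) lam (b * ln lam) sigma g30 l0 (mix lam ll) rL
  logr anti sigma1 VE.
move=> /le_trans; apply; rewrite lee_fin -[leRHS]mulrA; apply: (ler_wpM2l (ltW K0)).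
have pD x y : lam `^ (x + y) = lam `^ x * lam `^ y by rewrite powRD// (gt_eqF l0) implybT.
set T := lam `^ (- (3 / 2) * nu + 1).
have T0 : 0 <= T by exact: powR_ge0.
have lnX (k : nat) : (k <= 3 * d)%N -> ln lam ^+ k <= ln lam ^+ (3 * d).
  by move=> kd; exact: ler_weXn2l.
rewrite [leRHS]mulrDl mul1r; apply: lerD.
  apply: le_trans (_ : _ <= T) _; last first.
    by rewrite ler_peMl//; exact: (lnX 0%N).
  (* The factorization matches the mixing term factor by factor, using [r <= L lam <= lam], the
     choice of [b] for the exponential and [sigma^-1 <= 1] for the last factor. *)
  have -> : T = lam * lam `^ g0 * lam `^ g0 * lam `^ (- (3 / 2) * nu - 2 * g0) * 1.
    rewrite mulr1 -[X in X * _ * _ * _](powRr1 (ltW l0)) -!pD /T; congr (_ `^ _); ring.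
  have Lle : L lam <= lam by apply: ler1_powR => //; rewrite invf_le1 ?ltr0n.
  have g0_le x y : 0 <= x -> x <= y -> x `^ g0 <= y `^ g0.
    by move=> x0 xy; apply: ge0_ler_powR => //; rewrite ?nnegrE ?(ltW g00)// (le_trans x0).
  apply: ler_pM5; rewrite ?powR_ge0 ?expR_ge0 ?invr_ge0//.
  - by rewrite divr_ge0 ?exprn_ge0 ?(ltW l0)//; lra.
  - by lra.
  - rewrite ler_pdivrMr ?exprn_gt0//; last by lra.
    by rewrite ler_peMr ?(ltW l0)// exprn_ege1.
  - by apply: g0_le; lra.
  - by apply: g0_le => //; exact: powR_ge0.
  - rewrite /powR (gt_eqF l0) ler_expR; move: le1 bg; nra.
  - by rewrite invf_le1; lra.
apply: le_trans (_ : _ <= lam * (b * ln lam) ^+ (2 * d) * (e ^+ 3 * lam `^ (- (3 / 2) * nu))) _.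
  by apply: ler_wpM2l; [rewrite mulr_ge0 ?exprn_ge0 ?(ltW l0)//; lra|exact: sigma_cube_le].
have -> : T = lam `^ (- (3 / 2) * nu) * lam by rewrite /T pD powRr1 ?(ltW l0).
rewrite exprMn.
have -> : lam * (b ^+ (2 * d) * ln lam ^+ (2 * d)) * (e ^+ 3 * lam `^ (- (3 / 2) * nu)) =
  b ^+ (2 * d) * e ^+ 3 * (ln lam ^+ (2 * d) * (lam `^ (- (3 / 2) * nu) * lam)) by ring.
apply: ler_wpM2l; first by rewrite mulr_ge0 ?exprn_ge0 ?(ltW e0) ?(ltW b0).
apply: ler_wpM2r; first by rewrite mulr_ge0 ?powR_ge0 ?(ltW l0).
(* The moment term carries the power [2 * d] of the logarithm, which is absorbed into [3 * d]. *)
by apply: lnX; rewrite leq_mul2r orbT.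
Unshelve. all: by end_near. Qed.

Section polynomial.
Variables g0 g1 g2 g3 : R.
Hypothesis poly : polynomial_mixing P X xi g0 g1 g2 g3.
Hypothesis large :
  Num.max (3 * (- nu * d%:R + 2 * d%:R + 2 * g0) / (3 * nu - 2))
          (6 * (- nu * d%:R + d%:R + g0) / (3 * nu - 2) + g0) < g2.
Local Notation tau := (tau d nu g0 g2).

Lemma polynomial_rate : exists K : R, \forall lam \near +oo,
  (wasserstein P (normalized_score P X xi lam) PZ Z
   <= (K * lam `^ (- (3 / 2) * nu + 1 + tau))%:E)%E.
Proof.
have [[g00 g10 g20 g30] [lam0 lam00 mix]] := poly.
have nu2 : nu <= 2 := variance_growth_le2 d0 xiS C0 cubeC c0 Vnu.
have tau0 := tau_gt0 d0 nu23 g00 g20.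
have tau2 := tau_le2 d0 nu23 nu2 g00 g20 large.
have gap := tau_gap_ge d0 nu23 nu2 g00 g20 large.
have [K K0 KP] := wasserstein_scale_le ZN d0 xiS C0 cubeC statX muX g00 g10.
have dR0 : 0 < d%:R :> R by rewrite ltr0n.
pose b := tau / (2 * d%:R).
have b0 : 0 < b by apply: divr_gt0 => //; exact: mulr_gt0.
(* From [tau <= 2]; it ensures that the scale does not exceed the side of the window. *)
have bd : b <= d%:R^-1.
  by rewrite /b invfM mulrA ler_piMl ?invr_ge0//; lra.
have tauE : tau = 2 * (d%:R * b) by rewrite /b; field; rewrite gt_eqF.
exists (K * (e + e ^+ 3)).
near=> lam.
have l1 : 1 <= lam by near: lam; exact: nbhs_pinfty_ge.
have ll : lam0 <= lam by near: lam; apply: nbhs_pinfty_ge; exact: num_real.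
have le1 : 1 <= ln lam by near: lam; exact: ln_near_ge.
have ld : ln (2 * d%:R) <= ln lam by near: lam; exact: ln_near_ge.
have gl : 2 * g3 * ln lam <= lam `^ b by near: lam; exact: ln_near_le_powR.
have [sigma [sigma1 VE sigmaE]] : exists sigma : R,
  [/\ 1 <= sigma, 'V_P[total_score X xi lam]%E = (sigma ^+ 2)%:E &
      sigma^-1 <= e * lam `^ (- (nu / 2))].
  by near: lam; exact: standard_deviation_near.
have l0 : 0 < lam by lra.
have r1 : 1 <= lam `^ b by rewrite -[leLHS](powRr0 lam); exact: ler_powR (ltW b0).
have rL : 1 <= lam `^ b <= L lam by rewrite r1; exact: ler_powR.
have logr : g3 * Num.max (ln (2 * d%:R * L lam)) 1 <= lam `^ b.
  apply: le_trans gl; rewrite (mulrC 2 g3) -[leRHS]mulrA; apply: (ler_wpM2l (ltW g30)).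
  exact: ln_side_le.
have anti x y : lam `^ b <= x <= y -> 0 <= y `^ (- g2) <= x `^ (- g2).
  move=> /andP[rx xy]; rewrite powR_ge0 !powRN lef_pV2 ?posrE ?powR_gt0//; try lra.
  by apply: ge0_ler_powR; rewrite ?nnegrE ?(ltW g20)//; lra.
have := KP g3 (fun r => r `^ (- g2)) lam (lam `^ b) sigma g30 l0 (mix lam ll) rL
  logr anti sigma1 VE.
move=> /le_trans; apply; rewrite lee_fin -[leRHS]mulrA; apply: (ler_wpM2l (ltW K0)).
have pD x y : lam `^ (x + y) = lam `^ x * lam `^ y by rewrite powRD// (gt_eqF l0) implybT.
have pX x (k : nat) : (lam `^ x) ^+ k = lam `^ (x * k%:R).
  by rewrite powRrM powR_mulrn ?powR_ge0.
rewrite [leRHS]mulrDl !pX -!powRrM; apply: lerD.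
  set q := lam / _ * _ * _ * _.
  have q0 : 0 <= q by rewrite /q !mulr_ge0 ?powR_ge0 ?invr_ge0 ?(ltW l0)// powR_ge0.
  apply: le_trans (ler_wpM2l q0 sigmaE) _.
  rewrite mulrCA; apply: (ler_wpM2l (ltW e0)).
  rewrite /q -[X in X / lam `^ _](powRr1 (ltW l0)) -powRN -!pD; apply: ler_powR => //.
  (* Twice the required comparison of exponents; multiplied by [d%:R] it becomes [tau_gap_ge]. *)
  have h : 2 * nu + 2 * (d%:R^-1 * g0) <= 2 * b * (3 * d%:R + g2 - g0).
    rewrite -(ler_pM2l dR0); have -> : d%:R * (2 * b * (3 * d%:R + g2 - g0)) =
      tau * (3 * d%:R + g2 - g0) by rewrite tauE; ring.
    apply: le_trans gap; rewrite le_eqVlt; apply/orP; left; apply/eqP.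
    by field; rewrite gt_eqF.
  by rewrite tauE; lra.
apply: le_trans (ler_wpM2l _ (sigma_cube_le sigma1 sigmaE)) _.
  by rewrite mulr_ge0 ?powR_ge0 ?(ltW l0).
rewrite mulrCA; apply: ler_wpM2l; first by rewrite exprn_ge0 ?(ltW e0).
rewrite -[X in X * _ * _](powRr1 (ltW l0)) -!pD; apply: ler_powR => //.
by rewrite natrM tauE; lra.
Unshelve. all: by end_near. Qed.

(** By the equivalence of the two conditions the exponent in the rate is negative; the distance is
    squeezed between 0 and that rate. *)
Lemma polynomial_convergence :
  wasserstein P (normalized_score P X xi lam) PZ Z @[lam --> +oo] --> 0%E.
Proof.
have [[g00 g10 g20 g30] _] := poly.
have nu2 : nu <= 2 := variance_growth_le2 d0 xiS C0 cubeC c0 Vnu.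
have [K KP] := polynomial_rate.
pose a := - (- (3 / 2) * nu + 1 + tau).
have a0 : 0 < a.
  by have /(gamma2_large_tau d0 nu23 nu2 g00 g20) := large; rewrite /a; lra.
have K0 : (K * lam `^ (- a))%:E @[lam --> +oo] --> 0%E.
  apply/fine_cvgP; split; first by near=> lam.
  apply/cvgr0Pnorm_le => r r0; near=> lam => /=.
  have l1 : 1 <= lam by near: lam; exact: nbhs_pinfty_ge.
  have lK : `|K| / r <= lam `^ a by near: lam; exact: powR_near_ge.
  have la : 0 < lam `^ a by apply: powR_gt0; lra.
  rewrite normrM powRN normfV (ger0_norm (ltW la)) ler_pdivrMr// mulrC.
  by rewrite -ler_pdivrMr.
apply: squeeze_cvge (cvg_cst _) K0.
apply: filterS KP => lam; rewrite /a opprK => ->.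
by rewrite wasserstein_ge0.
Unshelve. all: by end_near. Qed.

End polynomial.

End rates.

Theorem theorem1p6 (R : realType) (d : nat)
    (dM dO dZ : measure_display)
    (M : measurableType dM) (Om : measurableType dO) (OmZ : measurableType dZ)
    (P : probability Om R) (PZ : probability OmZ R)
    (X : @marked_point_process R d dM dO M Om)
    (palm : R.-pker (d.-tuple R) ~> (marked_config R d M))
    (xi : d.-tuple R * M -> marked_config R d M -> set (d.-tuple R) -> R)
    (Z : {RV PZ >-> R}) (mu p1 p2 nu : R) :
  (0 < d)%N ->
  stationary P X -> 0 < mu -> has_intensity P X mu ->
  is_palm P X palm -> is_score xi ->
  distribution PZ Z = normal_prob 0 1 ->
  1 <= p1 -> 1 <= p2 -> 3 <= p1 * p2 / (p1 + p2 - 1) ->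
  has_point_moment P X p1 -> has_score_moment xi palm p2 ->
  2 / 3 < nu ->
  (exists2 c : R, 0 < c &
     \forall lam \near +oo,
       ((c * lam `^ nu)%:E <= 'V_P[total_score X xi lam])%E) ->
  (exponential_mixing P X xi ->
     exists C : R, \forall lam \near +oo,
       (wasserstein P (normalized_score P X xi lam) PZ Z
        <= (C * (ln lam ^+ (3 * d) * lam `^ (- (3 / 2) * nu + 1)))%:E)%E) /\
  (forall g0 g1 g2 g3 : R, polynomial_mixing P X xi g0 g1 g2 g3 ->
     let gamma2_large :=
       Num.max (3 * (- nu * d%:R + 2 * d%:R + 2 * g0) / (3 * nu - 2))
               (6 * (- nu * d%:R + d%:R + g0) / (3 * nu - 2) + g0) < g2 in
     (gamma2_large <-> tau d nu g0 g2 < 3 / 2 * nu - 1) /\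
     (gamma2_large ->
        (exists C : R, \forall lam \near +oo,
           (wasserstein P (normalized_score P X xi lam) PZ Z
            <= (C * lam `^ (- (3 / 2) * nu + 1 + tau d nu g0 g2))%:E)%E) /\
        wasserstein P (normalized_score P X xi lam) PZ Z
          @[lam --> +oo] --> 0%E)).
Proof.
move=> d0 statX mu0 muX palmX xiS ZN p11 p21 p123 mom1 mom2 nu23 [c c0 Vnu].
have [C C0 cubeC] := cube_third_moment statX muX palmX xiS p11 p21 p123 mom1 mom2.
split=> [|g0 g1 g2 g3 poly gamma2_large].
  exact: (exponential_rate ZN d0 xiS C0 cubeC statX muX nu23 c0 Vnu).
(* The equivalence of the two conditions also relies on [nu <= 2]. *)
have nu2 := variance_growth_le2 d0 xiS C0 cubeC c0 Vnu.
split=> [|large].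
  by have [[g00 _ g20 _] _] := poly; exact: gamma2_large_tau.
split; first exact: (polynomial_rate ZN d0 xiS C0 cubeC statX muX nu23 c0 Vnu poly large).
exact: (polynomial_convergence ZN d0 xiS C0 cubeC statX muX nu23 c0 Vnu poly large).
Qed.
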